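(* Let $\Omega\subset\mathbb{R}^n$ be a well-covered bounded domain and, for $\epsilon\in(0,\epsilon_0]$, let $\{D_i^\epsilon\}_{i\in I_\epsilon}$ be the corresponding cover of $\Omega_{-\epsilon}$ by well-foliated domains as in the definition of well-covered. Then, with $$C_1(\Omega_{-\epsilon}):=\Big[c_E^{-1}(c_r^+)^2\Big(1+\frac{c_r^++\sqrt{c_Ec_L^+c_r^-}}{c_r^+\inf_{i\in I_\epsilon}\beta_{\inf}(D_i^\epsilon)}\cdot\frac{c_{\mathcal I}^+}{c_r^-}\Big)+\frac{1+\frac{c_r^+}{\sqrt{c_Ec_L^+c_r^-}}}{\inf_{i\in I_\epsilon}\beta_{\inf}(D_i^\epsilon)}\,c_L^+c_{\mathcal I}^+\Big]^{-1},$$ one has $\inf_{\epsilon\in(0,\epsilon_0]}C_1(\Omega_{-\epsilon})>0$ and $$\lambda_2^N(D_i^\epsilon)\ge C_1(\Omega_{-\epsilon})\,\epsilon^{-2}\qquad\text{for all }\epsilon\in(0,\epsilon_0],\ i\in I_\epsilon.$$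
   Context: A domain is an open connected subset of $\mathbb{R}^n$; $\mathrm{vol}_n$ is $n$-dimensional volume. For a domain $D$, $$\lambda_2^N(D):=\inf\Big\{\|\nabla v\|_{L^2(D)}^2/\|v\|_{L^2(D)}^2 : v\in H^1(D)\setminus\{0\},\ \int_D v\,dx=0\Big\}$$ is the first non-trivial Neumann eigenvalue. For $\epsilon>0$, $\Omega_{-\epsilon}:=\{x\in\Omega:\mathrm{dist}(x,\partial\Omega)<\epsilon\}$. Well-foliated. A domain $D\subset\mathbb{R}^n$ is well-foliated if there is a family $\Gamma$ of pairwise disjoint rectifiable, a.e. differentiable paths $\gamma:(0,\mathrm{len}\,\gamma)\to D$, parametrised by arc length, whose images partition $D$ (up to a null set), such that the following hold. Each $\gamma$ is identified with a base point $q=\gamma(0)$ ranging over a subset of an $(n-1)$-dimensional affine hyperplane ($d\gamma$ denotes $(n-1)$-dimensional Lebesgue measure on this subset), and $\varphi(\gamma,t)=\gamma(t)$ is a change of coordinates with density $\beta=|\det D\varphi|$, i.e. $\int_D f\,dx=\int_\Gamma\int_0^{\mathrm{len}\,\gamma}f(\gamma(t))\beta(\gamma,t)\,dt\,d\gamma$ for nonnegative measurable $f$; one also writes $\beta(\gamma(t))=\beta(\gamma,t)$. Moreover, for some number $L$, $0<\inf_\gamma \mathrm{len}\,\gamma\le\sup_\gamma\mathrm{len}\,\gamma<L$, $\operatorname{ess\,inf}_{x\in D}\beta(x)>0$, and $\sup_{\gamma\in\Gamma}\int_0^{\mathrm{len}\,\gamma}\beta(\gamma,t)\,dt<\infty$.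 In this setting one fixes $r\in(0,\inf_\gamma\mathrm{len}\,\gamma)$ and sets $E:=\{\gamma(t):\gamma\in\Gamma,\ 0<t<r\}$, which is a bounded domain. For $S\subset D$: $\beta_{\inf}(S):=\operatorname{ess\,inf}_{x\in S}\beta(x)$ and $\mathcal I_\beta(S):=\sup_{\gamma\in\Gamma}\int_0^{\mathrm{len}\,\gamma}1_S(\gamma(t))\beta(\gamma(t))\,dt$. Well-covered. $\Omega$ is well-covered if there are $\mu\in\mathbb N$ and $\epsilon_0>0$ such that for every $\epsilon\in(0,\epsilon_0]$ there is a family of well-foliated domains $\{D_i^\epsilon\subset\Omega\}_{i\in I_\epsilon}$ with $\mathrm{vol}_n(\Omega_{-\epsilon})=\mathrm{vol}_n(\Omega_{-\epsilon}\cap\bigcup_iD_i^\epsilon)$ and multiplicity $\sup_x\#\{i:x\in D_i^\epsilon\}\le\mu$, with corresponding quantities $r,L,\mathcal I_\beta=\mathcal I_\beta(D_i^\epsilon),E$, satisfying: (i) there are $\delta\in\mathbb R$ and $C(\Omega)\in\mathbb R$ with $\#I_\epsilon\le C(\Omega)\epsilon^{-\delta}$ for all $\epsilon\in(0,\epsilon_0]$; (ii) there are constants $c_r^\pm,c_L^\pm,c_{\mathcal I}^\pm,c_{\mathrm{diam}}^\pm,c_{\mathrm{vol}}^\pm>0$ such that for all $\epsilon\in(0,\epsilon_0]$ and each $D_i^\epsilon$: $\frac r\epsilon\in(c_r^-,c_r^+)$, $\frac L\epsilon\in(c_L^-,c_L^+)$, $\frac{\mathcal I_\beta}\epsilon\in(c_{\mathcal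 I}^-,c_{\mathcal I}^+)$, $\frac{\mathrm{diam}\,D_i^\epsilon}\epsilon\in(c_{\mathrm{diam}}^-,c_{\mathrm{diam}}^+)$, $\frac{\mathrm{vol}_n(D_i^\epsilon)}{\epsilon^n}\in(c_{\mathrm{vol}}^-,c_{\mathrm{vol}}^+)$; (iii) $\inf_{\epsilon,i}\beta_{\inf}(D_i^\epsilon)>0$; (iv) there is $c_E>0$ independent of $\epsilon$ such that for every $D_i^\epsilon$ the corresponding $E$ satisfies $\lambda_2^N(E)\ge c_Er^{-2}$. *)

(* Defs.v *)
From HB Require Import structures.
From mathcomp Require Import all_boot all_order all_algebra.
From mathcomp Require Import all_classical all_reals all_analysis.
From mathcomp Require Import measurable_realfun ess_sup_inf.
Set Implicit Arguments.
Unset Strict Implicit.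
Unset Printing Implicit Defensive.
Import Order.TTheory GRing.Theory Num.Theory.
Import numFieldNormedType.Exports.
Local Open Scope classical_set_scope.
Local Open Scope ring_scope.

(* Points of R^n are row vectors 'rV[R]_n.  The topology and the derivatives
   are the library's; the library's norm on 'rV[R]_n is the sup norm, so that
   distances, diameters and arc lengths use the Euclidean norm [enorm]
   below. *)

(* The library has no measure on R^n for a variable n.  The Borel sigma-algebra
   of 'rV[R]_n is generated by the coordinates (exactly as the library does for
   n.-tuple T), and Lebesgue measure is the iterated product of the
   one-dimensional one, transported along R * R^n = R^(n.+1). *)
Section measurable_rV.
Context {d} {T : sigmaRingType d} {n : nat}.

Let coord : 'I_n -> 'rV[T]_n -> T := fun i x => x ord0 i.

Let rV_set0 : g_sigma_preimage coord set0.
Proof. exact: sigma_algebra0. Qed.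

Let rV_setC A : g_sigma_preimage coord A -> g_sigma_preimage coord (~` A).
Proof. exact: sigma_algebraC. Qed.

Let rV_bigcup (F : _^nat) : (forall i, g_sigma_preimage coord (F i)) ->
  g_sigma_preimage coord (\bigcup_i (F i)).
Proof. exact: sigma_algebra_bigcup. Qed.

HB.instance Definition _ := @isMeasurable.Build (measure_tuple_display d)
  'rV[T]_n (g_sigma_preimage coord) rV_set0 rV_setC rV_bigcup.

End measurable_rV.

Lemma measurable_coord d (T : sigmaRingType d) n (i : 'I_n) :
  measurable_fun [set: 'rV[T]_n] (fun x : 'rV[T]_n => x ord0 i).
Proof.
move=> _ Y mY; rewrite setTI; apply: sub_sigma_algebra => /=.
rewrite -bigcup_seq/=; exists i => /=; first by rewrite mem_index_enum.
by exists Y => //; rewrite setTI.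
Qed.

Lemma measurable_fun_rVP d1 d2 (T1 : measurableType d1)
    (T2 : measurableType d2) n (f : T1 -> 'rV[T2]_n) :
  measurable_fun [set: T1] f <->
  forall i, measurable_fun [set: T1] (fun x => f x ord0 i).
Proof.
split=> [mf i|mf].
  exact: (measurableT_comp (measurable_coord i) mf).
move=> _ A mA; rewrite setTI.
have : (measurable : set (set 'rV[T2]_n)) `<=` [set A | measurable (f @^-1` A)].
  apply: smallest_sub => /=.
    split => /=.
    - by rewrite preimage_set0.
    - by move=> B mB; rewrite setTD -preimage_setC; exact: measurableC.
    - by move=> F mF; rewrite preimage_bigcup; exact: bigcupT_measurable.
  rewrite -bigcup_seq => B [i _] [C mC <-] /=; rewrite setTI.
  by rewrite -[X in measurable X]setTI; exact: mf.
exact.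
Qed.

Section lebesgue_rV.
Context {R : realType}.

Definition rV_cons n (p : R * 'rV[R]_n) : 'rV[R]_n.+1 :=
  \row_i (if unlift ord0 i is Some j then p.2 ord0 j else p.1).

Fixpoint lebesgue_rV n : set 'rV[R]_n -> \bar R :=
  match n with
  | 0 => \d_(0 : 'rV[R]_0)
  | m.+1 => pushforward (lebesgue_measure \x @lebesgue_rV m)%E (@rV_cons m)
  end.

Lemma measurable_rV_cons n : measurable_fun [set: R * 'rV[R]_n] (@rV_cons n).
Proof.
apply/measurable_fun_rVP => i; rewrite /rV_cons.
under eq_fun do rewrite mxE.
case: unliftP => [j _|_]; last exact: measurable_fst.
exact: (measurableT_comp (measurable_coord j) measurable_snd).
Qed.

Let rV_uncons n (x : 'rV[R]_n.+1) : R * 'rV[R]_n :=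
  (x ord0 ord0, \row_j x ord0 (lift ord0 j)).

Let rV_consK n : cancel (@rV_cons n) (@rV_uncons n).
Proof.
move=> [a v]; rewrite /rV_uncons /rV_cons mxE unlift_none; congr pair.
by apply/rowP => j; rewrite !mxE liftK.
Qed.

Let measurable_rV_uncons n : measurable_fun setT (@rV_uncons n).
Proof.
apply/measurable_fun_pairP; split; first exact: measurable_coord.
apply/measurable_fun_rVP => i; rewrite /rV_uncons /=.
under eq_fun do rewrite mxE.
exact: measurable_coord.
Qed.

Section step.
Variables (n : nat) (mu : {sigma_finite_measure set 'rV[R]_n -> \bar R}).

Let nu := pushforward (lebesgue_measure \x mu)%E (@rV_cons n).

Let preimage_measurable A : measurable A -> measurable (@rV_cons n @^-1` A).
Proof.
by move=> mA; rewrite -[X in measurable X]setTI; exact: measurable_rV_cons.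
Qed.

Let nu0 : nu set0 = 0%E.
Proof. by rewrite /nu /pushforward preimage_set0 measure0. Qed.

Let nu_ge0 A : (0 <= nu A)%E.
Proof. by rewrite /nu /pushforward measure_ge0. Qed.

Let nu_sigma_additive : semi_sigma_additive nu.
Proof.
move=> F mF tF mUF; rewrite /nu /pushforward preimage_bigcup.
apply: measure_semi_sigma_additive.
- by move=> k; exact: preimage_measurable.
- apply/trivIsetP => /= i j _ _ ij; rewrite -preimage_setI.
  by move/trivIsetP : tF => /(_ _ _ _ _ ij) ->//; rewrite preimage_set0.
- by rewrite -preimage_bigcup; exact: preimage_measurable.
Qed.

HB.instance Definition _ :=
  isMeasure.Build _ _ _ nu nu0 nu_ge0 nu_sigma_additive.

Let nu_sigma_finite : sigma_finite setT nu.
Proof.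
have /sigma_finiteP[F [TF ndF Foo]] := sigma_finiteT (@lebesgue_measure R).
have /sigma_finiteP[G [TG ndG Goo]] := sigma_finiteT mu.
exists (fun k => @rV_uncons n @^-1` (F k `*` G k)).
  rewrite -preimage_bigcup (_ : \bigcup_k _ = setT) ?preimage_setT//.
  rewrite -subTset => -[x y] _.
  have [k _ Fkx] : (\bigcup_i F i) x by rewrite -TF.
  have [l _ Gly] : (\bigcup_i G i) y by rewrite -TG.
  exists (maxn k l) => //; split => /=.
    by move: x Fkx; exact/subsetPset/ndF/leq_maxl.
  by move: y Gly; exact/subsetPset/ndG/leq_maxr.
move=> k; have [mF Fk] := Foo k; have [mG Gk] := Goo k; split.
  rewrite -[X in measurable X]setTI; apply: measurable_rV_uncons => //.
  exact: measurableX.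
rewrite /nu /pushforward -comp_preimage (_ : _ \o _ = id); last first.
  by apply/funext => x /=; rewrite rV_consK.
rewrite preimage_id product_measure1E//.
by rewrite lte_mul_pinfty// ge0_fin_numE.
Qed.

HB.instance Definition _ :=
  @Measure_isSigmaFinite.Build _ _ _ nu nu_sigma_finite.

Lemma lebesgue_rV_step :
  exists m : {sigma_finite_measure set 'rV[R]_n.+1 -> \bar R}, nu = m.
Proof. by exists nu. Qed.

End step.

Lemma lebesgue_rV_sigma_finite_measure n :
  exists m : {sigma_finite_measure set 'rV[R]_n -> \bar R}, @lebesgue_rV n = m.
Proof.
elim: n => [|n [m IH]]; first by exists (\d_(0 : 'rV[R]_0)).
by rewrite /= IH; exact: lebesgue_rV_step.
Qed.

Section instances.
Variable n : nat.

Let lebesgue_rV0 : @lebesgue_rV n set0 = 0%E.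
Proof. by have [m ->] := lebesgue_rV_sigma_finite_measure n. Qed.

Let lebesgue_rV_ge0 A : (0 <= @lebesgue_rV n A)%E.
Proof.
by have [m ->] := lebesgue_rV_sigma_finite_measure n; exact: measure_ge0.
Qed.

Let lebesgue_rV_sigma_additive : semi_sigma_additive (@lebesgue_rV n).
Proof.
have [m ->] := lebesgue_rV_sigma_finite_measure n.
exact: measure_semi_sigma_additive.
Qed.

HB.instance Definition _ := isMeasure.Build _ _ _ (@lebesgue_rV n)
  lebesgue_rV0 lebesgue_rV_ge0 lebesgue_rV_sigma_additive.

Let lebesgue_rV_sigma_finite : sigma_finite setT (@lebesgue_rV n).
Proof.
by have [m ->] := lebesgue_rV_sigma_finite_measure n; exact: sigma_finiteT.
Qed.

HB.instance Definition _ :=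
  @Measure_isSigmaFinite.Build _ _ _ (@lebesgue_rV n) lebesgue_rV_sigma_finite.

End instances.

Lemma lebesgue_rV_box n (A : 'I_n -> set R) : (forall i, measurable (A i)) ->
  measurable [set x : 'rV[R]_n | forall i, A i (x ord0 i)] /\
  @lebesgue_rV n [set x : 'rV[R]_n | forall i, A i (x ord0 i)] =
    (\prod_(i < n) lebesgue_measure (A i))%E.
Proof.
elim: n => [|n IH] in A * => mA.
  have -> : [set x : 'rV[R]_0 | forall i, A i (x ord0 i)] = setT by apply/seteqP; split => // x _ [].
  by rewrite big_ord0 /= diracT; split.
have mB i : measurable (A (lift ord0 i)) by [].
have [mB1 IH1] := IH (fun i => A (lift ord0 i)) mB.
split.
  rewrite (_ : mkset _ = \bigcap_(i in [set: 'I_n.+1]) ((fun x : 'rV[R]_n.+1 => x ord0 i) @^-1` A i)).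
    apply: fin_bigcap_measurable => // i _; rewrite -[X in measurable X]setTI.
    exact: measurable_coord.
  by apply/seteqP; split => x /= h i; [move=> _|]; apply: h.
rewrite big_ord_recl /= /pushforward -IH1.
rewrite (_ : _ @^-1` _ = A ord0 `*` [set x : 'rV[R]_n | forall i, A (lift ord0 i) (x ord0 i)]).
  rewrite product_measure1E //; exact: mA.
apply/seteqP; split => -[a v] /=.
  move=> h; split; first by have := h ord0; rewrite mxE unlift_none.
  by move=> i; have := h (lift ord0 i); rewrite mxE liftK.
by move=> [ha hv] i; rewrite mxE; case: unliftP => [j ->|->].
Qed.

End lebesgue_rV.

Arguments lebesgue_rV {R} n.

(* Measurability for the completion of [mu]. *)
Section completion.
Context d (T : measurableType d) (R : realType).
Variable mu : {measure set T -> \bar R}.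

Definition completion_measurable (A : set T) :=
  exists2 B, measurable B & mu.-negligible ((A `\` B) `|` (B `\` A)).

Definition completion_measurable_fun d' (U : measurableType d') (A : set T)
    (f : T -> U) :=
  exists2 g : T -> U, measurable_fun [set: T] g &
    {ae mu, forall x, A x -> f x = g x}.

End completion.

Section euclidean.
Context {R : realType} {n : nat}.
Implicit Types (x y : 'rV[R]_n) (A D : set 'rV[R]_n).

Definition enorm x : R := Num.sqrt (\sum_i x ord0 i ^+ 2).

Definition edist_set x A : \bar R := ereal_inf [set (enorm (x - y))%:E | y in A].

Definition ediam A : \bar R :=
  ereal_sup [set (enorm (xy.1 - xy.2))%:E | xy in A `*` A].

Definition is_domain D := open D /\ connected D.

Definition boundary A := closure A `\` interior A.

(* the set \Omega_{-\epsilon} *)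
Definition boundary_layer D (e : R) :=
  [set x | D x /\ (edist_set x (boundary D) < e%:E)%E].

Definition arc_length (gam : R -> 'rV[R]_n) (a b : R) : \bar R :=
  ereal_sup [set (\sum_(0 <= k < size s)
      enorm (gam (nth b (a :: s) k.+1) - gam (nth b (a :: s) k)))%:E
    | s in itv_partition a b].

End euclidean.

Section neumann.
Context {R : realType} {n : nat}.
Implicit Types (D : set 'rV[R]_n) (v phi : 'rV[R]_n -> R).

Definition partial (i : 'I_n) phi : 'rV[R]_n -> R :=
  fun x => 'D_(delta_mx ord0 i) phi x.

Definition smooth phi := forall (s : seq 'I_n) x,
  {for x, continuous (foldr partial phi s)} /\
  forall i : 'I_n, derivable (foldr partial phi s) x (delta_mx ord0 i).

(* the space C_c^\infty(D) *)
Definition test_function D phi := smooth phi /\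
  exists K : set 'rV[R]_n,
    [/\ compact K, K `<=` D & forall x, ~ K x -> phi x = 0].

(* Square-integrable functions.  Every class of Lebesgue measurable functions
   modulo null sets has a Borel representative, so nothing is lost by asking
   for Borel measurability. *)
Definition L2 D v := measurable_fun D v /\
  (\int[lebesgue_rV n]_(x in D) (v x ^+ 2)%:E < +oo)%E.

Definition weak_gradient D v (g : 'rV[R]_n -> 'rV[R]_n) :=
  forall phi (i : 'I_n), test_function D phi ->
    (\int[lebesgue_rV n]_(x in D) (v x * partial i phi x)%:E =
     - \int[lebesgue_rV n]_(x in D) (g x ord0 i * phi x)%:E)%E.

(* [v] is in H^1(D), with gradient [g] *)
Definition H1 D v (g : 'rV[R]_n -> 'rV[R]_n) :=
  [/\ L2 D v, forall i : 'I_n, L2 D (fun x => g x ord0 i) & weak_gradient D v g].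

Definition sqL2 D v : R := fine (\int[lebesgue_rV n]_(x in D) (v x ^+ 2)%:E).

(* The infimum of the Rayleigh quotients is taken in the extended reals; since
   +oo - +oo = -oo there, a vanishing integral of v entails its integrability. *)
Definition lambda2N D : \bar R :=
  ereal_inf [set q | exists v g,
    [/\ H1 D v g, sqL2 D v != 0,
        (\int[lebesgue_rV n]_(x in D) (v x)%:E = 0)%E &
        q = (sqL2 D (fun x => enorm (g x)) / sqL2 D v)%:E]].

End neumann.

Section foliations.
Context {R : realType} {n : nat}.

(* The data of a foliation.  The affine hyperplane of the base points is
   parametrised isometrically by R^(n-1), through [base_point]; in these
   coordinates [base_set] is the set of the base points, which indexes the
   paths.
   The density is given as a function on the domain, so that its value at the
   coordinates (q, t) is [density F (curve F q t)]. *)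
Record foliation := Foliation {
  origin : 'rV[R]_n;
  frame : 'M[R]_(n.-1, n);
  base_set : set 'rV[R]_n.-1;
  len : 'rV[R]_n.-1 -> R;
  curve : 'rV[R]_n.-1 -> R -> 'rV[R]_n;
  density : 'rV[R]_n -> R;
  len_bound : R }.

Implicit Types (D S : set 'rV[R]_n) (F : foliation).

Definition base_point F (q : 'rV[R]_n.-1) := origin F + q *m frame F.

Definition inf_len F : \bar R := ereal_inf [set (len F q)%:E | q in base_set F].

Definition sup_len F : \bar R := ereal_sup [set (len F q)%:E | q in base_set F].

Definition leaf F (q : 'rV[R]_n.-1) := curve F q @` `]0, len F q[.

Definition beta_inf F S : \bar R :=
  ess_inf (lebesgue_rV n) (patch (fun=> +oo%E) S (EFin \o density F)).

Definition path_integral F (q : 'rV[R]_n.-1) (f : 'rV[R]_n -> \bar R) :=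
  (\int[lebesgue_measure]_(t in `]0%R, len F q[)
     (f (curve F q t) * (density F (curve F q t))%:E))%E.

Definition I_beta F S : \bar R :=
  ereal_sup [set path_integral F q (EFin \o \1_S) | q in base_set F].

(* rectifiable, a.e. differentiable paths in D, parametrised by arc length and
   issued from their base points *)
Definition unit_speed_paths D F := forall q, base_set F q ->
  [/\ forall t, t \in `]0, len F q[ -> D (curve F q t),
      forall a b, 0 < a -> a <= b -> b < len F q ->
        arc_length (curve F q) a b = (b - a)%:E,
      {ae lebesgue_measure, forall t : R,
        t \in `]0, len F q[ -> derivable (curve F q) t 1} &
      curve F q t @[t --> 0^'+] --> base_point F q].

(* (q, t) |-> curve F q t is a change of coordinates with density beta: it is
   injective, negligible sets correspond, and the change of variables formula
   holds.  Since base_set F need not be a Borel set, measurability over it is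
   Lebesgue measurability. *)
Definition change_of_coordinates D F :=
  [/\ forall q, base_set F q -> {in `]0, len F q[ &, injective (curve F q)},
      forall N, (lebesgue_rV n).-negligible N ->
        {ae lebesgue_rV n.-1, forall q, base_set F q ->
          lebesgue_measure.-negligible
            [set t : R | (t \in `]0, len F q[) /\ N (curve F q t)]},
      (forall x, D x -> 0 <= density F x) /\
      completion_measurable_fun (lebesgue_rV n) D (density F) &
      forall f : 'rV[R]_n -> \bar R, measurable_fun D f ->
        (forall x, D x -> 0 <= f x)%E ->
        completion_measurable_fun (lebesgue_rV n.-1) (base_set F)
          (path_integral F ^~ f) /\
        (\int[lebesgue_rV n]_(x in D) f x =
         \int[lebesgue_rV n.-1]_(q in base_set F) path_integral F q f)%E].

Definition foliates D F :=
  [/\ frame F *m (frame F)^T = 1%:M,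
      completion_measurable (lebesgue_rV n.-1) (base_set F),
      unit_speed_paths D F,
      (forall q q', base_set F q -> base_set F q' -> q <> q' ->
         leaf F q `&` leaf F q' = set0) /\
      (lebesgue_rV n).-negligible (D `\` \bigcup_(q in base_set F) leaf F q) &
      change_of_coordinates D F] /\
  [/\ (0 < inf_len F)%E, (sup_len F < (len_bound F)%:E)%E,
      (0 < beta_inf F D)%E & (I_beta F D < +oo)%E].

Definition well_foliated D := is_domain D /\ exists F, foliates D F.

(* the set E of the points at parameter less than r *)
Definition initial_part F (r : R) : set 'rV[R]_n :=
  [set x | exists q t, [/\ base_set F q, 0 < t < r & x = curve F q t]].

(* a well-foliated domain together with the choice of r *)
Definition foliated_with D F (r : R) :=
  [/\ is_domain D, foliates D F, 0 < r, (r%:E < inf_len F)%E &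
      is_domain (initial_part F r) /\ bounded_set (initial_part F r)].

End foliations.

Arguments foliation : clear implicits.

Section covers.
Context {R : realType} {n : nat}.

Record covering := Covering {
  mult : nat;
  eps0 : R;
  idx : R -> finType;
  piece : forall e, idx e -> set 'rV[R]_n;
  fol : forall e, idx e -> foliation R n;
  rad : forall e, idx e -> R;
  card_exp : R; card_const : R;
  c_r_m : R; c_r_p : R;
  c_L_m : R; c_L_p : R;
  c_I_m : R; c_I_p : R;
  c_diam_m : R; c_diam_p : R;
  c_vol_m : R; c_vol_p : R;
  c_E : R }.

Implicit Types (Omega : set 'rV[R]_n) (W : covering).

Definition covers Omega W e :=
  [/\ forall i : idx W e, piece i `<=` Omega,
      forall i : idx W e, foliated_with (piece i) (fol i) (rad i),
      lebesgue_rV n (boundary_layer Omega e) =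
        lebesgue_rV n (boundary_layer Omega e `&` \bigcup_(i : idx W e) piece i) &
      forall x, (#|[set i : idx W e | `[< piece i x >]]%SET| <= mult W)%N].

Definition constants_gt0 W :=
  [/\ 0 < c_r_m W /\ 0 < c_r_p W, 0 < c_L_m W /\ 0 < c_L_p W,
      0 < c_I_m W /\ 0 < c_I_p W, 0 < c_diam_m W /\ 0 < c_diam_p W &
      0 < c_vol_m W /\ 0 < c_vol_p W].

Definition scaled_in (x : \bar R) (s cm cp : R) :=
  (cm%:E < x * (s^-1)%:E < cp%:E)%E.

Definition uniform_geometry W e (i : idx W e) :=
  let D := piece i in let F := fol i in
  [/\ scaled_in (rad i)%:E e (c_r_m W) (c_r_p W),
      scaled_in (len_bound F)%:E e (c_L_m W) (c_L_p W),
      scaled_in (I_beta F D) e (c_I_m W) (c_I_p W),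
      scaled_in (ediam D) e (c_diam_m W) (c_diam_p W) &
      scaled_in (lebesgue_rV n D) (e ^+ n) (c_vol_m W) (c_vol_p W)].

Definition piece_beta_inf W e (i : idx W e) : \bar R :=
  beta_inf (fol i) (piece i).

Definition well_covered_by Omega W :=
  [/\ 0 < eps0 W,
      forall e, e \in `]0, eps0 W] -> covers Omega W e,
      forall e, e \in `]0, eps0 W] ->
        #|idx W e|%:R <= card_const W * e `^ (- card_exp W),
      constants_gt0 W /\
      forall e, e \in `]0, eps0 W] -> forall i : idx W e, uniform_geometry i &
      [/\ (0 < ereal_inf [set b | exists2 e, e \in `]0%R, eps0 W] &
              exists i : idx W e, b = piece_beta_inf i])%E,
          0 < c_E W &
          forall e, e \in `]0, eps0 W] -> forall i : idx W e,
            ((c_E W * rad i ^- 2)%:E <=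
               lambda2N (initial_part (fol i) (rad i)))%E]].

Definition well_covered Omega := exists W, well_covered_by Omega W.

(* The infimum over i is a real number whenever idx W e is nonempty.  If it
   is empty the infimum is +oo, which [fine] sends to 0, and the convention
   x / 0 = 0 gives the quotients by it their limit value 0. *)
Definition C1 W e : R :=
  let b := fine (ereal_inf [set piece_beta_inf i | i in [set: idx W e]]) in
  ((c_E W)^-1 * c_r_p W ^+ 2 *
     (1 + (c_r_p W + Num.sqrt (c_E W * c_L_p W * c_r_m W)) / (c_r_p W * b)
            * (c_I_p W / c_r_m W))
   + (1 + c_r_p W / Num.sqrt (c_E W * c_L_p W * c_r_m W)) / b
       * c_L_p W * c_I_p W)^-1.

End covers.

Arguments covering : clear implicits.

(* Main.v *)
Require Import Defs.
From mathcomp Require Import all_boot all_order all_algebra.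
From mathcomp Require Import all_classical all_reals all_analysis.
From mathcomp Require Import measurable_realfun ess_sup_inf.
From mathcomp Require Import lra ring.
Set Implicit Arguments.
Unset Strict Implicit.
Unset Printing Implicit Defensive.
Import Order.TTheory GRing.Theory Num.Theory.
Import numFieldNormedType.Exports.
Local Open Scope classical_set_scope.
Local Open Scope ring_scope.

(* Approximate v in H^1(D) by mollifications whose errors, together with those
   of their gradients, are summable in L^1.  By the change of coordinates the
   sum of the errors is integrable along almost every leaf, so v is absolutely
   continuous there, with derivative controlled by |g|.  Hence, for s, t on a
   leaf of length at most L,
     |v(t) - c|^2 <= (1 + eta) |v(s) - c|^2 + (1 + 1/eta) L int |g|^2,
   and averaging over 0 < s < r, then integrating in t against beta, bounds
   int_D |v - c|^2 by int_E |v - c|^2 and int_D |g|^2.  When c is the mean of v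
   over E, the spectral gap of E bounds int_E |v - c|^2 by int_E |g|^2, and when
   v has mean zero over D, int_D |v|^2 <= int_D |v - c|^2.  The choice
   eta = sqrt(c_E c_L^+ c_r^-) / c_r^+ gives the constant C_1. *)

(** * Integrals of possibly nonmeasurable functions *)

(** The leaves are only rectifiable, so no pointwise chain rule is integrated along them. Smooth
    approximants are compared at nearby points of a leaf through the chord, whose length is at most
    the parameter difference, and a second-order Taylor remainder, which repeated bisection removes.
    This is why mollifiers carry explicit uniform Taylor bounds; these also pass through an integral
    without differentiation under it. Both [v] and [g] are extended by zero before mollifying. Near
    the boundary of [D] the mollified [g] need not be the gradient of the mollified [v], but a
    compact arc of a leaf stays away from the boundary once the mollification scale is small. The
    base set, the density and the path integrals are measurable only up to null sets, so Borel
    representatives replace them along almost every leaf. The choice of eta minimises the final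
    bound: with the constants of the cover inserted, the part depending on eta is a multiple of
    c_E^{-1} (c_r^+)^2 eta / c_r^- + c_L^+ / eta, least at eta^2 = c_E c_L^+ c_r^- / (c_r^+)^2. *)

Section lower_integral.
Local Open Scope ereal_scope.
Context d (T : measurableType d) (R : realType).
Variable mu : {measure set T -> \bar R}.
Import HBNNSimple.

(* Nonnegative integrands over base sets are not known to be measurable: the
   integral is then the supremum over simple functions below, which is still
   monotone and insensitive to null sets. *)
Lemma ae_le_integral_nomeas (D : set T) (f g : T -> \bar R) :
  (forall x, D x -> 0 <= f x) -> (forall x, D x -> 0 <= g x) ->
  {ae mu, forall x, D x -> f x <= g x} ->
  \int[mu]_(x in D) f x <= \int[mu]_(x in D) g x.
Proof.
move=> f0 g0 [N [mN N0 fgN]].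
rewrite !ge0_integralE//; apply: ge_ereal_sup => _ [h /= hf <-].
have mN' : measurable (~` N) by exact: measurableC.
(* Cutting the simple function [h] off on the null set [N] keeps its integral and puts it below [g]
   everywhere. *)
pose k := mul_nnsfun h (indic_nnsfun R mN').
apply: (@le_trans _ _ (sintegral mu k)); last first.
  apply: ereal_sup_ubound; exists k => //= x.
  have [Nx|Nx] := pselect (N x).
    rewrite /= mindicE (_ : (x \in ~` N) = false) ?mulr0;
      first exact: erestrict_ge0.
    by apply: memNset => /(_ Nx).
  rewrite /= mindicE mem_set// mulr1; apply: (le_trans (hf x)).
  rewrite !patchE; case: ifPn => //; rewrite inE => Dx.
  by apply: contrapT => fg; apply: Nx; apply: fgN => /= /(_ Dx).
rewrite -!integralT_nnsfun.
apply: ae_ge0_le_integral => //.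
- by move=> x _; rewrite lee_fin.
- exact/measurable_EFinP.
- by move=> x _; rewrite lee_fin.
- exact/measurable_EFinP.
- exists N; split => // x /= hk; apply: contrapT => Nx; apply: hk => _.
  by rewrite lee_fin /k /= mindicE mem_set// mulr1.
Qed.

Lemma ae_eq_integral_nomeas (D : set T) (f g : T -> \bar R) :
  (forall x, D x -> 0 <= f x) -> (forall x, D x -> 0 <= g x) ->
  {ae mu, forall x, D x -> f x = g x} ->
  \int[mu]_(x in D) f x = \int[mu]_(x in D) g x.
Proof.
move=> f0 g0 fg; apply/eqP; rewrite eq_le !ae_le_integral_nomeas//.
  by move: fg; apply: filterS => x fg /fg ->.
by move: fg; apply: filterS => x fg /fg ->.
Qed.

(** Serves to exchange a base set, known only to be Lebesgue measurable, for a Borel set. *)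
Lemma ae_eq_set_integral_nomeas (A B : set T) (f : T -> \bar R) :
  (forall x, A x -> 0 <= f x) -> (forall x, B x -> 0 <= f x) ->
  mu.-negligible ((A `\` B) `|` (B `\` A)) ->
  \int[mu]_(x in A) f x = \int[mu]_(x in B) f x.
Proof.
move=> fA fB AB; rewrite integral_mkcond [RHS]integral_mkcond.
apply: ae_eq_integral_nomeas.
- by move=> x _; exact: erestrict_ge0.
- by move=> x _; exact: erestrict_ge0.
apply: negligibleS AB => x /= fg.
apply: contrapT => /not_orP[nAB nBA]; apply: fg => _.
rewrite !patchE; case: ifPn => [/set_mem Ax|/negP Ax].
  by case: ifPn => // /negP Bx; exfalso; apply: nAB; split => // Bx';
    apply/Bx/mem_set.
case: ifPn => // /set_mem Bx; exfalso; apply: nBA; split => // Ax'.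
exact/Ax/mem_set.
Qed.

End lower_integral.

Section almost_everywhere_lemmas.
Context d (T : measurableType d) (R : realType).
Variable mu : {measure set T -> \bar R}.

Lemma ae_mono (P Q : T -> Prop) : {ae mu, forall x, P x} ->
  (forall x, P x -> Q x) -> {ae mu, forall x, Q x}.
Proof. by move=> aeP PQ; apply: negligibleS aeP => x nQ /PQ. Qed.

Lemma ae_mono2 (P Q S : T -> Prop) : {ae mu, forall x, P x} ->
  {ae mu, forall x, Q x} -> (forall x, P x -> Q x -> S x) ->
  {ae mu, forall x, S x}.
Proof.
move=> aeP aeQ PQS; apply: negligibleS (negligibleU aeP aeQ) => x nS.
by apply/not_andP => -[Px Qx]; exact/nS/PQS.
Qed.

End almost_everywhere_lemmas.

(** * Borel sets and translations of R^n *)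

Section rV_borel.
Context {R : realType} {n : nat}.
Implicit Types (x y : 'rV[R]_n) (D : set 'rV[R]_n).

(** The sup-norm ball for positive [e], written coordinatewise so that [lebesgue_rV_box] measures
    it. *)
Definition cube x (e : R) : set 'rV[R]_n :=
  [set y | forall i, `|y ord0 i - x ord0 i| < e].

Lemma open_cubeP D x : open D -> D x -> exists2 e, 0 < e & cube x e `<=` D.
Proof.
rewrite openE => oD /oD /nbhs_ballP[e e0 xD]; exists e => // y xy.
apply: xD; split => // i j; rewrite (ord1 i) /ball /= distrC; exact: xy.
Qed.

Lemma nbhs_cube x (e : R) : 0 < e -> nbhs x (cube x e).
Proof.
move=> e0; apply/nbhs_ballP; exists e => //= y [_ xy] i.
by have := xy ord0 i; rewrite /ball /= distrC.
Qed.

Lemma continuous_coord (i : 'I_n) : continuous (fun x : 'rV[R]_n => x ord0 i).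
Proof. exact: coord_continuous. Qed.

Lemma open_cube x e : open (cube x e).
Proof.
rewrite openE => y xy.
exists (fun _ i => [set z | `|z - x ord0 i| < e]) => [j i|z /= h i];
  last exact: h.
rewrite (ord1 j); apply: (@cvgr_lt _ _ (nbhs (y ord0 i)) _ (fun z =>
  `|z - x ord0 i|)
  `|y ord0 i - x ord0 i|); last exact: xy.
by apply: cvg_norm; apply: cvgB; [exact: cvg_id|exact: cvg_cst].
Qed.

Lemma measurable_cube x e : measurable (cube x e).
Proof.
have -> : cube x e = [set y | forall i, ball (x ord0 i) e (y ord0 i)].
  by apply/seteqP; split => y /= h i; have := h i; rewrite /ball /= distrC.
by apply: (@lebesgue_rV_box R n (fun i => ball (x ord0 i) e) _).1 => i;
  exact: measurable_ball.
Qed.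

(** An open set is the union of the countably many cubes with rational centre and radius 1/(m+1)
    that it contains. *)
Lemma open_measurable_rV D : open D -> measurable D.
Proof.
move=> oD.
pose F (p : 'rV[rat]_n * nat) : set 'rV[R]_n :=
  let c := cube (map_mx ratr p.1) (p.2.+1%:R^-1) in
  if `[< c `<=` D >] then c else set0.
have -> : D = \bigcup_p F p.
  apply/seteqP; split; last first.
    by move=> x [p _]; rewrite /F; case: asboolP => // h /h.
  move=> x Dx; have [e e0 xD] := open_cubeP oD Dx.
  (* With 1/(m+1) < e/2, any cube of radius 1/(m+1) containing [x] lies in [cube x e], hence in
     [D]. *)
  pose m := Num.truncn (2 / e).
  have m2 : m.+1%:R^-1 < e / 2.
    rewrite invf_plt ?posrE ?divr_gt0// invf_div; exact: truncnS_gt.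
  have q_ i : exists q : rat, `|ratr q - x ord0 i| < m.+1%:R^-1.
    have : x ord0 i - m.+1%:R^-1 < x ord0 i + m.+1%:R^-1.
      by rewrite ltrBlDr -addrA ltrDl addr_gt0// invr_gt0 ltr0n.
    move=> /rat_in_itvoo[q]; rewrite in_itv/= => /andP[q1 q2]; exists q.
    by rewrite ltr_distl q1 q2.
  have [q qx] : exists q : 'rV[rat]_n,
      forall i, `|ratr (q ord0 i) - x ord0 i| < m.+1%:R^-1.
    by exists (\row_i sval (cid (q_ i))) => i; rewrite mxE; case: cid.
  exists (q, m) => //; rewrite /F/=; case: asboolP => h.
    by move=> i; rewrite mxE distrC.
  exfalso; apply: h => y yq; apply: xD => i.
  have {}qx := qx i; have {}yq := yq i; rewrite mxE in yq.
  apply: (le_lt_trans (ler_distD (ratr (q ord0 i)) (y ord0 i) (x ord0 i))).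
  by rewrite (splitr e) (lt_trans (ltrD yq qx))// ltrD.
apply: countable_bigcupT_measurable => [|p]; first exact: countableP.
by rewrite /F; case: asboolP => // _; exact: measurable_cube.
Qed.

(** Open sets are stable under intersection, so this lets a Dynkin induction over measurable sets
    start from them. *)
Lemma measurable_rV_open : (measurable : set_system 'rV[R]_n) = <<s open >>.
Proof.
apply/seteqP; split => A; last first.
  apply: smallest_sub; first exact: sigma_algebra_measurable.
  exact: open_measurable_rV.
apply: smallest_sub => /=; first exact: smallest_sigma_algebra.
rewrite -bigcup_seq => B [i _] [C mC <-] /=; rewrite setTI.
have : (@ocitv R).-sigma.-measurable `<=`
   [set C | <<s open >> ((fun x : 'rV[R]_n => x ord0 i) @^-1` C)].
  rewrite RGenOpens.measurableE.
  apply: smallest_sub.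
    split => /=.
    - by rewrite preimage_set0; apply: (@sigma_algebra0 _ setT _).
    - move=> E mE; rewrite setTD -preimage_setC -setTD.
      exact: sigma_algebraCD.
    - move=> F mF; rewrite preimage_bigcup; exact: sigma_algebra_bigcup.
  move=> _ [x [y ->]] /=; apply: sub_gen_smallest.
  apply: open_comp; last exact: interval_open.
  by move=> z _; exact: continuous_coord.
exact.
Qed.

Lemma continuous_measurable_rV (f : 'rV[R]_n -> R) : continuous f ->
  measurable_fun setT f.
Proof.
move=> cf; apply: (measurability _ (RGenOpens.measurableE R)).
move=> _ [_ [a [b ->] <-]]; rewrite setTI; apply: open_measurable_rV.
by apply: open_comp; [move=> x _; exact: cf|exact: interval_open].
Qed.

Lemma cube_lipschitz_continuous (f : 'rV[R]_n -> R) (C : R) : 0 <= C ->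
  (forall x (h : 'rV[R]_n) (d : R), 0 <= d -> (forall i, `|h ord0 i| <= d) ->
    `|f (x + h) - f x| <= C * d) ->
  continuous f.
Proof.
move=> C0 fC x; apply/(@cvgrPdist_lt _ _ _ _ (nbhs_filter x)) => e e0.
have d0 : 0 < e / (C + 1) by rewrite divr_gt0// ltr_wpDl.
apply: filterS (nbhs_cube x d0) => y xy.
have := fC x (y - x) _ (ltW d0) _; rewrite subrKC distrC => h.
rewrite (le_lt_trans (h _)) => [//|i|]; first by rewrite !mxE ltW.
by rewrite mulrA ltr_pdivrMr ?ltr_wpDl// mulrC ltr_pM2l// ltrDl.
Qed.

Lemma measurable_fun_addrV d (T : measurableType d) (f g : T -> 'rV[R]_n) :
  measurable_fun setT f -> measurable_fun setT g ->
  measurable_fun setT (fun t : T => f t + g t).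
Proof.
move=> /measurable_fun_rVP mf /measurable_fun_rVP mg.
apply/measurable_fun_rVP => i; under eq_fun do rewrite mxE.
exact: measurable_funD.
Qed.

Lemma measurable_translate (a : 'rV[R]_n) :
  measurable_fun setT (fun x : 'rV[R]_n => x + a).
Proof. by apply: measurable_fun_addrV => //; exact: measurable_cst. Qed.

End rV_borel.

(** Translation preserves the lengths of half-open intervals, and these determine the measure. *)
Lemma lebesgue_measure_translate (R : realType) (a : R) (A : set R) :
  measurable A ->
  lebesgue_measure ((fun x => x + a) @^-1` A) = lebesgue_measure A.
Proof.
move=> mA.
have ma : measurable_fun [set: measurableTypeR R]
    ((fun x => x + a) : _ -> measurableTypeR R).
  by apply: measurable_funD => //; exact: measurable_cst.
symmetry; apply: (@lebesgue_measure_unique R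
  (measure_function_pushforward__canonical__measure_function_Measure
    (@lebesgue_measure R) ma)) => // _ [[b c]] _ <- /=.
rewrite /pushforward (_ : _ @^-1` _ = `]b - a, c - a]%classic); last first.
  by apply/seteqP; split => x /=; rewrite !in_itv/= ltrBlDr lerBrDr.
rewrite !lebesgue_measure_itv/= !lte_fin ltrD2r.
by case: ifPn => // _; congr EFin; lra.
Qed.

Section translation.
Context {R : realType}.

(** Induction on the dimension: on R * R^n the translation is a product of translations, so the
    translated product measure agrees with the product measure on rectangles, and uniqueness
    concludes. *)
Lemma lebesgue_rV_translate n (a : 'rV[R]_n) (A : set 'rV[R]_n) :
  measurable A -> lebesgue_rV n ((fun x => x + a) @^-1` A) = lebesgue_rV n A.
Proof.
elim: n => [|n IH] in a A * => mA.
  congr (lebesgue_rV 0 _); apply/seteqP.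
  by split => x /=; rewrite [x + a](_ : _ = x)//; apply/rowP => -[].
pose tau (p : measurableTypeR R * 'rV[R]_n) : measurableTypeR R * 'rV[R]_n :=
  ((p.1 : R) + a ord0 ord0, p.2 + \row_j a ord0 (lift ord0 j)).
have mtau : measurable_fun setT tau.
  apply/measurable_fun_pairP; split.
    by apply: measurable_funD => //; exact: measurable_cst.
  by apply: measurable_fun_addrV => //; exact: measurable_snd.
have mB : measurable (@rV_cons R n @^-1` A).
  by rewrite -[X in measurable X]setTI; exact: measurable_rV_cons.
rewrite /= /pushforward.
rewrite (_ : @rV_cons R n @^-1` _ = tau @^-1` (@rV_cons R n @^-1` A));
  last first.
  apply/seteqP; split => -[t v] /=; rewrite /tau.
    rewrite (_ : rV_cons _ + a =
      rV_cons (t + a ord0 ord0, v + \row_j a ord0 (lift ord0 j)))//.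
    by apply/rowP => i; rewrite !mxE; case: unliftP => [j ->|->]; rewrite ?mxE.
  rewrite (_ : rV_cons _ + a =
    rV_cons (t + a ord0 ord0, v + \row_j a ord0 (lift ord0 j)))//.
  by apply/rowP => i; rewrite !mxE; case: unliftP => [j ->|->]; rewrite ?mxE.
have := @product_measure_unique _ _ _ _ R lebesgue_measure (lebesgue_rV n)
  (measure_function_pushforward__canonical__measure_function_Measure
    (lebesgue_measure \x lebesgue_rV n)%E mtau) _ _ mB.
move=> /= H; symmetry.
rewrite H => //= B C mB' mC.
rewrite /pushforward (_ : tau @^-1` _ = ((fun x => x + a ord0 ord0) @^-1` B) `*`
   ((fun x => x + \row_j a ord0 (lift ord0 j)) @^-1` C))//.
rewrite product_measure1E.
- by congr (_ * _)%E; [exact: lebesgue_measure_translate|exact: IH].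
- rewrite -[X in measurable X]setTI; apply: measurable_funD => //;
  exact: measurable_cst.
- rewrite -[X in measurable X]setTI; apply: measurable_fun_addrV => //;
  exact: measurable_cst.
Qed.

Lemma ge0_integral_translate n (a : 'rV[R]_n) (f : 'rV[R]_n -> \bar R) :
  measurable_fun setT f -> (forall x, 0 <= f x)%E ->
  (\int[lebesgue_rV n]_x f (x + a)%R = \int[lebesgue_rV n]_x f x)%E.
Proof.
move=> mf f0; have ma := @measurable_translate R n a.
transitivity (\int[pushforward (lebesgue_rV n) (fun x : 'rV[R]_n =>
  x + a)%R]_x f x)%E.
  by rewrite (@ge0_integral_pushforward _ _ _ _ _ _ ma).
apply: (@eq_measure_integral _ _ _ _ _
  (measure_function_pushforward__canonical__measure_function_Measure
    (lebesgue_rV n) ma)) => A mA _.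
by rewrite /= /pushforward lebesgue_rV_translate.
Qed.

Lemma integral_translate n (a : 'rV[R]_n) (f : 'rV[R]_n -> \bar R) :
  measurable_fun setT f ->
  (\int[lebesgue_rV n]_x f (x + a)%R = \int[lebesgue_rV n]_x f x)%E.
Proof.
move=> mf; rewrite integralE [RHS]integralE.
congr (_ - _)%E.
  have H := ge0_integral_translate a (measurable_funepos mf) (funepos_ge0 f).
  by rewrite -[RHS]H; apply: eq_integral => x _; rewrite !funeposE.
have H := ge0_integral_translate a (measurable_funeneg mf) (funeneg_ge0 f).
by rewrite -[RHS]H; apply: eq_integral => x _; rewrite !funenegE.
Qed.

End translation.

(** * Continuity of translations in L^1 *)

Section translation_continuity.
Context {R : realType} {n : nat}.
Local Notation mu := (@lebesgue_rV R n).
Implicit Types (A B : set 'rV[R]_n) (a : 'rV[R]_n).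

Local Notation tr a := (fun x : 'rV[R]_n => x + a).

(** Only one half of the symmetric difference with the translate is recorded; for a measurable set
    of finite measure the other half has the same measure, by [mu_setD_shiftC]. *)
Definition set_shift_cvg A := forall e : R, 0 < e ->
  exists2 d : R, 0 < d & forall a, (forall i, `|a ord0 i| < d) ->
    (mu (A `\` tr a @^-1` A) <= e%:E)%E.

Let mshift a A : measurable A -> measurable (tr a @^-1` A).
Proof.
by move=> mA; rewrite -[X in measurable X]setTI; exact: measurable_translate.
Qed.

Lemma mu_setD_shiftC A a : measurable A -> (mu A < +oo)%E ->
  mu (tr a @^-1` A `\` A) = mu (A `\` tr a @^-1` A).
Proof.
move=> mA Aoo; have mAa := mshift a mA.
have muE := lebesgue_rV_translate a mA.
rewrite !measureD//; last by rewrite -muE in Aoo.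
by rewrite setIC; congr (_ - _)%E.
Qed.

(** What a shift removes from the union lies in the union minus [B k], small for large [k] by
    continuity from above, or is removed from [B k] itself. *)
Lemma set_shift_cvg_bigcup (B : nat -> set 'rV[R]_n) :
  (forall k, measurable (B k)) -> nondecreasing_seq B ->
  (mu (\bigcup_k B k) < +oo)%E -> (forall k, set_shift_cvg (B k)) ->
  set_shift_cvg (\bigcup_k B k).
Proof.
move=> mB ndB Boo sB e e0; set A := \bigcup_k B k.
have mA : measurable A by exact: bigcupT_measurable.
have : (fun k => mu (A `\` B k)) @ \oo --> mu (\bigcap_k (A `\` B k)).
  apply: nonincreasing_cvg_mu.
  - by rewrite (le_lt_trans _ Boo)// le_measure ?inE//; exact: measurableD.
  - by move=> k; exact: measurableD.
  - by apply: bigcapT_measurable => k; exact: measurableD.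
  - by move=> i j ij; apply/subsetPset; apply: setDS; exact/subsetPset/ndB.
rewrite (_ : \bigcap_k _ = set0) ?measure0; last first.
  apply/seteqP; split => // x /= h; have [[k _ Bkx] _] := h 0 I.
  by have [] := h k I.
have e20 : 0 < e / 2 by rewrite divr_gt0.
move/fine_cvgP => [_ /cvgrPdist_le/(_ _ e20)[k _ /(_ k (leqnn k))]].
rewrite sub0r normrN => hk.
have Dk : (mu (A `\` B k) <= (e / 2)%:E)%E.
  rewrite -[leLHS]fineK ?lee_fin; first exact: (le_trans (ler_norm _) hk).
  rewrite ge0_fin_numE// (le_lt_trans _ Boo)// le_measure ?inE//.
  exact: measurableD.
have [d d0 hd] := sB k _ e20; exists d => // a /hd ha.
have mBk : measurable (B k `\` tr a @^-1` (B k)).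
  by apply: measurableD => //; exact: mshift.
have mABk : measurable (A `\` B k) by exact: measurableD.
apply: (@le_trans _ _ (mu ((A `\` B k) `|` (B k `\` tr a @^-1` (B k))))).
  apply: le_measure; rewrite ?inE.
  - by apply: measurableD => //; exact: mshift.
  - exact: measurableU.
  move=> x [Ax nAx]; have [Bx|nBx] := pselect (B k x); last by left.
  by right; split => // Bxa; apply: nAx; exists k.
apply: (le_trans (measureU2 _ _ _)) => //.
by rewrite (splitr e) EFinD; exact: leeD.
Qed.

(** The points whose cube of radius 1/(k+1) lies in [A] stay in [A] under shifts smaller than
    1/(k+1), and these sets exhaust [A]. *)
Lemma set_shift_cvg_open A : open A -> (mu A < +oo)%E -> set_shift_cvg A.
Proof.
move=> oA Aoo.
pose K k := [set x | cube x k.+1%:R^-1 `<=` A].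
have KA k : K k `<=` A.
  by move=> x; apply => i; rewrite subrr normr0 invr_gt0 ltr0n.
have UK : \bigcup_k K k = A.
  apply/seteqP; split; first by apply: bigcup_sub => k _; exact: KA.
  move=> x Ax; have [e e0 xA] := open_cubeP oA Ax.
  exists (Num.truncn e^-1) => // y xy; apply: xA => i.
  apply: (lt_trans (xy i)); rewrite invf_plt ?posrE ?ltr0n//.
  exact: truncnS_gt.
have mK k : measurable (K k).
  (* The complement of [K k] is a union of open cubes around the points outside [A], hence open. *)
  have -> : K k = ~` (\bigcup_(y in ~` A) cube y k.+1%:R^-1).
    apply/seteqP; split => x /= h.
      by move=> [y Ay xy]; apply: Ay; apply: h => i; rewrite distrC.
    move=> y xy; apply: contrapT => Ay; apply: h; exists y => // i.
    by rewrite distrC.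
  apply: measurableC; apply: open_measurable_rV; apply: bigcup_open => y _.
  exact: open_cube.
move=> e e0; have mA := open_measurable_rV oA.
have : (fun k => mu (A `\` K k)) @ \oo --> mu (\bigcap_k (A `\` K k)).
  apply: nonincreasing_cvg_mu.
  - by rewrite (le_lt_trans _ Aoo)// le_measure ?inE//; exact: measurableD.
  - by move=> k; exact: measurableD.
  - by apply: bigcapT_measurable => k; exact: measurableD.
  - move=> i j ij; apply/subsetPset; apply: setDS => x Kx y xy.
    apply: Kx => l; apply: (lt_le_trans (xy l)).
    by rewrite lef_pV2 ?posrE ?ltr0n// ler_nat.
rewrite (_ : \bigcap_k _ = set0) ?measure0; last first.
  apply/seteqP; split => // x /= h; have [] := h 0 I; rewrite -{1}UK.
  by move=> [k _ Kx] _; have [] := h k I.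
move/fine_cvgP => [_ /cvgrPdist_le/(_ _ e0)[k _ /(_ k (leqnn k))]].
rewrite sub0r normrN => hk; exists k.+1%:R^-1; first by rewrite invr_gt0 ltr0n.
move=> a ak; apply: (@le_trans _ _ (mu (A `\` K k))).
  apply: le_measure; rewrite ?inE.
  - by apply: measurableD => //; exact: mshift.
  - exact: measurableD.
  move=> x [Ax nAx]; split => // Kx; apply: nAx; apply: Kx => i.
  by rewrite mxE addrAC subrr add0r.
rewrite -[leLHS]fineK ?lee_fin; first exact: (le_trans (ler_norm _) hk).
rewrite ge0_fin_numE// (le_lt_trans _ Aoo)// le_measure ?inE//.
exact: measurableD.
Qed.

Lemma set_shift_cvgU A B : measurable A -> measurable B ->
  set_shift_cvg A -> set_shift_cvg B -> set_shift_cvg (A `|` B).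
Proof.
move=> mA mB sA sB e e0; have e20 : 0 < e / 2 by rewrite divr_gt0.
have [d1 d10 h1] := sA _ e20; have [d2 d20 h2] := sB _ e20.
exists (Num.min d1 d2) => [|a ad]; first by rewrite lt_min d10.
have {}h1 : (mu (A `\` tr a @^-1` A) <= (e / 2)%:E)%E.
  by apply: h1 => i; rewrite (lt_le_trans (ad i))// ge_min lexx.
have {}h2 : (mu (B `\` tr a @^-1` B) <= (e / 2)%:E)%E.
  by apply: h2 => i; rewrite (lt_le_trans (ad i))// ge_min lexx orbT.
have mD C : measurable C -> measurable (C `\` tr a @^-1` C).
  by move=> mC; apply: measurableD => //; exact: mshift.
apply: (@le_trans _ _ (mu ((A `\` tr a @^-1` A) `|` (B `\` tr a @^-1` B)))).
  apply: le_measure; rewrite ?inE.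
  - by apply: mD; exact: measurableU.
  - by apply: measurableU; exact: mD.
  move=> x [[Ax|Bx] nABx]; [left|right]; split => // h; apply: nABx.
    by left.
  by right.
apply: (le_trans (measureU2 _ _ _)); [exact: mD|exact: mD|].
by rewrite (splitr e) EFinD; exact: leeD.
Qed.

Lemma cube_fin (e : R) : (mu (cube 0 e) < +oo)%E.
Proof.
have -> : cube (0 : 'rV[R]_n) e = [set y | forall i, ball (0 : R) e (y ord0 i)].
  by apply/seteqP; split => y /= h i; have := h i; rewrite /ball /= mxE distrC.
rewrite (@lebesgue_rV_box R n (fun=> ball 0 e) _).2; last first.
  by move=> i; exact: measurable_ball.
suff : (\prod_(i < n) lebesgue_measure (ball 0%R e))%E \is a fin_num.
  by move=> /fin_numPlt/andP[].
apply: (big_ind (fun x : \bar R => x \is a fin_num)) => // [x y|i _].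
  exact: fin_numM.
have [e0|e0] := leP e 0; first
  by rewrite ball_itv/= set_itv_ge ?measure0// bnd_simp -leNgt; lra.
by rewrite lebesgue_measure_ball// ltW.
Qed.

(** Dynkin induction from the open sets, carried out inside a fixed cube so that all measures are
    finite; the cubes are then exhausted. *)
Lemma measurable_set_shift_cvg A : measurable A -> (mu A < +oo)%E ->
  set_shift_cvg A.
Proof.
move=> mA Aoo.
suff H k : forall S, measurable S -> set_shift_cvg (S `&` cube 0 k%:R).
  have -> : A = \bigcup_k (A `&` cube 0 k%:R).
    apply/seteqP; split => [x Ax|x [k _ []]//].
    pose m := \max_(i < n) (Num.truncn `|x ord0 i|).+1.
    exists m => //; split => // i; rewrite mxE subr0.
    apply: (lt_le_trans (truncnS_gt _)); rewrite ler_nat.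
    exact: (leq_bigmax i).
  apply: set_shift_cvg_bigcup.
  - by move=> k; apply: measurableI => //; exact: measurable_cube.
  - move=> i j ij; apply/subsetPset; apply: setIS => x h l.
    by apply: (lt_le_trans (h l)); rewrite ler_nat.
  - apply: le_lt_trans Aoo; apply: le_measure; rewrite ?inE//.
      apply: bigcupT_measurable => k; apply: measurableI => //.
      exact: measurable_cube.
    by move=> x [k _ []].
  - by move=> k; exact: H.
move=> S; rewrite measurable_rV_open => mS.
set U := cube 0 k%:R.
have mU : measurable U by exact: measurable_cube.
have Uoo B : measurable B -> (mu (B `&` U) < +oo)%E.
  move=> mB; apply: le_lt_trans (cube_fin k%:R); apply: le_measure.
  - by rewrite inE; exact: measurableI.
  - by rewrite inE.
  - by move=> x [].
have sU : set_shift_cvg U.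
  by apply: set_shift_cvg_open; [exact: open_cube|exact: cube_fin].
move: S mS; apply: (@dynkin_induction _ 'rV[R]_n open
  (fun S => set_shift_cvg (S `&` U)) measurable_rV_open) => //.
- by move=> B C; exact: openI.
- by rewrite setTI.
- move=> B oB; apply: set_shift_cvg_open.
    by apply: openI => //; exact: open_cube.
  by apply: Uoo; exact: open_measurable_rV.
(* A point of [U] outside [B] can leave this set only by leaving [U] or by entering the intersection
   of [B] and [U]. Entering costs as much measure as leaving, by [mu_setD_shiftC]. *)
- move=> B mB sB e e0; have e20 : 0 < e / 2 by rewrite divr_gt0.
  have [d1 d10 h1] := sU _ e20; have [d2 d20 h2] := sB _ e20.
  exists (Num.min d1 d2) => [|a ad]; first by rewrite lt_min d10.
  have {}h1 : (mu (U `\` tr a @^-1` U) <= (e / 2)%:E)%E.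
    by apply: h1 => i; rewrite (lt_le_trans (ad i))// ge_min lexx.
  have {}h2 : (mu (B `&` U `\` tr a @^-1` (B `&` U)) <= (e / 2)%:E)%E.
    by apply: h2 => i; rewrite (lt_le_trans (ad i))// ge_min lexx orbT.
  have mBU : measurable (B `&` U) by exact: measurableI.
  rewrite -mu_setD_shiftC// in h2; last exact: Uoo.
  have m1 : measurable (U `\` tr a @^-1` U).
    by apply: measurableD => //; exact: mshift.
  have m2 : measurable (tr a @^-1` (B `&` U) `\` (B `&` U)).
    by apply: measurableD => //; exact: mshift.
  apply: (@le_trans _ _ (mu ((U `\` tr a @^-1` U) `|`
      (tr a @^-1` (B `&` U) `\` (B `&` U))))).
    apply: le_measure; rewrite ?inE.
    - have mC : measurable (~` B `&` U) by apply: measurableI => //;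
      exact: measurableC.
      by apply: measurableD => //; exact: mshift.
    - exact: measurableU.
    move=> x [[nBx Ux] h]; have [Uxa|Uxa] := pselect (U (tr a x)); last by left.
    right; split; last by move=> [].
    by apply: contrapT => Bxa; apply: h; split => // Bxa'; apply: Bxa; split.
  apply: (le_trans (measureU2 _ _ _)) => //.
  by rewrite (splitr e) EFinD; exact: leeD.
- move=> F mF _ sF; pose B k := [set x | exists2 i, (i < k)%N & (F i `&` U) x].
  have mFU i : measurable (F i `&` U) by exact: measurableI.
  have BS j : B j.+1 = B j `|` (F j `&` U).
    apply/seteqP; split => [x [i + Fx]|x [[i ij Fx]|Fx]].
    - by rewrite ltnS leq_eqVlt => /orP[/eqP <-|ij]; [right|left; exists i].
    - by exists i => //; exact: ltnW.
    - by exists j.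
  have B0 : B 0 = set0 by apply/seteqP; split => // x [].
  have mB j : measurable (B j).
    by elim: j => [|j IH]; rewrite ?B0// BS; exact: measurableU.
  have BE : \bigcup_k B k = (\bigcup_k F k) `&` U.
    apply/seteqP; split => [x [j _ [i _ [Fx Ux]]]|x [[i _ Fx] Ux]].
      by split => //; exists i.
    by exists i.+1 => //; exists i.
  rewrite -BE; apply: set_shift_cvg_bigcup => //.
  + by move=> i j ij; apply/subsetPset => x [l li Fx]; exists l => //;
    exact: leq_trans ij.
  + by rewrite BE; apply: Uoo; exact: bigcupT_measurable.
  + elim=> [|j IH]; last by rewrite BS; exact: set_shift_cvgU.
    rewrite B0 => e e0; exists 1 => // a _.
    by rewrite set0D measure0 lee_fin ltW.
Qed.

Definition fun_shift_cvg (f : 'rV[R]_n -> R) := measurable_fun setT f /\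
  forall e : R, 0 < e ->
  exists2 d : R, 0 < d & forall a, (forall i, `|a ord0 i| < d) ->
    (\int[mu]_x `|f (x + a)%R - f x|%:E <= e%:E)%E.

Let measurable_dist_shift (f g : 'rV[R]_n -> R) a : measurable_fun setT f ->
  measurable_fun setT g ->
  measurable_fun setT (fun x : 'rV[R]_n => (`|f (x + a) - g x|)%:E).
Proof.
move=> mf mg; apply/measurable_EFinP; apply: measurableT_comp => //.
apply: measurable_funB => //; apply: (measurableT_comp mf).
exact: measurable_translate.
Qed.

Lemma fun_shift_cvg_indic A : measurable A -> (mu A < +oo)%E ->
  fun_shift_cvg \1_A.
Proof.
move=> mA Aoo; split; first exact: measurable_indic.
move=> e e0; have e20 : 0 < e / 2 by rewrite divr_gt0.
have [d d0 h] := measurable_set_shift_cvg mA Aoo e20; exists d => // a /h ha.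
have mAa := mshift a mA.
have m1 : measurable (A `\` tr a @^-1` A) by exact: measurableD.
have m2 : measurable (tr a @^-1` A `\` A) by exact: measurableD.
rewrite (eq_integral (fun x => (\1_(A `\` tr a @^-1` A) x)%:E +
   (\1_(tr a @^-1` A `\` A) x)%:E)%E); last first.
  move=> x _; rewrite -EFinD !indicE !in_setD; congr EFin.
  have -> : (x + a \in A) = (x \in tr a @^-1` A) by apply/idP/idP; rewrite !inE.
  by case: (x \in A); case: (x \in _) => /=;
    rewrite ?subrr ?normr0 ?addr0 ?subr0 ?normr1 ?sub0r ?normrN1 ?add0r.
rewrite ge0_integralD//; [|exact/measurable_EFinP/measurable_indic..].
rewrite !integral_indic// !setIT (splitr e) EFinD.
by apply: leeD => //; apply: (le_trans _ ha);
  rewrite -(mu_setD_shiftC a mA Aoo).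
Qed.

Lemma fun_shift_cvg_cst0 : fun_shift_cvg (cst 0).
Proof.
split=> [|e e0]; first exact: measurable_cst.
exists 1 => // a _; rewrite integral0_eq ?lee_fin ?ltW// => x _.
by rewrite subrr normr0.
Qed.

Lemma fun_shift_cvgZ (c : R) f : fun_shift_cvg f ->
  fun_shift_cvg (fun x => c * f x).
Proof.
move=> [mf sf]; split; first exact: measurable_funM.
move=> e e0; have e1 : 0 < e / (`|c| + 1) by rewrite divr_gt0// ltr_wpDl.
have [d d0 h] := sf _ e1; exists d => // a /h ha.
under eq_integral do rewrite -mulrBr normrM EFinM.
rewrite ge0_integralZl//.
- apply: (@le_trans _ _ (`|c|%:E * (e / (`|c| + 1))%:E)%E).
    by apply: lee_wpmul2l.
  rewrite -EFinM lee_fin mulrCA ler_piMr ?ltW// ltr_pdivrMr ?ltr_wpDl// mul1r.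
  by rewrite ltrDl.
- exact: measurable_dist_shift.
Qed.

Lemma fun_shift_cvgD f g : fun_shift_cvg f -> fun_shift_cvg g ->
  fun_shift_cvg (fun x => f x + g x).
Proof.
move=> [mf sf] [mg sg]; split; first exact: measurable_funD.
move=> e e0; have e20 : 0 < e / 2 by rewrite divr_gt0.
have [d1 d10 h1] := sf _ e20; have [d2 d20 h2] := sg _ e20.
exists (Num.min d1 d2) => [|a ad]; first by rewrite lt_min d10.
have {}h1 : (\int[mu]_x `|f (x + a)%R - f x|%:E <= (e / 2)%:E)%E.
  by apply: h1 => i; rewrite (lt_le_trans (ad i))// ge_min lexx.
have {}h2 : (\int[mu]_x `|g (x + a)%R - g x|%:E <= (e / 2)%:E)%E.
  by apply: h2 => i; rewrite (lt_le_trans (ad i))// ge_min lexx orbT.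
apply: (@le_trans _ _ (\int[mu]_x (`|f (x + a)%R - f x|%:E + `|g (x + a)%R - g
  x|%:E))%E).
  apply: ge0_le_integral => //.
  - exact: (measurable_dist_shift a (measurable_funD mf mg) (measurable_funD
    mf mg)).
  - by apply: emeasurable_funD; exact: measurable_dist_shift.
  - move=> x _; rewrite -EFinD lee_fin opprD addrACA; exact: ler_normD.
rewrite ge0_integralD//; [|exact: measurable_dist_shift..].
by rewrite (splitr e) EFinD leeD.
Qed.

Lemma fun_shift_cvg_sum (I : Type) (s : seq I) (F : I -> 'rV[R]_n -> R) :
  (forall i, fun_shift_cvg (F i)) ->
  fun_shift_cvg (fun x => \sum_(i <- s) F i x).
Proof.
move=> sF; elim: s => [|i s IH].
  by under eq_fun do rewrite big_nil; exact: fun_shift_cvg_cst0.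
by under eq_fun do rewrite big_cons; exact: fun_shift_cvgD.
Qed.

Import HBSimple.

(** Integrability forces the level sets of nonzero values to have finite measure; the value 0
    contributes nothing. *)
Lemma fun_shift_cvg_sfun (g : {sfun 'rV[R]_n >-> R}) :
  mu.-integrable setT (EFin \o g) -> fun_shift_cvg g.
Proof.
move=> ig; have [s ->] : exists s : seq R,
    (g : _ -> R) = (fun x => \sum_(y <- s) (y * \1_(g @^-1` [set y]) x)).
  by eexists; apply/funext => x; rewrite [LHS]fimfunE fsbig_finite.
apply: fun_shift_cvg_sum => y.
have [->|y0] := eqVneq y 0.
  by under eq_fun do rewrite mul0r; exact: fun_shift_cvg_cst0.
have mA : measurable (g @^-1` [set y]) by [].
apply: fun_shift_cvgZ; apply: fun_shift_cvg_indic => //.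
have /integrableP[mg goo] := ig.
rewrite -(@lte_pmul2l _ `|y|%:E)// ?lte_fin ?normr_gt0// mulr_infty.
rewrite gtr0_sg ?normr_gt0// mul1e.
apply: le_lt_trans goo.
rewrite -integral_cst//; apply: (@le_trans _ _
    (\int[mu]_(x in g @^-1` [set y]) `|(EFin \o g) x|)%E).
  apply: ge0_le_integral => //; [by move=> x _;
    rewrite lee_fin|by apply: measurable_funTS; exact: measurableT_comp|].
  by move=> x /= ->.
by apply: ge0_subset_integral => //; exact: measurableT_comp.
Qed.

(** An e/3 argument: approximation by a simple function, whose error after the shift is the same by
    translation invariance. *)
Lemma integrable_fun_shift_cvg (f : 'rV[R]_n -> R) :
  mu.-integrable setT (EFin \o f) -> fun_shift_cvg f.
Proof.
move=> intf; have /integrableP[/measurable_EFinP mf _] := intf;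
  split => // e e0.
have e30 : 0 < e / 3 by rewrite divr_gt0.
have [g_ [ig _ /fine_cvgP[gfin /cvgrPdist_le/(_ _ e30) gcvg]]] :=
  approximation_sfun_integrable measurableT intf.
have [k _ /(_ k (leqnn k))[fk]] : \forall k \near \oo,
  (\int[mu]_x `|(EFin \o f) x - (g_ k x)%:E|)%E \is a fin_num /\
  `|0 - fine (\int[mu]_x `|(EFin \o f) x - (g_ k x)%:E|)%E| <= e / 3.
  by near=> k; split; near: k.
rewrite sub0r normrN => hk.
have [mg sg] := fun_shift_cvg_sfun (ig k).
have [d d0 h] := sg _ e30; exists d => // a /h ha.
have gf : (\int[mu]_x `|f x - g_ k x|%:E <= (e / 3)%:E)%E.
  by rewrite -[leLHS]fineK// lee_fin; exact: (le_trans (ler_norm _) hk).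
have m1 : measurable_fun setT (fun x : 'rV[R]_n => (`|f x - g_ k x|)%:E).
  apply/measurable_EFinP; apply: measurableT_comp => //.
  exact: measurable_funB.
have m1a : measurable_fun setT (fun x : 'rV[R]_n =>
  (`|f (x + a) - g_ k (x + a)|)%:E).
  by apply: (measurableT_comp m1); exact: measurable_translate.
have gfa : (\int[mu]_x `|f (x + a)%R - g_ k (x + a)%R|%:E <= (e / 3)%:E)%E.
  rewrite (ge0_integral_translate a (f := fun x => (`|f x - g_ k x|)%:E))//.
apply: (@le_trans _ _ (\int[mu]_x (`|f (x + a)%R - g_ k (x + a)%R|%:E +
   (`|g_ k (x + a)%R - g_ k x|%:E + `|f x - g_ k x|%:E)))%E).
  apply: ge0_le_integral => //.
  - exact: measurable_dist_shift.
  - apply: emeasurable_funD => //; apply: emeasurable_funD => //.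
    exact: measurable_dist_shift.
  - move=> x _; rewrite -!EFinD lee_fin (distrC (f x)).
    rewrite (le_trans (ler_distD (g_ k (x + a)) _ _))// lerD2l.
    exact: ler_distD.
have m2 := measurable_dist_shift a mg mg.
rewrite ge0_integralD//; [|by move=> x _;
  exact: adde_ge0|exact: emeasurable_funD].
rewrite ge0_integralD//.
rewrite (_ : e = e / 3 + (e / 3 + e / 3)); last by field.
by rewrite !EFinD; apply: leeD => //; exact: leeD.
Unshelve. all: by end_near. Qed.

End translation_continuity.

(** * Smooth bump functions *)

(** A quadratic remainder bound is easier to obtain than a limit, both at the edge of the support of
    a bump and for products of bumps; every derivative of a mollifier is read off from one. *)
Lemma is_derive_quadratic_remainder (R : realType) (V : normedModType R)
    (f : V -> R) (x v : V) (d C : R) :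
  (forall h : R, `|f (h *: v + x) - f x - h * d| <= C * h ^+ 2) ->
  is_derive x v f d.
Proof.
move=> fC.
have cf : (fun h => h^-1 *: ((f \o shift x) (h *: v) - f x)) @ 0^' --> d.
  apply/cvgrPdist_le => e e0; near=> h.
  have h0 : h != 0 by near: h; exact: nbhs_dnbhs_neq.
  rewrite /= distrC.
  have -> : h^-1 *: (f (h *: v + x) - f x) - d =
            h^-1 * (f (h *: v + x) - f x - h * d).
    by rewrite [RHS]mulrBr mulKf.
  rewrite normrM normfV ler_pdivrMl ?normr_gt0//.
  apply: (le_trans (fC h)); rewrite -[h ^+ 2]real_normK ?num_real// expr2
    mulrCA.
  rewrite ler_wpM2l//; apply: (@le_trans _ _ ((`|C| + 1) * `|h|)).
    by rewrite ler_wpM2r// (le_trans (ler_norm C))// lerDl.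
  rewrite -ler_pdivlMl ?ltr_wpDl//; near: h; apply: dnbhs0_le.
  by rewrite mulr_gt0// invr_gt0 ltr_wpDl.
split; last exact: cvg_lim.
by apply/cvg_ex; exists d.
Unshelve. all: by end_near. Qed.

Section bump.
Context {R : realType}.
Implicit Types (P : {poly R}) (m : nat) (t : R).

(* These functions are stable under differentiation, with [P] and [m] changed
   to [dbump P m] and [m.+2]. *)
Definition bump P m t : R :=
  if `|t| < 1 then P.[t] * (1 - t ^+ 2)^-1 ^+ m * expR (- (1 - t ^+ 2)^-1)
  else 0.

Definition dbump P m : {poly R} :=
  P^`() * (1 - 'X^2) ^+ 2 + (m.*2)%:R *: ('X * P * (1 - 'X^2)) - 2 *: ('X * P).

Lemma horner_bounded P : exists2 C, 0 <= C & forall t, `|t| < 1 ->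
  `|P.[t]| <= C.
Proof.
exists (\sum_(i < size P) `|P`_i|) => [|t t1]; first exact: sumr_ge0.
rewrite horner_coef; apply: (le_trans (ler_norm_sum _ _ _)).
apply: ler_sum => i _; rewrite normrM normrX ler_piMr//.
by rewrite exprn_ile1// ltW.
Qed.

(** With 1 + x <= e^x at x = u / k, raised to the power k; the constant is k^k. *)
Lemma exprn_le_expR k : exists2 C : R, 0 <= C & forall u, 0 <= u ->
  u ^+ k <= C * expR u.
Proof.
case: k => [|k].
  by exists 1 => // u u0; rewrite expr0 mul1r -expR0 ler_expR.
exists (k.+1%:R ^+ k.+1) => [|u u0]; first by rewrite exprn_ge0.
have -> : u = k.+1%:R * (u / k.+1%:R) by rewrite mulrC divfK// pnatr_eq0.
rewrite expRM_natl exprMn ler_wpM2l ?exprn_ge0//.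
rewrite lerXn2r ?nnegrE ?expR_ge0 ?divr_ge0//.
by rewrite (le_trans _ (expR_ge1Dx _))// lerDr.
Qed.

Lemma sqr_lt1 t : `|t| < 1 -> 0 < 1 - t ^+ 2.
Proof. by move=> t1; rewrite subr_gt0 -real_normK ?num_real// expr_lt1. Qed.

(** With v = 1 / (1 - t^2), the bound v^(m+2) <= B e^v leaves two spare powers of 1 - t^2. They make
    the bump vanish to second order at the edge of its support, which [is_derive_bump] needs
    there. *)
Lemma bump_le P m : exists2 C, 0 <= C &
  forall t, `|t| < 1 -> `|bump P m t| <= C * (1 - t ^+ 2) ^+ 2.
Proof.
have [A A0 hA] := horner_bounded P; have [B B0 hB] := exprn_le_expR m.+2.
exists (A * B) => [|t t1]; first exact: mulr_ge0.
rewrite /bump t1; have u0 := sqr_lt1 t1; set u := 1 - t ^+ 2 in u0 *.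
rewrite -mulrA normrM -mulrA ler_pM ?hA//.
have v0 : 0 < u^-1 by rewrite invr_gt0.
rewrite ger0_norm ?mulr_ge0 ?expR_ge0 ?exprn_ge0 ?(ltW v0)//.
rewrite expRN ler_pdivrMr ?expR_gt0//.
have := hB _ (ltW v0); rewrite -addn2 exprD => h.
have u20 : 0 < u ^+ 2 by rewrite exprn_gt0.
by rewrite mulrAC -ler_pdivrMr// -exprVn.
Qed.

Lemma bump_bounded P m : exists2 C, 0 <= C & forall t, `|bump P m t| <= C.
Proof.
have [C C0 h] := bump_le P m; exists C => // t.
have [t1|t1] := boolP (`|t| < 1); last by rewrite /bump (negbTE t1) normr0.
have u0 := sqr_lt1 t1.
apply: (le_trans (h t t1)); rewrite ler_piMr// exprn_ile1 ?(ltW u0)//.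
by rewrite lerBlDr lerDl sqr_ge0.
Qed.

Lemma bump_out P m t : 1 <= `|t| -> bump P m t = 0.
Proof. by rewrite leNgt /bump => /negbTE ->. Qed.

(** Where |t| >= 1 the derivative is 0 because of the second-order vanishing; where |t| < 1 the
    formula is differentiated with w = 1 / (1 - t^2), for which w' = 2 t w^2. *)
Lemma is_derive_bump P m t :
  is_derive t (1 : R) (bump P m) (bump (dbump P m) m.+2 t).
Proof.
have [t1|t1] := ltP `|t| 1; last first.
  rewrite (bump_out _ _ t1).
  have [C C0 h] := bump_le P m.
  (* The constant comes from C (2|s|)^2: if |t| >= 1 > |s + t| then 1 - (s + t)^2 <= 2|s|. *)
  apply: (@is_derive_quadratic_remainder _ _ _ _ _ _ (4 * C)) => s.
  rewrite mulr0 subr0 (bump_out _ _ t1) subr0 [s *: 1]mulr1.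
  have [s1|s1] := ltP `|s + t| 1; last first.
    by rewrite bump_out// normr0; apply: mulr_ge0;
      [exact: mulr_ge0|exact: sqr_ge0].
  rewrite (le_trans (h _ s1))//.
  have -> : 4 * C * s ^+ 2 = C * (2 * `|s|) ^+ 2.
    by rewrite exprMn real_normK ?num_real//; ring.
  rewrite ler_wpM2l//.
  rewrite lerXn2r ?nnegrE ?mulr_ge0 ?(ltW (sqr_lt1 s1))//.
  have -> : 1 - (s + t) ^+ 2 = (1 + `|s + t|) * (1 - `|s + t|).
    by rewrite -[(s + t) ^+ 2]real_normK ?num_real//; ring.
  apply: ler_pM.
  - exact: addr_ge0.
  - by rewrite subr_ge0 ltW.
  - by rewrite -[leRHS]/(1 + 1) lerD2l ltW.
  - rewrite lerBlDr; apply: (le_trans t1).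
    by rewrite -{1}(addKr s t) (le_trans (ler_normD _ _))// normrN.
have u0 := sqr_lt1 t1; have un0 : 1 - t ^+ 2 != 0 by rewrite gt_eqF.
pose w : R -> R := fun s => (1 - s ^+ 2)^-1.
have dw : is_derive t (1 : R) w (2 * t * w t ^+ 2).
  have du : is_derive t (1 : R) (fun s : R => 1 - s ^+ 2) (- (2 * t)).
    have -> : (fun s : R => 1 - s ^+ 2) = cst 1 - (id ^+ 2) by [].
    by apply: is_derive_eq; rewrite sub0r expr1 [_ *: 1]mulr1.
  split; first by apply: (@derivableV _ _ (fun s : R => 1 - s ^+ 2) t 1).
  rewrite (@deriveV _ _ (fun s : R =>
    1 - s ^+ 2) t 1)// (@derive_val _ _ _ _ _ _ _ du).
  rewrite /w [_ *: _]mulrN mulNr opprK exprVn; ring.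
have dew : is_derive t (1 : R) (fun s =>
  expR (- w s)) (- (2 * t * w t ^+ 2) * expR (- w t)).
  rewrite mulrC; apply: (@is_derive1_comp _ expR (fun s => - w s)).
apply: (@near_eq_is_derive _ _ _ (fun s => P.[s] * w s ^+ m * expR (- w s))).
  near=> s; rewrite /bump ifT//; near: s.
  exact: (cvgr_lt _ (cvg_norm cvg_id)).
have -> : (fun s => P.[s] * w s ^+ m * expR (- w s)) =
   (horner P * w ^+ m * (fun s => expR (- w s))) by rewrite exprfctE.
apply: is_derive_eq.
have dbE : (dbump P m).[t] = P^`().[t] * (1 - t ^+ 2) ^+ 2 +
    (m.*2)%:R * (t * P.[t] * (1 - t ^+ 2)) - 2 * (t * P.[t]).
  by rewrite /dbump !hornerE/=; ring.
rewrite exprfctE; change (P.[t] * w t ^+ m * (- (2 * t * w t ^+ 2) * expR (- w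
  t)) +
  expR (- w t) * (P.[t] * ((m%:R * w t ^+ m.-1) * (2 * t * w t ^+ 2)) +
   w t ^+ m * P^`().[t]) = bump (dbump P m) m.+2 t).
rewrite /bump t1 dbE -/(w t).
have uw : (1 - t ^+ 2) * w t = 1 by rewrite mulfV.
set v := w t in uw *; set u := 1 - t ^+ 2 in uw *.
(* After factoring out w^m e^(-w), the derivative is P' + 2 m t P w - 2 t P w^2. [dbump] is this
   times (1 - t^2)^2, which u * v = 1 undoes. *)
rewrite (_ : (_ + _ - _) * v ^+ m.+2 = v ^+ m * (P^`().[t] * (u * v) ^+ 2 +
    (m.*2)%:R * (t * P.[t] * (u * v) * v) - 2 * (t * P.[t] * v ^+ 2)));
      last first.
  by rewrite -[m.+2]addn2 exprD; ring.
(* The derivative of w^m contains the truncated exponent [m.-1], so m = 0 is separate. *)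
rewrite uw expr1n -muln2 natrM {dbE}; case: m => [|k] /=; first by ring.
rewrite !exprS; ring.
Unshelve. all: by end_near. Qed.

End bump.

(** * Uniform second-order Taylor bounds *)

Section taylor.
Context {R : realType}.

Lemma mean_value (f df : R -> R) (t h : R) :
  (forall x, is_derive x (1 : R) f (df x)) ->
  exists2 c, `|c - t| <= `|h| & f (t + h) - f t = h * df c.
Proof.
move=> fdf.
have cf : continuous f.
  by move=> x; apply/differentiable_continuous/derivable1_diffP;
    exact: (@ex_derive _ _ _ _ _ _ _ (fdf x)).
have cfw A : {within A, continuous f} by exact: continuous_subspaceT.
have [h0|h0] := leP 0 h.
  have th : t <= t + h by rewrite lerDl.
  have [c] := MVT_segment th (fun x _ => fdf x) (cfw _).
  rewrite in_itv/= => /andP[tc ch] E; exists c;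
    last by rewrite E mulrC addrAC subrr add0r.
  by rewrite !ger0_norm ?subr_ge0// lerBlDl.
have th : t + h <= t by rewrite gerDl ltW.
have [c] := MVT_segment th (fun x _ => fdf x) (cfw _).
rewrite in_itv/= => /andP[tc ch] E; exists c.
  by rewrite distrC ger0_norm ?subr_ge0// ltr0_norm//; lra.
by rewrite -opprB E; ring.
Qed.

(** One constant bounds [f], its increments and its first-order remainder at all points. This form
    is stable under products and under integration of translates, and it determines [df] as the
    gradient. *)
Definition taylor2 n (f : 'rV[R]_n -> R) (df : 'I_n -> 'rV[R]_n -> R) :=
  exists2 C, 0 <= C & forall (z h : 'rV[R]_n) (d : R), 0 <= d ->
    (forall i, `|h ord0 i| <= d) ->
  [/\ `|f z| <= C, `|f (z + h) - f z| <= C * d &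
      `|f (z + h) - f z - \sum_i h ord0 i * df i z| <= C * d ^+ 2].

(** The mean value theorem is applied to [f], then to [f1] between the base point and the
    intermediate point. *)
Lemma taylor2_coord n (i : 'I_n) (f f1 f2 : R -> R) :
  (forall x, is_derive x (1 : R) f (f1 x)) ->
  (forall x, is_derive x (1 : R) f1 (f2 x)) ->
  (exists2 C, 0 <= C & forall x, `|f x| <= C) ->
  (exists2 C, 0 <= C & forall x, `|f1 x| <= C) ->
  (exists2 C, 0 <= C & forall x, `|f2 x| <= C) ->
  taylor2 (fun z : 'rV[R]_n => f (z ord0 i))
          (fun j z => if j == i then f1 (z ord0 i) else 0).
Proof.
move=> ff1 f1f2 [A A0 fA] [B B0 fB] [C C0 fC].
exists (A + B + C) => [|z h d d0 hd]; first by rewrite !addr_ge0.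
rewrite mxE (bigD1 i)//= eqxx big1 ?addr0; last first.
  by move=> j /negbTE ->; rewrite mulr0.
have [c ct E] := mean_value (z ord0 i) (h ord0 i) ff1.
split.
- by rewrite (le_trans (fA _))// -addrA lerDl addr_ge0.
- rewrite E normrM mulrC ler_pM// (le_trans (fB _))// -addrA addrCA lerDl.
  exact: addr_ge0.
- rewrite E -mulrBr; have [c' ct' E'] :=
  mean_value (z ord0 i) (c - z ord0 i) f1f2.
  have cd : `|c - z ord0 i| <= d by exact: le_trans ct (hd i).
  rewrite subrKC in E'; rewrite E' !normrM.
  rewrite (_ : (A + B + C) * d ^+ 2 = d * (d * (A + B + C))); last by ring.
  rewrite ler_pM ?mulr_ge0// ler_pM// (le_trans (fC _))// lerDr.
  exact: addr_ge0.
Qed.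

Lemma taylor2_cst n (c : R) : taylor2 (fun _ : 'rV[R]_n => c) (fun _ _ => 0).
Proof.
exists `|c| => // z h d d0 hd; split => //.
  by rewrite subrr normr0 mulr_ge0.
rewrite big1 ?subr0 ?subrr ?normr0; last by move=> i _; rewrite mulr0.
by rewrite mulr_ge0// sqr_ge0.
Qed.

End taylor.

(** * Tensor products of bumps and mollifiers *)

Section smooth_bump.
Context {R : realType} {n : nat}.
Implicit Types (f g : 'rV[R]_n -> R) (P : 'I_n -> {poly R}) (m : 'I_n -> nat).

Lemma taylor2M f df g dg : taylor2 f df -> taylor2 g dg ->
  taylor2 (fun z => f z * g z) (fun j z => f z * dg j z + g z * df j z).
Proof.
(* The remainder of a product has three terms: the remainder of [f] times g, f times the remainder
   of [g], and the product of the increments. *)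
move=> [A A0 fA] [B B0 gB]; exists (3 * (A * B)) => [|z h d d0 hd].
  by rewrite !mulr_ge0.
have [f0 f1 f2] := fA z h d d0 hd; have [g0 g1 g2] := gB z h d d0 hd.
have [fh _ _] := fA (z + h) h d d0 hd.
have AB0 : 0 <= A * B by rewrite mulr_ge0.
split.
- rewrite normrM (le_trans (ler_pM _ _ f0 g0))// ler_peMl//; lra.
- have -> : f (z + h) * g (z + h) - f z * g z =
    f (z + h) * (g (z + h) - g z) + (f (z + h) - f z) * g z by ring.
  rewrite (le_trans (ler_normD _ _))// !normrM.
  have := ler_pM (normr_ge0 _) (normr_ge0 _) fh g1.
  have := ler_pM (normr_ge0 _) (normr_ge0 _) f1 g0.
  have : 0 <= A * B * d by rewrite mulr_ge0.
  lra.
- have -> : \sum_i h ord0 i * (f z * dg i z + g z * df i z) =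
    f z * (\sum_i h ord0 i * dg i z) + g z * (\sum_i h ord0 i * df i z).
    by rewrite !mulr_sumr -big_split/=; apply: eq_bigr => i _; ring.
  set F := \sum_i _ * df i z in f2 *; set G := \sum_i _ * dg i z in g2 *.
  have -> : f (z + h) * g (z + h) - f z * g z - (f z * G + g z * F) =
    (f (z + h) - f z - F) * g z + f z * (g (z + h) - g z - G) +
    (f (z + h) - f z) * (g (z + h) - g z) by ring.
  rewrite (le_trans (ler_normD _ _))//.
  have := ler_pM (normr_ge0 _) (normr_ge0 _) f2 g0.
  have := ler_pM (normr_ge0 _) (normr_ge0 _) f0 g2.
  have := ler_pM (normr_ge0 _) (normr_ge0 _) f1 g1.
  rewrite -!normrM => h1 h2 h3.
  have := ler_normD ((f (z + h) - f z - F) * g z) (f z * (g (z + h) - g z - G)).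
  have -> : 3 * (A * B) * d ^+ 2 =
    A * d ^+ 2 * B + A * (B * d ^+ 2) + A * d * (B * d).
    by ring.
  lra.
Qed.

Lemma taylor2_prod (I : Type) (s : seq I) (f : I -> 'rV[R]_n -> R) :
  (forall i, exists df, taylor2 (f i) df) ->
  exists df, taylor2 (fun z => \prod_(i <- s) f i z) df.
Proof.
move=> fT; elim: s => [|i s [dg gT]].
  exists (fun _ _ => 0); under eq_fun do rewrite big_nil; exact: taylor2_cst.
have [df fT'] := fT i.
eexists; under eq_fun do rewrite big_cons; exact: taylor2M fT' gT.
Qed.

Lemma taylor2_is_derive f df (j : 'I_n) z : taylor2 f df ->
  is_derive z (delta_mx ord0 j) f (df j z).
Proof.
move=> [C C0 fC]; apply: (@is_derive_quadratic_remainder _ _ _ _ _ _ C) => h.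
rewrite -[h ^+ 2]real_normK ?num_real//.
have [i|_ _] := fC z (h *: delta_mx ord0 j) _ (normr_ge0 h).
  by rewrite !mxE eqxx/= normrM ler_piMr//; case: (_ == _);
    rewrite ?normr1 ?normr0.
rewrite [_ *: _ + z]addrC (bigD1 j)//= big1 ?addr0; last first.
  by move=> i /negbTE ij; rewrite !mxE eqxx ij mulr0 mul0r.
by rewrite !mxE !eqxx mulr1.
Qed.

Lemma taylor2_continuous f df : taylor2 f df -> continuous f.
Proof.
move=> [C C0 fC]; apply: (cube_lipschitz_continuous C0) => x h d d0 hd.
by have [] := fC x h d d0 hd.
Qed.

(** A separate [P] and [m] for each coordinate keeps the family closed under [partial]. For positive
    [k] the support lies in the closed cube of centre [x] and radius 1/k. *)
Definition bump_prod (k : R) (x : 'rV[R]_n) P m (y : 'rV[R]_n) : R :=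
  \prod_(i < n) bump (P i) (m i) (k * (y ord0 i - x ord0 i)).

Lemma is_derive_bump_affine (k c : R) (p : {poly R}) l (t : R) :
  is_derive t (1 : R) (fun t => bump p l (k * (t - c)))
    (bump (k *: dbump p l) l.+2 (k * (t - c))).
Proof.
have -> : bump (k *: dbump p l) l.+2 (k * (t - c)) =
    bump (dbump p l) l.+2 (k * (t - c)) * k.
  by rewrite /bump; case: ifP => _; rewrite ?mul0r// hornerZ; ring.
apply: (@is_derive1_comp _ (bump p l) (fun t => k * (t - c))).
  exact: is_derive_bump.
have -> : (fun t => k * (t - c)) = k \*: (id - cst c) by [].
by apply: is_derive_eq; rewrite subr0 [_ *: _]mulr1.
Qed.

Definition bump_dP (k : R) P m j : 'I_n -> {poly R} :=
  fun i => if i == j then k *: dbump (P i) (m i) else P i.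

Definition bump_dm m (j : 'I_n) : 'I_n -> nat :=
  fun i => if i == j then (m i).+2 else m i.

(** [taylor2_prod] supplies some first-order term; it must be the partial derivative, and along the
    axis [j] only the factor of index [j] varies. *)
Lemma taylor2_bump_prod k x P m : taylor2 (bump_prod k x P m)
  (fun j => bump_prod k x (bump_dP k P m j) (bump_dm m j)).
Proof.
have [df T] : exists df, taylor2 (bump_prod k x P m) df.
  apply: taylor2_prod => i; eexists.
  apply: (taylor2_coord i (f := fun t =>
    bump (P i) (m i) (k * (t - x ord0 i)))).
  - by move=> t; exact: is_derive_bump_affine.
  - by move=> t; exact: is_derive_bump_affine.
  - by have [C C0 h] := bump_bounded (P i) (m i); exists C.
  - by have [C C0 h] := bump_bounded (k *: dbump (P i) (m i)) (m i).+2;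
    exists C.
  - have [C C0 h] := bump_bounded (k *: dbump (k *: dbump (P i) (m i)) (m
    i).+2) (m i).+4.
    by exists C.
suff -> : (fun j => bump_prod k x (bump_dP k P m j) (bump_dm m j)) = df by [].
apply/funext => j; apply/funext => z.
have /@derive_val <- := taylor2_is_derive j z T.
rewrite /derive.
pose c := \prod_(i < n | i != j) bump (P i) (m i) (k * (z ord0 i - x ord0 i)).
pose b t := bump (P j) (m j) (k * (t - x ord0 j)).
have db : is_derive (z ord0 j) (1 : R) (c \*: b)
    (c *: bump (k *: dbump (P j) (m j)) (m j).+2 (k * (z ord0 j - x ord0 j))).
  by apply: (@is_deriveZ _ _ _ b c) => //; exact: is_derive_bump_affine.
transitivity ('D_1 (c \*: b) (z ord0 j)).
  rewrite (@derive_val _ _ _ _ _ _ _ db) /bump_prod (bigD1 j)//=.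
  rewrite /bump_dP /bump_dm eqxx [RHS]mulrC; congr (_ * _).
  by apply: eq_bigr => i /negbTE ->.
rewrite /derive.
set F := (X in lim (X @ _) = _); set G := (X in _ = lim (X @ _)).
suff -> : F = G by [].
apply/funext => h; rewrite {}/F {}/G /=.
congr (_ *: _).
have cE (y : 'rV[R]_n) : (forall i, i != j -> y ord0 i = z ord0 i) ->
   bump_prod k x P m y = c *: b (y ord0 j).
  move=> yz; rewrite /bump_prod (bigD1 j)//= mulrC; congr (_ * _).
  by apply: eq_bigr => i ij; rewrite yz.
rewrite !cE//.
  by rewrite !mxE !eqxx.
by move=> i /negbTE ij; rewrite !mxE ij eqxx mulr0 add0r.
Qed.

Lemma partial_bump_prod k x P m j :
  partial j (bump_prod k x P m) = bump_prod k x (bump_dP k P m j) (bump_dm m j).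
Proof.
apply/funext => z; rewrite /partial.
by have /@derive_val -> := taylor2_is_derive j z (taylor2_bump_prod k x P m).
Qed.

Lemma smooth_bump_prod k x P m : smooth (bump_prod k x P m).
Proof.
move=> s y.
have [P' [m' ->]] : exists P' m',
    foldr (@partial R n) (bump_prod k x P m) s = bump_prod k x P' m'.
  elim: s => [|j s [P' [m' IH]]]; first by exists P, m.
  by eexists; eexists; rewrite /= IH partial_bump_prod.
split=> [|i].
  exact: (taylor2_continuous (taylor2_bump_prod k x P' m')).
exact: (@ex_derive _ _ _ _ _ _ _ (taylor2_is_derive i y (taylor2_bump_prod k x
  P' m'))).
Qed.

Lemma compact_cube (x : 'rV[R]_n) (e : R) :
  compact [set y : 'rV[R]_n | forall i, `|y ord0 i - x ord0 i| <= e].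
Proof.
have -> : [set y : 'rV[R]_n | forall i, `|y ord0 i - x ord0 i| <= e] =
   [set y : 'rV[R]_n | forall i, `[x ord0 i - e,
     x ord0 i + e]%classic (y ord0 i)].
  by apply/seteqP; split => y /= h i; have := h i; rewrite in_itv/= ler_distl.
apply: (@rV_compact R n (fun i => `[x ord0 i - e, x ord0 i + e]%classic)) => i.
exact: segment_compact.
Qed.

(** The last clause concerns translates because the mollification at [x] tests the weak gradient
    with y |-> rho (y - x), which is admissible once the closed e-cube around [x] lies in [D]. *)
Lemma mollifier_exists (e : R) : 0 < e ->
  exists (rho : 'rV[R]_n -> R) (drho : 'I_n -> 'rV[R]_n -> R),
  [/\ [/\ forall z, 0 <= rho z, forall z, ~ cube 0 e z -> rho z = 0 &
        (0 < \int[lebesgue_rV n]_z (rho z)%:E)%E],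
      taylor2 rho drho, forall j, exists ddrho, taylor2 (drho j) ddrho &
      forall (D : set 'rV[R]_n) (x : 'rV[R]_n), (forall y : 'rV[R]_n,
        (forall i, `|y ord0 i - x ord0 i| <= e) -> D y) ->
        test_function D (fun y => rho (y - x)) /\
        forall j y, partial j (fun y : 'rV[R]_n =>
          rho (y - x)) y = drho j (y - x)].
Proof.
move=> e0; pose P : 'I_n -> {poly R} := fun=> 1;
  pose m : 'I_n -> nat := fun=> 0%N.
have bump1 t : 0 <= bump (1 : {poly R}) 0 t.
  by rewrite /bump; case: ifP => // _;
    rewrite hornerC mul1r expr0 mul1r expR_ge0.
exists (bump_prod e^-1 0 P m), (fun j =>
  bump_prod e^-1 0 (bump_dP e^-1 P m j) (bump_dm m j)).
have shiftE Q l (x : 'rV[R]_n) : (fun y : 'rV[R]_n =>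
  bump_prod e^-1 0 Q l (y - x)) = bump_prod e^-1 x Q l.
  apply/funext => y; apply: eq_bigr => i _; congr bump; congr (_ * _).
  by rewrite !mxE subr0.
have T := taylor2_bump_prod e^-1 0 P m.
have rho0 z : 0 <= bump_prod e^-1 0 P m z by apply: prodr_ge0 => i _;
  exact: bump1.
split=> //.
- split => // [z|].
    move=> /existsNP[i /negP]; rewrite -leNgt => zi.
    rewrite /bump_prod (bigD1 i)//= bump_out ?mul0r//.
    by rewrite normrM gtr0_norm ?invr_gt0// ler_pdivlMl// mulr1.
  have mrho : measurable_fun setT (bump_prod e^-1 0 P m).
    exact: continuous_measurable_rV (taylor2_continuous T).
  rewrite lt0e; apply/andP; split; last first.
    by apply: integral_ge0 => z _; rewrite lee_fin.
  (* A zero integral would make the nonnegative mollifier vanish almost everywhere, but it is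
     positive on a cube of positive measure. *)
  apply/eqP => int0.
  have mErho : measurable_fun setT (EFin \o bump_prod e^-1 0 P m).
    exact/measurable_EFinP.
  have := (ae_eq_integral_abs (lebesgue_rV n) measurableT mErho).1.
  case.
    by under eq_integral => z _ do rewrite /= ger0_norm//.
  move=> N [mN N0 hN].
  have : (lebesgue_rV n (cube 0 e) <= 0)%E.
    rewrite -N0; apply: le_measure; rewrite ?inE//;
      first exact: measurable_cube.
    move=> z ze; apply: hN => /= /(_ I)[]; apply/eqP; rewrite gt_eqF//.
    apply: prodr_gt0 => i _; rewrite /bump ifT.
      by rewrite hornerC mul1r expr0 mul1r expR_gt0.
    by rewrite normrM gtr0_norm ?invr_gt0// ltr_pdivrMl// mulr1; exact: ze.
  apply/negP; rewrite -ltNge.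
  have -> : cube (0 : 'rV[R]_n) e =
    [set y | forall i, ball (0 : R) e (y ord0 i)].
    by apply/seteqP; split => y /= h i; have := h i;
      rewrite /ball /= mxE distrC.
  rewrite (@lebesgue_rV_box R n (fun=> ball 0 e) _).2; last first.
    by move=> i; exact: measurable_ball.
  apply: (big_ind (fun x : \bar R => 0 < x)%E) => // [x y|i _].
    exact: mule_gt0.
  by rewrite lebesgue_measure_ball ?ltW// lte_fin mulrn_wgt0.
- by move=> j; eexists; exact: taylor2_bump_prod.
- move=> D x xD; split; last first.
    move=> j y; rewrite shiftE partial_bump_prod.
    by rewrite -[RHS]/((fun y : 'rV[R]_n =>
      bump_prod e^-1 0 _ _ (y - x)) y) shiftE.
  rewrite shiftE; split; first exact: smooth_bump_prod.
  exists [set y | forall i, `|y ord0 i - x ord0 i| <= e]; split => //.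
    exact: compact_cube.
  move=> y /existsNP[i /negP]; rewrite -ltNge => yi.
  rewrite /bump_prod (bigD1 i)//= bump_out ?mul0r//.
  by rewrite normrM gtr0_norm ?invr_gt0// ler_pdivlMl// mulr1 ltW.
Qed.

End smooth_bump.

(** * Mollification of Sobolev functions *)

Section mollification.
Context {R : realType} {n : nat}.
Local Notation mu := (@lebesgue_rV R n).
Implicit Types (f phi : 'rV[R]_n -> R) (x y z : 'rV[R]_n).

Definition bounded_borel phi := measurable_fun setT phi /\
  exists2 C, 0 <= C & forall z, `|phi z| <= C.

Lemma taylor2_bounded_borel phi dphi : taylor2 phi dphi -> bounded_borel phi.
Proof.
move=> T; split; first exact: continuous_measurable_rV (taylor2_continuous T).
have [C C0 h] := T; exists C => // z; have [|//] := h z 0 0 (lexx 0).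
by move=> i; rewrite mxE normr0.
Qed.

Lemma bounded_borel_shift phi x : bounded_borel phi ->
  bounded_borel (fun y => phi (y - x)).
Proof.
move=> [mphi [C C0 h]]; split; last by exists C.
by apply: (measurableT_comp mphi); exact: measurable_translate.
Qed.

Lemma integrable_mul_bounded f phi : mu.-integrable setT (EFin \o f) ->
  bounded_borel phi -> mu.-integrable setT (fun y => (f y * phi y)%:E).
Proof.
move=> intf [mphi [C C0 hC]].
have /integrableP[/measurable_EFinP mf _] := intf.
apply: (@le_integrable _ _ _ _ _ measurableT _ (fun y =>
  C%:E * (EFin \o f) y)%E).
- by apply/measurable_EFinP; exact: measurable_funM.
- move=> y _ /=; rewrite lee_fin !normrM (ger0_norm C0) mulrC ler_wpM2r//.
- exact: integrableZl.
Qed.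

Lemma Rintegral_mul_le f phi (K : R) : mu.-integrable setT (EFin \o f) ->
  measurable_fun setT phi -> (forall y, `|phi y| <= K) ->
  `|\int[mu]_y (f y * phi y)| <= K * \int[mu]_y `|f y|.
Proof.
move=> intf mphi hK; have K0 : 0 <= K by exact: le_trans (hK 0).
have bphi : bounded_borel phi by split => //; exists K.
have ifp := integrable_mul_bounded intf bphi.
apply: (le_trans (le_normr_Rintegral measurableT ifp)).
have inf : mu.-integrable setT (EFin \o (fun y => `|f y|)).
  exact: integrable_norm.
rewrite -RintegralZl//; apply: le_Rintegral => //.
- exact: (integrable_norm ifp).
- exact: (integrableZl _ K inf).
- by move=> y _; rewrite normrM mulrC ler_wpM2r.
Qed.

Lemma bounded_borel_sum (I : Type) (s : seq I) (c : I -> R)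
    (psi : I -> 'rV[R]_n -> R) : (forall i, bounded_borel (psi i)) ->
  bounded_borel (fun y => \sum_(i <- s) c i * psi i y).
Proof.
move=> bpsi; elim: s => [|i s [mS [C C0 hC]]].
  split; first by under eq_fun do rewrite big_nil; exact: measurable_cst.
  by exists 0 => // z; rewrite big_nil normr0.
have [mi [B B0 hB]] := bpsi i; split.
  under eq_fun do rewrite big_cons; apply: measurable_funD => //.
  exact: measurable_funM.
exists (`|c i| * B + C) => [|z]; first by rewrite addr_ge0// mulr_ge0.
rewrite big_cons (le_trans (ler_normD _ _))// lerD//.
by rewrite normrM ler_wpM2l.
Qed.

Lemma Rintegral_mul_sum f (I : Type) (s : seq I) (c : I -> R)
    (psi : I -> 'rV[R]_n -> R) : mu.-integrable setT (EFin \o f) ->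
  (forall i, bounded_borel (psi i)) ->
  \int[mu]_y (f y * \sum_(i <- s) c i * psi i y) =
  \sum_(i <- s) c i * \int[mu]_y (f y * psi i y).
Proof.
move=> intf bpsi; elim: s => [|i s IH].
  rewrite big_nil; under eq_Rintegral do rewrite big_nil mulr0.
  by rewrite /Rintegral integral0.
rewrite big_cons -IH -RintegralZl//; last exact: integrable_mul_bounded.
rewrite -RintegralD//.
- by apply: eq_Rintegral => y _; rewrite big_cons mulrDr mulrCA.
- exact: (integrableZl _ (c i) (integrable_mul_bounded intf (bpsi i))).
- exact: (integrable_mul_bounded intf (bounded_borel_sum s c bpsi)).
Qed.

(** A correlation instead of a convolution, so that the kernel is a translate of [phi] in [y], as
    the test functions are. Differentiation in [x] brings a minus sign, which cancels the one in
    [weak_gradient]. *)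
Definition correlation f phi x : R := \int[mu]_y (f y * phi (y - x)).

Lemma correlation_lipschitz f phi dphi : mu.-integrable setT (EFin \o f) ->
  taylor2 phi dphi -> exists2 C, 0 <= C &
  forall x (h : 'rV[R]_n) (d : R), 0 <= d -> (forall i, `|h ord0 i| <= d) ->
    `|correlation f phi (x + h) - correlation f phi x| <= C * d.
Proof.
move=> intf T; have [C C0 hC] := T.
exists (C * \int[mu]_y `|f y|) => [|x h d d0 hd].
  by rewrite mulr_ge0// Rintegral_ge0.
have bphi := taylor2_bounded_borel T.
have b1 := bounded_borel_shift (x + h) bphi.
have b2 := bounded_borel_shift x bphi.
rewrite /correlation -RintegralB//; [|exact: integrable_mul_bounded..].
under eq_Rintegral do rewrite -mulrBr.
rewrite mulrAC; apply: Rintegral_mul_le => //.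
  by apply: measurable_funB; [case: b1|case: b2].
move=> y; have [|_ + _] := hC (y - x) (- h) d d0.
  by move=> i; rewrite mxE normrN.
by rewrite -addrA -opprD.
Qed.

(** The expansion of [phi] at y - x with increment -h is uniform in y, so it integrates against [f];
    the increment -h explains the plus sign before the sum. *)
Lemma correlation_taylor f phi dphi : mu.-integrable setT (EFin \o f) ->
  taylor2 phi dphi -> (forall j, bounded_borel (dphi j)) ->
  exists2 C, 0 <= C & forall x (h : 'rV[R]_n) (d : R), 0 <= d ->
    (forall i, `|h ord0 i| <= d) ->
    `|correlation f phi (x + h) - correlation f phi x +
      \sum_i h ord0 i * correlation f (dphi i) x| <= C * d ^+ 2.
Proof.
move=> intf T bd; have [C C0 hC] := T.
exists (C * \int[mu]_y `|f y|) => [|x h d d0 hd].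
  by rewrite mulr_ge0// Rintegral_ge0.
have bphi := taylor2_bounded_borel T.
have b1 := bounded_borel_shift (x + h) bphi.
have b2 := bounded_borel_shift x bphi.
have i1 := integrable_mul_bounded intf b1.
have i2 := integrable_mul_bounded intf b2.
have bx i := bounded_borel_shift x (bd i).
have bS := bounded_borel_sum (index_enum 'I_n) (fun i => h ord0 i) bx.
rewrite /correlation -Rintegral_mul_sum// -RintegralB// -RintegralD//;
  last 2 first.
- exact: (integrableB measurableT i1 i2).
- exact: integrable_mul_bounded.
under eq_Rintegral do rewrite -mulrBr -mulrDr.
rewrite mulrAC; apply: Rintegral_mul_le => //.
  apply: measurable_funD; last by case: bS.
  by apply: measurable_funB; [case: b1|case: b2].
move=> y; have [|_ _ ] := hC (y - x) (- h) d d0.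
  by move=> i; rewrite mxE normrN.
rewrite (_ : y - x - h = y - (x + h)); last by rewrite -addrA -opprD.
congr (`|_ + _| <= _).
by rewrite -sumrN; apply: eq_bigr => i _; rewrite mxE mulNr opprK.
Qed.

Lemma bounded_borel_cube_integrable phi (e : R) : bounded_borel phi ->
  (forall z, ~ cube 0 e z -> phi z = 0) -> mu.-integrable setT (EFin \o phi).
Proof.
move=> [mphi [C C0 hC]] phi0; apply/integrableP; split;
  first exact/measurable_EFinP.
apply: (@le_lt_trans _ _ (\int[mu]_z (C * \1_(cube 0 e) z)%:E)%E).
  apply: ge0_le_integral => //.
  - by apply: measurableT_comp => //; exact/measurable_EFinP.
  - apply/measurable_EFinP; apply: measurable_funM => //.
    by apply: measurable_indic; exact: measurable_cube.
  - move=> z _ /=; rewrite lee_fin indicE.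
    have [ze|ze] := pselect (cube 0 e z); first by rewrite mem_set// mulr1.
    by rewrite phi0// normr0 mulr_ge0.
under eq_integral do rewrite EFinM.
rewrite ge0_integralZl//; last first.
  by apply/measurable_EFinP; apply: measurable_indic; exact: measurable_cube.
rewrite integral_indic ?setIT//; last exact: measurable_cube.
by rewrite lte_mul_pinfty//; exact: cube_fin.
Qed.

(** The kernel is not normalised, hence the division by its integral. *)
Definition mollify rho f x : R :=
  (\int[mu]_z rho z)^-1 * correlation f rho x.

Section mollify_L1.
Variables (rho f : 'rV[R]_n -> R) (e d : R).
Hypothesis brho : bounded_borel rho.
Hypothesis rho_ge0 : forall z, 0 <= rho z.
Hypothesis rho_supp : forall z, ~ cube 0 e z -> rho z = 0.
Hypothesis rho_gt0 : (0 < \int[mu]_z (rho z)%:E)%E.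
Hypothesis intf : mu.-integrable setT (EFin \o f).
Hypothesis d_ge0 : 0 <= d.
Hypothesis fd : forall a : 'rV[R]_n, (forall i, `|a ord0 i| < e) ->
  (\int[mu]_x `|f (x + a)%R - f x|%:E <= d%:E)%E.

Let Z := \int[mu]_z rho z.

Let ZE : (\int[mu]_z (rho z)%:E)%E = Z%:E.
Proof.
rewrite fineK//; apply: integrable_fin_num => //.
exact: (bounded_borel_cube_integrable brho rho_supp).
Qed.

Let Z_gt0 : 0 < Z. Proof. by move: rho_gt0; rewrite ZE lte_fin. Qed.

Let mf : measurable_fun setT f.
Proof. by have /integrableP[/measurable_EFinP] := intf. Qed.

Let mrho : measurable_fun setT rho. Proof. by case: brho. Qed.

Let mollify_dist x : (`|mollify rho f x - f x|%:E <=
  Z^-1%:E * \int[mu]_z (`|f (x + z)%R - f x| * rho z)%:E)%E.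
Proof.
have bx := bounded_borel_shift x brho.
have ix := integrable_mul_bounded intf bx.
have ZxE : (\int[mu]_y (rho (y - x)%R)%:E)%E = Z%:E.
  rewrite -ZE; apply: (ge0_integral_translate (- x) (f := EFin \o rho)).
    exact/measurable_EFinP.
  by move=> z; rewrite lee_fin.
have Zx : \int[mu]_y rho (y - x) = Z by rewrite /Rintegral ZxE.
have irx : mu.-integrable setT (EFin \o (fun y => rho (y - x))).
  apply/integrableP; split; first by apply/measurable_EFinP; case: bx.
  by under eq_integral do rewrite /= ger0_norm//; rewrite ZxE ltry.
have E : mollify rho f x - f x = Z^-1 * \int[mu]_y ((f y - f x) * rho (y - x)).
  rewrite /mollify -/Z -[f x in LHS](mulKf (lt0r_neq0 Z_gt0)) -mulrBr.
  congr (_ * _); rewrite -{1}Zx mulrC -RintegralZl//.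
  rewrite /correlation -RintegralB//; last exact: (integrableZl _ (f x) irx).
  by apply: eq_Rintegral => y _; rewrite mulrBl.
have iB : mu.-integrable setT (EFin \o (fun y => (f y - f x) * rho (y - x))).
  apply: eq_integrable (integrableB measurableT ix (integrableZl measurableT
    (f x) irx)) => //.
  by move=> y _ /=; rewrite mulrBl.
have Zi0 : 0 <= Z^-1 by rewrite invr_ge0 ltW.
rewrite E normrM (ger0_norm Zi0) EFinM; apply: lee_wpmul2l => //.
rewrite EFin_normr_Rintegral//;
  apply: (le_trans (le_abse_integral _ _ _)) => //.
  by have /integrableP[] := iB.
rewrite -(ge0_integral_translate (- x)
  (f := fun z => (`|f (x + z)%R - f x| * rho z)%:E)); last 2 first.
- apply/measurable_EFinP; apply: measurable_funM => //.
  apply: measurableT_comp => //; apply: measurable_funB => //.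
  apply: (measurableT_comp mf); 
  by apply: measurable_fun_addrV => //; exact: measurable_cst.
- by move=> z; rewrite lee_fin mulr_ge0.
rewrite le_eqVlt; apply/orP; left; apply/eqP; apply: eq_integral => y _ /=.
by rewrite normrM (ger0_norm (rho_ge0 _)) subrKC.
Qed.

(** The error at x is the average of f (x + z) - f x over z, with weight rho z / Z. Tonelli
    exchanges the integrals, and only z in [cube 0 e] contribute, where [fd] applies. *)
Lemma mollify_L1 : (\int[mu]_x `|mollify rho f x - f x|%:E <= d%:E)%E.
Proof.
pose F (p : 'rV[R]_n * 'rV[R]_n) : \bar R :=
  (`|f (p.1 + p.2)%R - f p.1| * rho p.2)%:E.
have mF : measurable_fun setT F.
  apply/measurable_EFinP; apply: measurable_funM;
    last exact: (measurableT_comp mrho).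
  apply: measurableT_comp => //; apply: measurable_funB;
    last exact: (measurableT_comp mf).
  by apply: (measurableT_comp mf); exact: measurable_fun_addrV.
have F0 p : (0 <= F p)%E by rewrite lee_fin mulr_ge0.
have Zi0 : (0 <= Z^-1%:E)%E by rewrite lee_fin invr_ge0 ltW.
apply: (@le_trans _ _ (\int[mu]_x (Z^-1%:E * \int[mu]_z F (x, z)))%E).
  apply: ae_le_integral_nomeas => [//|x _|].
    by apply: mule_ge0 => //; exact: integral_ge0.
  by apply: aeW => x _; exact: mollify_dist.
rewrite ge0_integralZl//; last 2 first.
- exact: measurable_fun_fubini_tonelli_F.
- by move=> x _; exact: integral_ge0.
rewrite (fubini_tonelli F)//.
apply: (@le_trans _ _ (Z^-1%:E * \int[mu]_z (d%:E * (rho z)%:E))%E).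
  apply: lee_wpmul2l => //; apply: ge0_le_integral => //.
  - by move=> z _; exact: integral_ge0.
  - exact: (@measurable_fun_fubini_tonelli_G _ _ _ _ _ _ F).
  - by apply: emeasurable_funM => //; exact/measurable_EFinP.
  move=> z _; rewrite /F/=; under eq_integral do rewrite mulrC EFinM.
  rewrite ge0_integralZl//; last 2 first.
  - apply/measurable_EFinP; apply: measurableT_comp => //.
    apply: measurable_funB => //; apply: (measurableT_comp mf).
    exact: measurable_translate.
  - by rewrite lee_fin.
  have [ze|ze] := pselect (cube 0 e z).
    rewrite muleC lee_wpmul2r ?lee_fin//; apply: fd => i.
    by have := ze i; rewrite mxE subr0.
  by rewrite rho_supp// mul0e mule0.
rewrite ge0_integralZl//; [|exact/measurable_EFinP|by move=> z _;
  rewrite lee_fin].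
by rewrite ZE -!EFinM lee_fin mulrCA mulVf ?mulr1// gt_eqF.
Qed.

End mollify_L1.

Lemma L2_integrable (D : set 'rV[R]_n) v : measurable D -> (mu D < +oo)%E ->
  L2 D v -> mu.-integrable D (EFin \o v).
Proof.
move=> mD Doo [mv voo]; apply/integrableP; split; first exact/measurable_EFinP.
apply: (@le_lt_trans _ _ (\int[mu]_(x in D) (cst 1%E x + (v x ^+ 2)%:E))%E).
  apply: ge0_le_integral => //.
  - by apply: measurableT_comp => //; exact/measurable_EFinP.
  - apply/measurable_EFinP; apply: measurable_funD => //.
    exact: measurable_funX.
  - move=> x _ /=; rewrite lee_fin -[v x ^+ 2]real_normK ?num_real//.
    have := sqr_ge0 (`|v x| - 1); rewrite sqrrB mulr1 expr1n;
      have := normr_ge0 (v x); lra.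
rewrite ge0_integralD//; last 2 first.
- by move=> x _; rewrite lee_fin sqr_ge0.
- by apply/measurable_EFinP; exact: measurable_funX.
by rewrite integral_cst// mul1e lte_add_pinfty.
Qed.

Lemma L2_subr (E : set 'rV[R]_n) (v : 'rV[R]_n -> R) (c : R) :
  measurable E -> (mu E < +oo)%E -> L2 E v -> L2 E (fun x => v x - c).
Proof.
move=> mE Eoo [mv voo]; split; first exact: measurable_funB.
have mv2 : measurable_fun E (fun x => (v x ^+ 2)%:E).
  by apply/measurable_EFinP; exact: measurable_funX.
apply: (@le_lt_trans _ _
    (\int[mu]_(x in E) (2%:E * (v x ^+ 2)%:E + cst (2 * c ^+ 2)%:E x))%E).
  apply: ge0_le_integral => //.
  - by move=> x _; rewrite lee_fin sqr_ge0.
  - by apply/measurable_EFinP; apply: measurable_funX; exact: measurable_funB.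
  - by apply: emeasurable_funD => //; exact: measurable_funeM.
  move=> x _; rewrite /= -EFinM -EFinD lee_fin -subr_ge0.
  by rewrite (_ : _ - _ = (v x + c) ^+ 2); [exact: sqr_ge0|ring].
rewrite ge0_integralD//; last 3 first.
- by move=> x _; rewrite -EFinM lee_fin mulr_ge0// sqr_ge0.
- exact: measurable_funeM.
- by move=> x _; rewrite lee_fin mulr_ge0// sqr_ge0.
rewrite integral_cst// ge0_integralZl//; last by move=> x _;
  rewrite lee_fin sqr_ge0.
apply: lte_add_pinfty; apply: lte_mul_pinfty => //.
by rewrite lee_fin mulr_ge0// sqr_ge0.
Qed.

(* The first-order expansion is only required at points whose [e]-cube lies in
   [D], where the mollified weak gradient is the gradient of the
     mollification. *)
Definition inner_taylor (D : set 'rV[R]_n) (e : R) (w : 'rV[R]_n -> R)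
    (dw : 'I_n -> 'rV[R]_n -> R) :=
  exists2 C, 0 <= C & forall (x h : 'rV[R]_n) (d : R), 0 <= d ->
    (forall i, `|h ord0 i| <= d) ->
    (forall i, `|dw i (x + h) - dw i x| <= C * d) /\
    ((forall y : 'rV[R]_n, (forall i, `|y ord0 i - x ord0 i| <= e) -> D y) ->
     `|w (x + h) - w x - \sum_i h ord0 i * dw i x| <= C * d ^+ 2).

(** The zero extensions of [v] and [g] are integrable on the whole space, so their translations are
    continuous in L^1 and a mollification at a small enough scale reaches any accuracy. The rate
    2^-k makes the errors summable. *)
Lemma sobolev_approx (D : set 'rV[R]_n) v (g : 'rV[R]_n -> 'rV[R]_n) :
  open D -> (mu D < +oo)%E -> H1 D v g ->
  exists (vk : nat -> 'rV[R]_n -> R) (gk : nat -> 'I_n -> 'rV[R]_n -> R),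
  [/\ (forall k, measurable_fun setT (vk k)) /\
        (forall k i, measurable_fun setT (gk k i)),
      forall k, (\int[mu]_x `|vk k x - (v \_ D) x|%:E <= (2^-1 ^+ k)%:E)%E,
      forall k i, (\int[mu]_x
        `|gk k i x - ((fun y => g y ord0 i) \_ D) x|%:E <= (2^-1 ^+ k)%:E)%E &
      forall k, inner_taylor D k.+1%:R^-1 (vk k) (gk k)].
Proof.
move=> oD Doo [Lv Lg wg]; have mD := open_measurable_rV oD.
pose v0 := v \_ D; pose g0 i := (fun x => g x ord0 i) \_ D.
have extI u : L2 D u -> mu.-integrable setT (EFin \o (u \_ D)).
  by move=> Lu; rewrite -restrict_EFin -integrable_mkcond//;
    exact: L2_integrable.
have iv0 : mu.-integrable setT (EFin \o v0) by exact: extI.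
have ig0 i : mu.-integrable setT (EFin \o g0 i) by apply: extI; exact: Lg.
suff main k : exists (w : 'rV[R]_n -> R) (wg : 'I_n -> 'rV[R]_n -> R),
  [/\ measurable_fun setT w /\ forall i, measurable_fun setT (wg i),
      (\int[mu]_x `|w x - v0 x|%:E <= (2^-1 ^+ k)%:E)%E,
      forall i, (\int[mu]_x `|wg i x - g0 i x|%:E <= (2^-1 ^+ k)%:E)%E &
      inner_taylor D k.+1%:R^-1 w wg].
  have [vk /choice[gk H]] := choice main.
  exists vk, gk; split.
  - by split => k; have [[]] := H k.
  - by move=> k; have [] := H k.
  - by move=> k; have [] := H k.
  - by move=> k; have [] := H k.
have p0 : 0 < (2^-1 : R) ^+ k by rewrite exprn_gt0.
have [e e0 [ek he]] : exists2 e : R, 0 < e & e <= k.+1%:R^-1 /\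
    (forall a : 'rV[R]_n, (forall i, `|a ord0 i| < e) ->
     (\int[mu]_x `|v0 (x + a)%R - v0 x|%:E <= (2^-1 ^+ k)%:E)%E /\
     forall i, (\int[mu]_x `|g0 i (x + a)%R - g0 i x|%:E <= (2^-1 ^+ k)%:E)%E).
  have [_ /(_ _ p0)[d d0 hd]] := integrable_fun_shift_cvg iv0.
  have /choice[dg hdg] : forall i, exists c : R, 0 < c /\ forall a : 'rV[R]_n,
      (forall i, `|a ord0 i| < c) ->
      (\int[mu]_x `|g0 i (x + a)%R - g0 i x|%:E <= (2^-1 ^+ k)%:E)%E.
    by move=> i; have [_ /(_ _ p0)[c c0 hc]] :=
      integrable_fun_shift_cvg (ig0 i); exists c.
  (* The scale is at most 1/(k+1) and at most the moduli of continuity under translation of [v0] and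
     of all components of [g0]. *)
  exists (Num.min (Num.min k.+1%:R^-1 d) (\big[Num.min/1]_i dg i)).
    rewrite !lt_min invr_gt0 ltr0n d0/=.
    by apply: (big_ind (fun x : R => 0 < x)) => // [x y x0 y0|i _];
      [rewrite lt_min x0|case: (hdg i)].
  split; first by rewrite !ge_min lexx.
  move=> a ha; split.
    by apply: hd => i; apply: (lt_le_trans (ha i)); rewrite !ge_min lexx orbT.
  move=> i; apply: (hdg i).2 => j; apply: (lt_le_trans (ha j)).
  by rewrite ge_min; apply/orP; right; exact: bigmin_le.
have [rho [drho [[rho0 rhoS rhoI] T dT testT]]] := @mollifier_exists R n e e0.
have brho := taylor2_bounded_borel T.
have bd j : bounded_borel (drho j) by have [dd /taylor2_bounded_borel] := dT j.
exists (mollify rho v0), (fun i => mollify rho (g0 i)).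
have [Cv Cv0 hCv] := correlation_taylor iv0 T bd.
have /choice[Cg hCg] : forall i, exists C, 0 <= C /\
   forall x (h : 'rV[R]_n) (d : R), 0 <= d -> (forall i, `|h ord0 i| <= d) ->
    `|correlation (g0 i) rho (x + h) - correlation (g0 i) rho x| <= C * d.
  by move=> i; have [C C0 hC] := correlation_lipschitz (ig0 i) T; exists C.
set Zi := (\int[mu]_z rho z)^-1.
have mM u C : 0 <= C -> (forall x (h : 'rV[R]_n) (d : R), 0 <= d ->
    (forall i, `|h ord0 i| <= d) ->
    `|correlation u rho (x + h) - correlation u rho x| <= C * d) ->
    measurable_fun setT (mollify rho u).
  move=> C0 hC; apply: measurable_funM; first exact: measurable_cst.
  exact: continuous_measurable_rV (cube_lipschitz_continuous C0 hC).
have mv : measurable_fun setT (mollify rho v0).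
  have [C C0 hC] := correlation_lipschitz iv0 T; exact: mM C0 hC.
have mg i : measurable_fun setT (mollify rho (g0 i)).
  have [C0 hC] := hCg i; exact: mM C0 hC.
split => //.
- apply: (mollify_L1 brho rho0 rhoS rhoI iv0 (ltW p0)) => a ha.
  by have [] := he a ha.
- move=> i; apply: (mollify_L1 brho rho0 rhoS rhoI (ig0 i) (ltW p0)) => a ha.
  by have [_] := he a ha.
have SC0 : 0 <= \sum_i Cg i by apply: sumr_ge0 => i _; have [] := hCg i.
exists (`|Zi| * (Cv + \sum_i Cg i)) => [|x h d d0 hd];
  first by rewrite mulr_ge0// addr_ge0.
split=> [i|xD].
  rewrite /mollify -/Zi -mulrBr normrM -mulrA ler_wpM2l//.
  have [_ hC] := hCg i; apply: (le_trans (hC x h d d0 hd)).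
  rewrite ler_wpM2r// (bigD1 i)//= addrCA lerDl addr_ge0//.
  by apply: sumr_ge0 => j _; have [] := hCg j.
have [] := testT D x _.
  by move=> y yx; apply: xD => i; exact: le_trans (yx i) ek.
move=> test partE.
(* The definition of the weak gradient, tested with y |-> rho (y - x); this is where the cube around
   [x] has to lie in [D]. *)
have corrE i : correlation v0 (drho i) x = - correlation (g0 i) rho x.
  rewrite /correlation /Rintegral -fineN; congr fine.
  transitivity (\int[mu]_(y in D) (v y * partial i (fun y : 'rV[R]_n =>
    rho (y - x)) y)%:E)%E.
    rewrite [RHS]integral_mkcond; apply: eq_integral => y _.
    by rewrite /v0 !patchE; case: ifP => _; rewrite ?mul0r// partE.
  rewrite wg//; congr (- _)%E; rewrite [LHS]integral_mkcond;
    apply: eq_integral => y _.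
  by rewrite /g0 !patchE; case: ifP => _; rewrite ?mul0r.
have := hCv x h d d0 hd.
under eq_bigr do rewrite corrE mulrN.
rewrite sumrN => hC.
rewrite /mollify -/Zi.
have -> : Zi * correlation v0 rho (x + h) - Zi * correlation v0 rho x -
    \sum_i h ord0 i * (Zi * correlation (g0 i) rho x) =
  Zi * (correlation v0 rho (x + h) - correlation v0 rho x -
    \sum_i h ord0 i * correlation (g0 i) rho x).
  by rewrite !mulrBr mulr_sumr; congr (_ - _); apply: eq_bigr => i _;
    rewrite mulrCA.
rewrite normrM -mulrA ler_wpM2l// (le_trans hC)// ler_wpM2r ?sqr_ge0//.
by rewrite lerDl.
Qed.

End mollification.

(** * Euclidean norms and square-integrable functions *)

Section euclidean_norm.
Context {R : realType} {n : nat}.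
Implicit Types x y : 'rV[R]_n.

Lemma enorm_ge0 x : 0 <= enorm x. Proof. exact: sqrtr_ge0. Qed.

Lemma sqr_enorm x : enorm x ^+ 2 = \sum_i x ord0 i ^+ 2.
Proof. by rewrite sqr_sqrtr// sumr_ge0// => i _; rewrite sqr_ge0. Qed.

Lemma coord_le_enorm x i : `|x ord0 i| <= enorm x.
Proof.
rewrite -(@ler_pXn2r _ 2) ?nnegrE ?enorm_ge0// sqr_enorm real_normK ?num_real//.
by rewrite (bigD1 i)//= lerDl sumr_ge0// => j _; rewrite sqr_ge0.
Qed.

Lemma enorm_cauchy_schwarz x y :
  `|\sum_i x ord0 i * y ord0 i| <= enorm x * enorm y.
Proof.
set A := \sum_i _.
have A2 : A ^+ 2 <= (enorm x * enorm y) ^+ 2.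
  rewrite exprMn !sqr_enorm; set X := \sum_i x _ _ ^+ 2;
    set Y := \sum_i y _ _ ^+ 2.
  have X0 : 0 <= X by apply: sumr_ge0 => i _; exact: sqr_ge0.
  have Y0 : 0 <= Y by apply: sumr_ge0 => i _; exact: sqr_ge0.
  have quad (a b : R) : 0 <= a ^+ 2 * X - 2 * a * b * A + b ^+ 2 * Y.
    have -> : a ^+ 2 * X - 2 * a * b * A + b ^+ 2 * Y =
        \sum_i (a * x ord0 i - b * y ord0 i) ^+ 2.
      rewrite /X /Y /A !mulr_sumr -sumrN -!big_split/=.
      by apply: eq_bigr => i _; ring.
    by apply: sumr_ge0 => i _; exact: sqr_ge0.
  have [Y00|Yn0] := eqVneq Y 0.
    have [->|A0] := eqVneq A 0; first by rewrite expr0n mulr_ge0.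
    (* With Y = 0 and A nonzero, this choice gives the form the negative value X - 2 (X + 1). *)
    have := quad 1 ((X + 1) / A); rewrite Y00 mulr0 addr0 mulr1 expr1n mul1r.
    by rewrite -mulrA divfK// => ?; exfalso; lra.
  have Yp : 0 < Y by rewrite lt0r Yn0.
  have := quad Y A.
  have -> : Y ^+ 2 * X - 2 * Y * A * A + A ^+ 2 * Y =
    Y * (X * Y - A ^+ 2) by ring.
  by rewrite pmulr_rge0// subr_ge0.
rewrite -(@ler_pXn2r _ 2) ?nnegrE ?mulr_ge0 ?enorm_ge0//.
by rewrite real_normK ?num_real.
Qed.

Lemma enormD x y : enorm (x + y) <= enorm x + enorm y.
Proof.
rewrite -(@ler_pXn2r _ 2) ?nnegrE ?addr_ge0 ?enorm_ge0// sqrrD !sqr_enorm.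
have := le_trans (ler_norm _) (enorm_cauchy_schwarz x y).
have -> : \sum_i (x + y) ord0 i ^+ 2 = \sum_i x ord0 i ^+ 2 +
   (\sum_i x ord0 i * y ord0 i) *+ 2 + \sum_i y ord0 i ^+ 2.
  rewrite -sumrMnl -!big_split/=; apply: eq_bigr => i _.
  by rewrite mxE sqrrD.
by rewrite lerD2r lerD2l => h; rewrite lerMn2r h orbT.
Qed.

Lemma enorm_le_sum x : enorm x <= \sum_i `|x ord0 i|.
Proof.
have S0 : 0 <= \sum_i `|x ord0 i| by exact: sumr_ge0.
rewrite -(@ler_pXn2r _ 2) ?nnegrE ?enorm_ge0// sqr_enorm expr2 mulr_suml.
apply: ler_sum => i _; rewrite -real_normK ?num_real// expr2 ler_wpM2l//.
by rewrite (bigD1 i)//= lerDl sumr_ge0.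
Qed.

Lemma measurable_enorm d (T : measurableType d) (f : T ->
  'rV[R]_n) (A : set T) :
  (forall i, measurable_fun A (fun t => f t ord0 i)) ->
  measurable_fun A (fun t => enorm (f t)).
Proof.
move=> mf; apply: (@measurableT_comp _ _ _ _ _ _ (@Num.sqrt R)).
  by apply: continuous_measurable_fun; exact: sqrt_continuous.
apply: measurable_sum => i; exact: measurable_funX.
Qed.

End euclidean_norm.

Section square_integrable.
Context {R : realType} {n : nat}.
Local Notation mu := (@lebesgue_rV R n).
Implicit Types (D E : set 'rV[R]_n) (v : 'rV[R]_n -> R).

Lemma L2_sqr_integrable D v : L2 D v ->
  mu.-integrable D (fun x => (v x ^+ 2)%:E).
Proof.
move=> [mv voo]; apply/integrableP; split.
  by apply/measurable_EFinP; exact: measurable_funX.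
by under eq_integral do rewrite /= ger0_norm ?sqr_ge0//.
Qed.

Lemma L2_enorm D (g : 'rV[R]_n -> 'rV[R]_n) : measurable D ->
  (forall i, L2 D (fun x => g x ord0 i)) -> L2 D (fun x => enorm (g x)).
Proof.
move=> mD Lg; split; first by apply: measurable_enorm => i; case: (Lg i).
under eq_integral do rewrite sqr_enorm -sumEFin.
rewrite ge0_integral_sum//; last 2 first.
- move=> i; apply/measurable_EFinP; apply: measurable_funX.
  by case: (Lg i).
- by move=> i x _; rewrite lee_fin sqr_ge0.
by apply: lte_sum_pinfty => i _; case: (Lg i).
Qed.

Lemma sqL2E D v : L2 D v -> (\int[mu]_(x in D) (v x ^+ 2)%:E = (sqL2 D v)%:E)%E.
Proof.
move=> [_ voo]; rewrite fineK// ge0_fin_numE// integral_ge0// => x _.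
by rewrite lee_fin sqr_ge0.
Qed.

Lemma sqL2_ge0 D v : 0 <= sqL2 D v.
Proof. by apply: fine_ge0; apply: integral_ge0 => x _;
  rewrite lee_fin sqr_ge0. Qed.

Lemma L2_subset D E v : measurable D -> measurable E -> E `<=` D -> L2 D v ->
  L2 E v.
Proof.
move=> mD mE ED [mv voo]; split; first exact: measurable_funS mv.
apply: le_lt_trans voo; apply: ge0_subset_integral => //.
  by apply/measurable_EFinP; exact: measurable_funX.
by move=> x _; rewrite lee_fin sqr_ge0.
Qed.

Lemma le_sqL2 D E v : measurable D -> measurable E -> E `<=` D -> L2 D v ->
  sqL2 E v <= sqL2 D v.
Proof.
move=> mD mE ED Lv; rewrite -lee_fin -!sqL2E//; last exact: L2_subset Lv.
apply: ge0_subset_integral => //.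
  by apply/measurable_EFinP; apply: measurable_funX; case: Lv.
by move=> x _; rewrite lee_fin sqr_ge0.
Qed.

(** Adding 2 c times the vanishing integral of [v] changes nothing, and v^2 <= (v - c)^2 + 2 c v
    pointwise. *)
Lemma sqL2_mean0_le D v c : measurable D -> (mu D < +oo)%E -> L2 D v ->
  (\int[mu]_(x in D) (v x)%:E = 0)%E -> sqL2 D v <= sqL2 D (fun x => v x - c).
Proof.
move=> mD Doo Lv v0; have Lc := L2_subr c mD Doo Lv.
have iv := L2_integrable mD Doo Lv.
have i2 := L2_sqr_integrable Lc.
rewrite -lee_fin -!sqL2E//.
have iz := integrableZl mD (2 * c) iv.
have -> : (\int[mu]_(x in D) ((v x - c) ^+ 2)%:E =
   \int[mu]_(x in D) ((v x - c) ^+ 2)%:E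
   + \int[mu]_(x in D) ((2 * c)%:E * (EFin \o v) x))%E.
  by rewrite integralZl// v0 mule0 adde0.
rewrite -integralD//.
apply: ge0_le_integral => //.
- by move=> x _; rewrite lee_fin sqr_ge0.
- by apply/measurable_EFinP; apply: measurable_funX; case: Lv.
- by have id := integrableD mD i2 iz; exact: (measurable_int _ id).
move=> x _; rewrite /= -EFinM -EFinD lee_fin; have := sqr_ge0 c; lra.
Qed.

End square_integrable.

(** * Sobolev functions along rectifiable curves *)

(* Bisection N times divides the quadratic error by 2 ^ N. *)
Lemma halving_estimate (R : realType) (F : R -> R) (Phi : R -> R ->
  R) (s t C : R) :
  (forall a c b, s <= a -> a <= c -> c <= b -> b <= t ->
     Phi a b = Phi a c + Phi c b) ->
  (forall a b, s <= a -> a <= b -> b <= t ->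
     `|F b - F a| <= Phi a b + C * (b - a) ^+ 2) ->
  s <= t -> `|F t - F s| <= Phi s t.
Proof.
move=> PhiD FPhi st.
have H N a b : s <= a -> a <= b -> b <= t ->
    `|F b - F a| <= Phi a b + C * (b - a) ^+ 2 * 2^-1 ^+ N.
  elim: N a b => [|N IH] a b sa ab bt; first by rewrite mulr1 FPhi.
  pose c := (a + b) / 2.
  have ac : a <= c by rewrite /c; lra.
  have cb : c <= b by rewrite /c; lra.
  have h1 := IH a c sa ac (le_trans cb bt).
  have h2 := IH c b (le_trans sa ac) cb bt.
  rewrite (PhiD a c b)//.
  have := ler_distD (F c) (F b) (F a) => h3.
  (* Each half carries a quarter of the squared length, so the two together halve the error. *)
  have E : C * (b - a) ^+ 2 * 2^-1 ^+ N.+1 = C * (c - a) ^+ 2 * 2^-1 ^+ N +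
     C * (b - c) ^+ 2 * 2^-1 ^+ N by rewrite [2^-1 ^+ _.+1]exprS /c;
       move: (2^-1 ^+ N) => p; field.
  rewrite E; lra.
apply/ler_addgt0Pr => e e0.
have : (fun N => C * (t - s) ^+ 2 * 2^-1 ^+ N) @ \oo --> (0 : R).
  rewrite -[X in _ --> X](mulr0 (C * (t - s) ^+ 2)).
  apply: cvgM; first exact: cvg_cst.
  by apply: cvg_expr; rewrite gtr0_norm ?invr_gt0// invf_lt1// ltr1n.
move=> /cvgrPdist_le/(_ _ e0)[N _ /(_ N (leqnn N))].
rewrite sub0r normrN => hN; apply: (le_trans (H N s t (lexx _) st (lexx _))).
by rewrite lerD2l (le_trans (ler_norm _) hN).
Qed.

Section curves.
Context {R : realType} {n : nat}.
Variables (gam : R -> 'rV[R]_n) (l : R).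
Hypothesis gam_lip : forall a b, 0 < a -> a <= b -> b < l ->
  enorm (gam b - gam a) <= b - a.

Let gam_coord a b i : 0 < a -> a < l -> 0 < b -> b < l ->
  `|gam b ord0 i - gam a ord0 i| <= `|b - a|.
Proof.
wlog ab : a b / a <= b => [wl a0 al b0 bl|a0 al b0 bl].
  have [ab|/ltW ba] := leP a b; first exact: wl.
  by rewrite distrC (distrC b); exact: wl.
rewrite (ger0_norm (_ : 0 <= b - a)) ?subr_ge0//.
apply: le_trans (gam_lip a0 ab bl).
by have := coord_le_enorm (gam b - gam a) i; rewrite !mxE.
Qed.

Lemma measurable_curve (f : 'rV[R]_n -> \bar R) : measurable_fun setT f ->
  measurable_fun `]0, l[%classic (fun t => f (gam t)).
Proof.
move=> mf.
pose gam0 t := if t \in `]0, l[ then gam t else 0.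
have mg : measurable_fun setT gam0.
  apply/measurable_fun_rVP => i.
  have -> : (fun t => gam0 t ord0 i) = (fun t =>
    gam t ord0 i) \_ `]0, l[%classic.
    by apply/funext => t; rewrite patchE mem_setE /gam0; case: ifP => // _;
      rewrite mxE.
  apply/(measurable_restrictT _ _).1 => //.
  apply: open_continuous_measurable_fun; first exact: interval_open.
  move=> t; rewrite inE/= in_itv/= => /andP[t0 tl].
  apply/cvgrPdist_le => e e0; near=> s.
  apply: (@le_trans _ _ `|t - s|).
    apply: gam_coord => //.
      by near: s; exact: lt_nbhsr.
    by near: s; exact: lt_nbhsl.
  by near: s; apply: (@cvgr_dist_le _ _ _ (nbhs t) _ id t) => //; exact: cvg_id.
apply: (@eq_measurable_fun _ _ _ _ _ (f \o gam0)).
  by move=> t; rewrite inE/= => tl; rewrite /gam0 tl.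
by apply: measurable_funTS; exact: measurableT_comp.
Unshelve. all: by end_near. Qed.

Lemma measurable_curveR (f : 'rV[R]_n -> R) : measurable_fun setT f ->
  measurable_fun `]0, l[%classic (fun t => f (gam t)).
Proof. by move=> /measurable_EFinP/measurable_curve/measurable_EFinP. Qed.

(** The Taylor bound on a chord and Cauchy-Schwarz give |u (gam b) - u (gam a)| <= (b - a) G a + C
    (b - a)^2. As [G] is Lipschitz with constant n C, its integral over ]a, b] differs from (b - a)
    G a by at most n C (b - a)^2. [halving_estimate] removes both quadratic errors. *)
Lemma curve_gradient_bound (u : 'rV[R]_n -> R) (w : 'I_n -> 'rV[R]_n -> R)
    (C s t : R) : 0 < s -> s <= t -> t < l -> 0 <= C ->
  (forall i, measurable_fun setT (w i)) ->
  (forall i x (h : 'rV[R]_n) d, 0 <= d -> (forall j, `|h ord0 j| <= d) ->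
     `|w i (x + h) - w i x| <= C * d) ->
  (forall a (h : 'rV[R]_n) d, s <= a -> a <= t -> 0 <= d ->
     (forall j, `|h ord0 j| <= d) ->
     `|u (gam a + h) - u (gam a) - \sum_i h ord0 i * w i (gam a)| <=
       C * d ^+ 2) ->
  (`|u (gam t) - u (gam s)|%:E <=
   \int[lebesgue_measure]_(a in `]s, t])
     (enorm (\row_i w i (gam a)))%:E)%E.
Proof.
move=> s0 st tl C0 mw wlip utaylor.
pose G a := enorm (\row_i w i (gam a)).
have K0 : 0 <= n%:R * C by rewrite mulr_ge0.
have Glip a b : s <= a -> a <= t -> s <= b -> b <= t ->
    G b <= G a + n%:R * C * `|b - a|.
  move=> sa at_ sb bt; have hj j : `|(gam b - gam a) ord0 j| <= `|b - a|.
    by rewrite !mxE; apply: gam_coord; lra.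
  have -> : G b = enorm (\row_i w i (gam a) + (\row_i w i (gam b) - \row_i w i
    (gam a))).
    by rewrite subrKC.
  rewrite (le_trans (enormD _ _))// lerD2l (le_trans (enorm_le_sum _))//.
  rewrite -mulrA mulr_natl -[X in _ *+ X]card_ord -sumr_const;
    apply: ler_sum => i _.
  by rewrite !mxE -{1}(subrKC (gam a) (gam b)); exact: wlip.
have mG : measurable_fun `]s, t]%classic G.
  apply: (@measurable_funS _ _ _ _ `]0, l[%classic) => //.
    by apply: subset_itv; rewrite bnd_simp//; lra.
  apply: (measurable_enorm (f := fun a => \row_i w i (gam a))) => i.
  have -> : (fun a => (\row_i w i (gam a)) ord0 i) = (fun a => w i (gam a)).
    by apply/funext => a; rewrite mxE.
  exact: measurable_curveR.
have iG : lebesgue_measure.-integrable `]s, t] (EFin \o G).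
  apply: measurable_bounded_integrable => //.
    by rewrite /= lebesgue_measure_itv/=; case: ifP => _;
      rewrite ?ltry// -EFinB ltry.
  exists (G s + n%:R * C * (t - s)); split => [|M /ltW KM a /=];
    first exact: num_real.
  rewrite in_itv/= => /andP[sa at_]; apply: le_trans KM;
    rewrite ger0_norm ?enorm_ge0//.
  apply: (le_trans (Glip s a (lexx s) st (ltW sa) at_)).
  by rewrite lerD2l ler_wpM2l// ger0_norm; lra.
have GE : (\int[lebesgue_measure]_(a in `]s, t]) (G a)%:E)%E =
    (\int[lebesgue_measure]_(a in `]s, t]) G a)%:E.
  by rewrite fineK//; exact: integrable_fin_num.
rewrite GE lee_fin.
have iGs a b : s <= a -> b <= t ->
  lebesgue_measure.-integrable `]a, b] (EFin \o G).
  move=> sa bt; apply: integrableS iG => //.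
  by apply: subset_itv; rewrite bnd_simp.
apply: (@halving_estimate _ (fun a => u (gam a))
  (fun a b => \int[lebesgue_measure]_(x in `]a,
    b]) G x) s t (C + n%:R * C)) => //.
- move=> a c b sa ac cb bt.
  rewrite -Rintegral_setU//.
  + by rewrite -itv_bndbnd_setU ?bnd_simp.
  + by rewrite -itv_bndbnd_setU ?bnd_simp//; exact: iGs.
  + apply/disj_setPS => x [] /=; rewrite !in_itv/= => /andP[_ xc] /andP[cx _].
    by have := lt_le_trans cx xc; rewrite ltxx.
- move=> a b sa ab bt.
  have [->|/eqP anb] := eqVneq a b.
    by rewrite !subrr normr0 expr0n mulr0 addr0 Rintegral_ge0// => *;
      exact: enorm_ge0.
  have ab' : 0 < b - a by rewrite subr_gt0 lt_neqAle ab andbT; apply/eqP.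
  have hj j : `|(gam b - gam a) ord0 j| <= b - a.
    by rewrite -(ger0_norm (ltW ab')) !mxE; apply: gam_coord; lra.
  have at_ : a <= t by lra.
  have := utaylor a _ _ sa at_ (ltW ab') hj.
  rewrite subrKC => hT.
  have hT' : `|u (gam b) - u (gam a)| <= (b - a) * G a + C * (b - a) ^+ 2.
    rewrite -[u (gam b) - u (gam a)](subrK (\sum_i (gam b - gam a) ord0 i * w
      i (gam a))).
    rewrite (le_trans (ler_normD _ _))// addrC lerD//.
    have := enorm_cauchy_schwarz (gam b - gam a) (\row_i w i (gam a)).
    under eq_bigr do rewrite [X in _ * X]mxE.
    move=> /le_trans; apply; rewrite ler_wpM2r ?enorm_ge0//.
    by apply: gam_lip; lra.
  (* After multiplication by b - a every term is an integral over ]a, b], constants included, and a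
     pointwise comparison suffices. *)
  rewrite -(ler_pM2l ab').
  have cstE (c : R) : \int[lebesgue_measure]_(x in `]a, b]) c = (b - a) * c.
    rewrite Rintegral_cst// /= lebesgue_measure_itv/= lte_fin -subr_gt0 ab'
      -EFinB/=.
    by rewrite mulrC.
  have icst (c : R) : lebesgue_measure.-integrable `]a, b] (EFin \o cst c).
    apply: measurable_bounded_integrable => //.
      by rewrite /= lebesgue_measure_itv/=; case: ifP => _;
        rewrite ?ltry// -EFinB ltry.
    by exists `|c|; split => [|M /ltW KM x _ /=]; [exact: num_real|].
  have iGab := iGs a b sa bt.
  rewrite mulrDr -RintegralZl// -!cstE -RintegralD//; last 2 first.
  - exact: (integrableZl _ (b - a) iGab).
  - exact: icst.
  apply: le_Rintegral => //; first exact: icst.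
    exact: (integrableD _ (integrableZl _ (b - a) iGab) (icst _)).
  move=> x /=; rewrite in_itv/= => /andP[ax xb].
  apply: (le_trans hT').
  have h1 : G a <= G x + n%:R * C * (b - a).
    apply: (le_trans (Glip x a _ _ _ _)); try lra.
    by rewrite lerD2l ler_wpM2l// ler0_norm; lra.
  have := ler_wpM2l (ltW ab') h1; rewrite mulrDr.
  have -> : (C + n%:R * C) * (b - a) ^+ 2 =
    (b - a) * (n%:R * C * (b - a)) + C * (b - a) ^+ 2 by ring.
  by rewrite addrA lerD2r.
Qed.

End curves.

Lemma nneseries_term_small (R : realType) (u : nat -> \bar R) (e : R) :
  (forall k, 0 <= u k)%E -> (\sum_(k <oo) u k < +oo)%E -> 0 < e ->
  exists N, forall k, (N <= k)%N -> (u k <= e%:E)%E.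
Proof.
move=> u0 uoo e0.
have /fine_cvgP[/= ufin /cvgrPdist_le/(_ _ e0) ule] :=
  @nneseries_tail_cvg R u xpredT uoo (fun k _ => u0 k).
have [N _ HN] : \forall N \near \oo, (\sum_(N <= k <oo) u k)%E \is a fin_num /\
   `|0 - fine (\sum_(N <= k <oo) u k)%E| <= e.
  by near=> N; split; near: N.
exists N => k Nk; have [kfin] := HN k Nk; rewrite sub0r normrN => kle.
apply: (@le_trans _ _ (\sum_(k <= i <oo) u i)%E).
  have := @nneseries_lim_ge R u xpredT k k.+1 (fun i _ _ => u0 i).
  by rewrite big_nat1.
by rewrite -[leLHS]fineK// lee_fin; exact: le_trans (ler_norm _) kle.
Unshelve. all: by end_near. Qed.

Section curve_limit.
Context {R : realType} {n : nat}.
Variables (gam : R -> 'rV[R]_n) (l : R) (D : set 'rV[R]_n).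
Hypothesis oD : open D.
Hypothesis gam_lip : forall a b, 0 < a -> a <= b -> b < l ->
  enorm (gam b - gam a) <= b - a.
Hypothesis gamD : forall a, 0 < a -> a < l -> D (gam a).

(** Around each point of the compact arc some cube lies in [D]; half its radius absorbs the motion
    of the curve, the other half the distance to [y]. Compactness makes the threshold uniform. *)
Lemma curve_uniformly_inside s t : 0 < s -> t < l ->
  exists N, forall k a (y : 'rV[R]_n), (N <= k)%N -> s <= a -> a <= t ->
    (forall i, `|y ord0 i - gam a ord0 i| <= k.+1%:R^-1) -> D y.
Proof.
move=> s0 tl.
pose P (k : nat) (a : R) := s <= a -> a <= t -> forall y : 'rV[R]_n,
  (forall i, `|y ord0 i - gam a ord0 i| <= k.+1%:R^-1) -> D y.
have /compact_near_coveringP/(_ nat \oo P) : compact `[s, t]%classic.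
  exact: segment_compact.
case=> [|N _ HN]; last first.
  exists N => k a y Nk sa at_; apply: (HN k Nk a) => //=.
  by rewrite in_itv/= sa.
move=> a /=; rewrite in_itv/= => /andP[sa at_].
have [e e0 he] := open_cubeP oD (gamD (lt_le_trans s0 sa) (le_lt_trans at_ tl)).
have e20 : 0 < e / 2 by rewrite divr_gt0.
exists ([set b | `|a - b| <= e / 2], [set k | (k.+1%:R : R)^-1 < e / 2]).
  split; last exact: near_infty_natSinv_lt (PosNum e20).
  by apply: (@cvgr_dist_le _ _ _ (nbhs a) _ id a) => //; exact: cvg_id.
move=> [b k] [/= ab ke] sb bt y yb; apply: he => i.
rewrite (splitr e); apply: (le_lt_trans (ler_distD (gam b ord0 i) _ _)).
apply: ltr_leD; first exact: le_lt_trans (yb i) ke.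
rewrite distrC in ab.
apply: le_trans ab.
have lipc c d : 0 < c -> c <= d -> d < l ->
  `|gam d ord0 i - gam c ord0 i| <= `|d - c|.
  move=> c0 cd dl; rewrite (ger0_norm (_ : 0 <= d - c)) ?subr_ge0//.
  apply: le_trans (gam_lip c0 cd dl).
  by have := coord_le_enorm (gam d - gam c) i; rewrite !mxE.
have [ab'|/ltW ba] := leP a b; first by apply: lipc => //; lra.
by rewrite distrC (distrC b); apply: lipc => //; lra.
Qed.

Variables (v : 'rV[R]_n -> R) (g : 'I_n -> 'rV[R]_n -> R).
Variables (vk : nat -> 'rV[R]_n -> R) (gk : nat -> 'I_n -> 'rV[R]_n -> R).
Hypothesis mv : measurable_fun setT v.
Hypothesis mg : forall i, measurable_fun setT (g i).
Hypothesis mvk : forall k, measurable_fun setT (vk k).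
Hypothesis mgk : forall k i, measurable_fun setT (gk k i).
Hypothesis approx : forall k, inner_taylor D k.+1%:R^-1 (vk k) (gk k).

Definition approx_error k x : R :=
  `|vk k x - v x| + \sum_i `|gk k i x - g i x|.

Definition total_error x : \bar R := (\sum_(k <oo) (approx_error k x)%:E)%E.

Lemma approx_error_ge0 k x : 0 <= approx_error k x.
Proof. by rewrite addr_ge0// sumr_ge0. Qed.

Lemma measurable_approx_error k : measurable_fun setT (approx_error k).
Proof.
apply: measurable_funD.
  by apply: measurableT_comp => //; exact: measurable_funB.
by apply: measurable_sum => i; apply: measurableT_comp => //;
  exact: measurable_funB.
Qed.

Lemma measurable_total_error : measurable_fun setT total_error.
Proof.
apply: (@ge0_emeasurable_sum _ _ _ _ (fun k x => (approx_error k x)%:E) xpredT).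
  by move=> k x _ _; rewrite lee_fin approx_error_ge0.
by move=> k _; apply/measurable_EFinP; exact: measurable_approx_error.
Qed.

(* Summability of the errors along the path makes the gradients converge in L^1
   of the path and the values converge wherever the series is finite. *)
Lemma curve_limit s t : 0 < s -> s <= t -> t < l ->
  (total_error (gam s) < +oo)%E -> (total_error (gam t) < +oo)%E ->
  (\int[lebesgue_measure]_(a in `]0%R, l[) total_error (gam a) < +oo)%E ->
  (`|v (gam t) - v (gam s)|%:E <=
   \int[lebesgue_measure]_(a in `]s, t]) (enorm (\row_i g i (gam a)))%:E)%E.
Proof.
move=> s0 st tl Es Et Eoo.
have sub : `]s, t]%classic `<=` `]0, l[%classic.
  by apply: subset_itv; rewrite bnd_simp//; lra.
have mE k : measurable_fun `]s, t]%classic (fun a =>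
  (approx_error k (gam a))%:E).
  apply: (@measurable_funS _ _ _ _ `]0, l[%classic) => //.
  apply: (measurable_curve gam_lip (f := fun x => (approx_error k x)%:E)).
  by apply/measurable_EFinP; exact: measurable_approx_error.
have mrow (u : 'I_n -> 'rV[R]_n -> R) : (forall i, measurable_fun setT (u i)) ->
    measurable_fun `]s, t]%classic (fun a => (enorm (\row_i u i (gam a)))%:E).
  move=> mu; apply/measurable_EFinP;
    apply: (@measurable_funS _ _ _ _ `]0, l[%classic) => //.
  apply: (measurable_enorm (f := fun a => \row_i u i (gam a))) => i.
  have -> : (fun a => (\row_i u i (gam a)) ord0 i) = (fun a => u i (gam a)).
    by apply/funext => a; rewrite mxE.
  exact: (measurable_curveR gam_lip).
have Ioo : (\sum_(k <oo) \int[lebesgue_measure]_(a in `]s, t])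
    (approx_error k (gam a))%:E < +oo)%E.
  rewrite -integral_nneseries//; last first.
    by move=> k a _; rewrite lee_fin approx_error_ge0.
  apply: le_lt_trans Eoo; apply: ge0_subset_integral => //.
    exact: (measurable_curve gam_lip measurable_total_error).
  by move=> a _; apply: nneseries_ge0 => k _ _;
    rewrite lee_fin approx_error_ge0.
apply/lee_addgt0Pr => e e0.
(* One third each for the value at [gam s], the value at [gam t] and the gradients along the arc. *)
have e30 : 0 < e / 3 by rewrite divr_gt0.
have Ege k x : (0 <= (approx_error k x)%:E)%E
  by rewrite lee_fin approx_error_ge0.
have [N1 H1] := nneseries_term_small (fun k => Ege k _) Es e30.
have [N2 H2] := nneseries_term_small (fun k => Ege k _) Et e30.
have Ige k : (0 <= \int[lebesgue_measure]_(a in `]s,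
  t]) (approx_error k (gam a))%:E)%E.
  by apply: integral_ge0 => a _; rewrite lee_fin approx_error_ge0.
have [N3 H3] := nneseries_term_small Ige Ioo e30.
have [N4 H4] := curve_uniformly_inside s0 tl.
pose k := maxn (maxn N1 N2) (maxn N3 N4).
have {}H1 : approx_error k (gam s) <= e / 3.
  by rewrite -lee_fin; apply: H1; rewrite !leq_max leqnn.
have {}H2 : approx_error k (gam t) <= e / 3.
  by rewrite -lee_fin; apply: H2; rewrite !leq_max leqnn orbT.
have {}H3 : (\int[lebesgue_measure]_(a in `]s,
  t]) (approx_error k (gam a))%:E <= (e / 3)%:E)%E.
  by apply: H3; rewrite !leq_max leqnn !orbT.
have kN4 : (N4 <= k)%N by rewrite !leq_max leqnn !orbT.
have [C C0 hC] := approx k.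
have := @curve_gradient_bound _ _ gam l gam_lip (vk k) (gk k) C s t s0 st tl
  C0 (mgk k).
move=> /(_ (fun i x h d d0 hd => (hC x h d d0 hd).1 i)).
move=> /(_ (fun a h d sa at_ d0 hd => (hC (gam a) h d d0 hd).2
   (fun y hy => H4 k a y kN4 sa at_ hy))) key.
have int_le : (\int[lebesgue_measure]_(a in `]s,
  t]) (enorm (\row_i gk k i (gam a)))%:E <=
    \int[lebesgue_measure]_(a in `]s,
      t]) (enorm (\row_i g i (gam a)))%:E + (e / 3)%:E)%E.
  apply: (@le_trans _ _ (\int[lebesgue_measure]_(a in `]s, t])
     ((enorm (\row_i g i (gam a)))%:E + (approx_error k (gam a))%:E))%E).
    apply: ge0_le_integral => //.
    - by move=> a _; rewrite lee_fin enorm_ge0.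
    - exact: (mrow _ (mgk k)).
    - by apply: emeasurable_funD; [exact: (mrow g mg)|exact: mE].
    move=> a _; rewrite -EFinD lee_fin.
    rewrite -[X in enorm X](subrK (\row_i g i (gam a))) addrC.
    rewrite (le_trans (enormD _ _))// lerD2l (le_trans (enorm_le_sum _))//.
    rewrite /approx_error -[leLHS]add0r lerD//.
    by apply: ler_sum => i _; rewrite !mxE.
  rewrite ge0_integralD//.
  - by rewrite leeD2l.
  - by move=> a _; rewrite lee_fin enorm_ge0.
  - exact: (mrow g mg).
  - exact: mE.
apply: (@le_trans _ _ ((e / 3)%:E + (e / 3)%:E + `|vk k (gam t) - vk k (gam
  s)|%:E)%E).
  rewrite -!EFinD lee_fin.
  have vE x : `|v x - vk k x| <= approx_error k x.
    by rewrite distrC lerDl sumr_ge0.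
  have h1 := le_trans (vE _) H1; have h2 := le_trans (vE _) H2.
  have := ler_distD (vk k (gam t)) (v (gam t)) (v (gam s)).
  have := ler_distD (vk k (gam s)) (vk k (gam t)) (v (gam s)).
  rewrite (distrC (vk k (gam s)) (v (gam s))); lra.
apply: (le_trans (leeD2l _ (le_trans key int_le))).
rewrite addeCA addeA -!EFinD.
by rewrite -addeA -EFinD leeD2l// lee_fin; lra.
Qed.

End curve_limit.

(** * The inequality on one leaf *)

Section leaf_inequality.
Context {R : realType}.
Local Notation leb := (@lebesgue_measure R).

(** Young's inequality h <= k/2 + h^2/(2k) is integrated. Taking k = 1 gives finiteness; taking k =
    N/l gives N <= l Gt / N. *)
Lemma integral_cauchy_schwarz (l Gt : R) (h : R -> R) : 0 < l ->
  measurable_fun `]0, l[%classic h ->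
  (forall t, 0 <= h t) ->
  (\int[leb]_(t in `]0%R, l[) (h t ^+ 2)%:E = Gt%:E)%E ->
  exists2 N, (\int[leb]_(t in `]0%R, l[) (h t)%:E = N%:E)%E & N ^+ 2 <= l * Gt.
Proof.
move=> l0 mh h0 hG.
have mu0l : leb `]0, l[%classic = l%:E.
  by rewrite /= lebesgue_measure_itv/= lte_fin l0 oppr0 adde0.
have mh2 : measurable_fun `]0, l[%classic (fun t => (h t ^+ 2)%:E).
  by apply/measurable_EFinP; exact: measurable_funX.
have young k : 0 < k -> (\int[leb]_(t in `]0%R, l[) (h t)%:E <=
    ((k * l + k^-1 * Gt) / 2)%:E)%E.
  move=> k0; apply: (@le_trans _ _ (\int[leb]_(t in `]0%R, l[)
      (cst (k / 2)%:E t + (k^-1 / 2)%:E * (h t ^+ 2)%:E))%E).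
    apply: ge0_le_integral => //.
    - by move=> t _; rewrite lee_fin.
    - exact/measurable_EFinP.
    - by apply: emeasurable_funD => //; exact: measurable_funeM.
    move=> t _; rewrite /= -EFinM -EFinD lee_fin.
    have -> : k / 2 + k^-1 / 2 * h t ^+ 2 = h t + (k - h t) ^+ 2 * k^-1 / 2.
      by field; rewrite gt_eqF.
    by rewrite lerDl divr_ge0// mulr_ge0 ?sqr_ge0// invr_ge0 ltW.
  have k20 : 0 <= k / 2 by rewrite divr_ge0// ltW.
  have k30 : 0 <= k^-1 / 2 by rewrite divr_ge0// invr_ge0 ltW.
  rewrite ge0_integralD//; last 2 first.
  - by move=> t _; rewrite -EFinM lee_fin mulr_ge0// sqr_ge0.
  - exact: measurable_funeM.
  rewrite integral_cst//= mu0l ge0_integralZl//; last first.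
    by move=> t _; rewrite lee_fin sqr_ge0.
  by rewrite hG -!EFinM -EFinD lee_fin; lra.
have Nfin : (\int[leb]_(t in `]0%R, l[) (h t)%:E)%E \is a fin_num.
  rewrite ge0_fin_numE; last by apply: integral_ge0 => t _; rewrite lee_fin.
  exact: (le_lt_trans (young 1 ltr01) (ltry _)).
exists (fine (\int[leb]_(t in `]0%R, l[) (h t)%:E)%E); first by rewrite fineK.
set N := fine _.
have N0 : 0 <= N by apply: fine_ge0; apply: integral_ge0 => t _;
  rewrite lee_fin.
have Gt0 : 0 <= Gt.
  by rewrite -lee_fin -hG; apply: integral_ge0 => t _; rewrite lee_fin sqr_ge0.
have [->|Nn0] := eqVneq N 0; first by rewrite expr0n mulr_ge0// ltW.
have Np : 0 < N by rewrite lt0r Nn0.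
have := young (N / l) (divr_gt0 Np l0); rewrite -[leLHS]fineK// -/N lee_fin.
rewrite divfK ?gt_eqF// invf_div => H.
have : N <= l / N * Gt by lra.
by rewrite mulrAC ler_pdivlMr// -expr2.
Qed.

Lemma young_sqr (eta x y N : R) : 0 < eta -> `|x - y| <= N ->
  x ^+ 2 <= (1 + eta) * y ^+ 2 + (1 + eta^-1) * N ^+ 2.
Proof.
move=> eta0 xyN; have e1 : 0 < eta^-1 by rewrite invr_gt0.
have h : (x - y) ^+ 2 <= N ^+ 2.
  rewrite -real_normK ?num_real// lerXn2r ?nnegrE//.
  exact: le_trans xyN.
apply: (@le_trans _ _ ((1 + eta) * y ^+ 2 + (1 + eta^-1) * (x - y) ^+ 2));
  last first.
  by rewrite lerD2l ler_wpM2l// ltW// addr_gt0.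
rewrite -subr_ge0.
have -> : (1 + eta) * y ^+ 2 + (1 + eta^-1) * (x - y) ^+ 2 - x ^+ 2 =
  eta^-1 * (eta * y - (x - y)) ^+ 2 by field; rewrite gt_eqF.
by rewrite mulr_ge0 ?sqr_ge0// ltW.
Qed.

(** Along a leaf, [W] is |v - c|^2, [G] is |g|^2, [B] the density, and [T] the set of parameters
    where values can be compared. Averaging over s in ]0, r[ bounds [W] on [T] by a constant, whose
    integral against [B] costs a factor [I]; the lower bound [b] then turns unweighted integrals
    into weighted ones. *)
Lemma leaf_inequality (l r b I L eta Gt : R) (W G B : R -> R) (T : set R) :
  0 < r -> r < l -> l <= L -> 0 < b -> 0 < eta -> 0 <= I ->
  measurable_fun `]0, l[%classic W -> measurable_fun `]0, l[%classic G ->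
  measurable_fun `]0, l[%classic B ->
  (forall t, 0 <= W t) -> (forall t, 0 <= G t) -> (forall t, b <= B t) ->
  (\int[leb]_(t in `]0%R, l[) (B t)%:E <= I%:E)%E ->
  (\int[leb]_(t in `]0%R, l[) (G t)%:E = Gt%:E)%E ->
  (\int[leb]_(t in `]0%R, l[) (W t)%:E < +oo)%E ->
  {ae leb, forall t, `]0, l[%classic t -> T t} ->
  (forall s t, 0 < s < l -> 0 < t < l -> T s -> T t ->
     W t <= (1 + eta) * W s + (1 + eta^-1) * (L * Gt)) ->
  (\int[leb]_(t in `]0%R, l[) (W t * B t)%:E <=
   \int[leb]_(t in `]0%R, l[)
     (((1 + I * (1 + eta) / (r * b)) * (\1_`]0, r[ t * W t) +
       (1 + eta^-1) * L * I / b * G t) * B t)%:E)%E.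
Proof.
move=> r0 rl lL b0 eta0 I0 mW mG mB W0 G0 bB BI GtE Woo aeT WT.
have l0 : 0 < l by exact: lt_trans rl.
have L0 : 0 < L by exact: lt_le_trans lL.
have B0 t : 0 <= B t by exact: le_trans (ltW b0) (bB t).
have Gt0 : 0 <= Gt by rewrite -lee_fin -GtE; apply: integral_ge0 => t _;
  rewrite lee_fin.
have sub_r : `]0, r[%classic `<=` `]0, l[%classic.
  by apply: subset_itvl; rewrite bnd_simp ltW.
have mWr : measurable_fun `]0, r[%classic W by exact: measurable_funS mW.
have mur : leb `]0, r[%classic = r%:E.
  by rewrite /= lebesgue_measure_itv/= lte_fin r0 oppr0 adde0.
have Afin : (\int[leb]_(t in `]0%R, r[) (W t)%:E)%E \is a fin_num.
  rewrite ge0_fin_numE; last by apply: integral_ge0 => t _; rewrite lee_fin.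
  apply: le_lt_trans Woo; apply: ge0_subset_integral => //.
    exact/measurable_EFinP.
  by move=> t _; rewrite lee_fin.
pose A := fine (\int[leb]_(t in `]0%R, r[) (W t)%:E)%E.
have AE : (\int[leb]_(t in `]0%R, r[) (W t)%:E)%E = A%:E by rewrite fineK.
have A0 : 0 <= A by apply: fine_ge0; apply: integral_ge0 => t _;
  rewrite lee_fin.
pose K := (1 + eta) * A / r + (1 + eta^-1) * (L * Gt).
have e1 : 0 < 1 + eta by rewrite addr_gt0.
have e2 : 0 < 1 + eta^-1 by rewrite addr_gt0// invr_gt0.
have K0 : 0 <= K.
  by rewrite addr_ge0// ?divr_ge0 ?mulr_ge0 ?(ltW e1) ?(ltW e2) ?(ltW r0)
    ?(ltW L0).
have WK t : 0 < t < l -> T t -> W t <= K.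
  move=> tl Tt.
  have : (\int[leb]_(s in `]0%R, r[) cst (W t)%:E s <=
     \int[leb]_(s in `]0%R, r[)
       ((1 + eta)%:E * (W s)%:E + cst ((1 + eta^-1) * (L * Gt))%:E s))%E.
    apply: ae_ge0_le_integral => //.
    - by move=> s _; rewrite lee_fin.
    - move=> s _; rewrite /= -EFinM -EFinD lee_fin.
      by rewrite addr_ge0 ?mulr_ge0 ?(ltW e1) ?(ltW e2) ?(ltW L0).
    - apply: emeasurable_funD => //; apply: measurable_funeM;
      exact/measurable_EFinP.
    apply: (ae_mono aeT) => s Ts sr; rewrite /= -EFinM -EFinD lee_fin.
    have sl := sub_r s sr.
    by apply: WT => //; exact: Ts.
  rewrite integral_cst//= mur ge0_integralD//; last 3 first.
  - by move=> s _; rewrite -EFinM lee_fin mulr_ge0// ltW.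
  - by apply: measurable_funeM; exact/measurable_EFinP.
  - by move=> s _; rewrite lee_fin !mulr_ge0// ?(ltW e2) ?(ltW L0).
  rewrite integral_cst//= mur ge0_integralZl//; last 3 first.
  - exact/measurable_EFinP.
  - by move=> s _; rewrite lee_fin.
  - by rewrite lee_fin ltW.
  rewrite AE -!EFinM -EFinD lee_fin => H.
  by rewrite -(ler_pM2r r0) /K mulrDl divfK ?gt_eqF.
set p := I * (1 + eta) / (r * b); set c2 := (1 + eta^-1) * L * I / b.
have p0 : 0 <= p by rewrite divr_ge0 ?mulr_ge0// ltW.
have c20 : 0 <= c2 by rewrite divr_ge0 ?mulr_ge0// ltW.
pose W1 t := \1_`]0, r[ t * W t.
have W10 t : 0 <= W1 t by rewrite mulr_ge0// indicE ler0n.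
have mW1 : measurable_fun `]0, l[%classic W1 by apply: measurable_funM.
have mW1B : measurable_fun `]0, l[%classic (fun t => (W1 t * B t)%:E).
  by apply/measurable_EFinP; exact: measurable_funM.
have mGB : measurable_fun `]0, l[%classic (fun t => (G t * B t)%:E).
  by apply/measurable_EFinP; exact: measurable_funM.
have mEB : measurable_fun `]0, l[%classic (fun t =>
  (B t)%:E) by exact/measurable_EFinP.
pose X := (\int[leb]_(t in `]0%R, l[) (W1 t * B t)%:E)%E.
pose Y := (\int[leb]_(t in `]0%R, l[) (G t * B t)%:E)%E.
have X0 : (0 <= X)%E by apply: integral_ge0 => t _; rewrite lee_fin mulr_ge0.
have Y0 : (0 <= Y)%E by apply: integral_ge0 => t _; rewrite lee_fin mulr_ge0.
have AX : ((b * A)%:E <= X)%E.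
  rewrite EFinM -AE -ge0_integralZl//; last 3 first.
  - exact/measurable_EFinP.
  - by move=> t _; rewrite lee_fin.
  - by rewrite lee_fin ltW.
  rewrite integral_mkcond /X [leRHS]integral_mkcond.
  apply: ae_le_integral_nomeas => [t _|t _|].
  - by apply: erestrict_ge0 => s _; rewrite -EFinM lee_fin mulr_ge0// ltW.
  - by apply: erestrict_ge0 => s _; rewrite lee_fin mulr_ge0.
  apply: aeW => t _; rewrite !patchE /W1 indicE.
  case: ifPn => tr; last first.
    by case: ifP => // _; rewrite lee_fin mulr_ge0// mulr_ge0.
  rewrite ifT; last by rewrite inE; apply: sub_r; rewrite inE in tr.
  by rewrite mul1r -EFinM lee_fin mulrC ler_wpM2l.
have GY : ((b * Gt)%:E <= Y)%E.
  rewrite EFinM -GtE -ge0_integralZl//; last 3 first.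
  - exact/measurable_EFinP.
  - by move=> t _; rewrite lee_fin.
  - by rewrite lee_fin ltW.
  apply: ge0_le_integral => //.
  - by move=> t _; rewrite -EFinM lee_fin mulr_ge0// ltW.
  - by apply: measurable_funeM; exact/measurable_EFinP.
  - by move=> t _; rewrite -EFinM lee_fin mulrC ler_wpM2l.
apply: (@le_trans _ _ (X + (p%:E * X + c2%:E * Y))%E); last first.
  rewrite [leRHS](_ : _ = \int[leb]_(t in `]0%R, l[)
     ((1 + p)%:E * (W1 t * B t)%:E + c2%:E * (G t * B t)%:E))%E; last first.
    by apply: eq_integral => t _; rewrite -!EFinM -EFinD; congr EFin;
      rewrite /W1; ring.
  rewrite ge0_integralD//; last 4 first.
  - move=> t _; rewrite -EFinM lee_fin; apply: mulr_ge0; first exact: addr_ge0.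
    exact: mulr_ge0.
  - exact: measurable_funeM.
  - by move=> t _; rewrite -EFinM lee_fin; apply: mulr_ge0 => //;
    exact: mulr_ge0.
  - exact: measurable_funeM.
  have WB0 t : `]0, l[%classic t -> (0 <= (W1 t * B t)%:E)%E.
    by move=> _; rewrite lee_fin mulr_ge0.
  have GB0 t : `]0, l[%classic t -> (0 <= (G t * B t)%:E)%E.
    by move=> _; rewrite lee_fin mulr_ge0.
  rewrite !ge0_integralZl ?lee_fin ?addr_ge0//.
  by rewrite -/X -/Y EFinD ge0_muleDl// mul1e addeA.
(* Almost everywhere W <= K; the nonnegative term [W1 t * B t] of the initial segment supplies the 1
   in 1 + p. *)
apply: (@le_trans _ _ (\int[leb]_(t in `]0%R, l[)
    ((W1 t * B t)%:E + K%:E * (B t)%:E))%E).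
  apply: ae_ge0_le_integral => //.
  - by move=> t _; rewrite lee_fin mulr_ge0.
  - by apply/measurable_EFinP; exact: measurable_funM.
  - by move=> t _; rewrite -EFinM -EFinD lee_fin addr_ge0 ?mulr_ge0.
  - by apply: emeasurable_funD => //; exact: measurable_funeM.
  apply: (ae_mono aeT) => t Tt tl; rewrite -EFinM -EFinD lee_fin.
  rewrite (le_trans (ler_wpM2r (B0 t) (WK t _ (Tt tl))))//.
  by rewrite lerDr mulr_ge0.
rewrite ge0_integralD//; last 3 first.
- by move=> t _; rewrite lee_fin mulr_ge0.
- by move=> t _; rewrite -EFinM lee_fin mulr_ge0.
- exact: measurable_funeM.
rewrite -/X leeD2l// ge0_integralZl//; last by move=> t _; rewrite lee_fin.
apply: (@le_trans _ _ (K%:E * I%:E)%E); first exact: lee_wpmul2l.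
(* The constants p and c2 are the coefficients of b A and b Gt in K I, so that [AX] and [GY]
   conclude. *)
have -> : (K%:E * I%:E = p%:E * (b * A)%:E + c2%:E * (b * Gt)%:E)%E.
  rewrite -!EFinM -EFinD; congr EFin; rewrite /K /p /c2.
  field; do ?[apply/andP; split]; rewrite gt_eqF//.
by apply: leeD; apply: lee_wpmul2l.
Qed.

End leaf_inequality.

(** * Integration over the leaves *)

Section foliated_estimates.
Context {R : realType} {n : nat}.
Variables (D : set 'rV[R]_n) (F : foliation R n).
Hypothesis oD : open D.
Hypothesis fD : foliates D F.
Local Notation mu := (@lebesgue_rV R n).
Local Notation nu := (@lebesgue_rV R n.-1).
Local Notation leb := (@lebesgue_measure R).

Lemma curve_in q t : base_set F q -> 0 < t -> t < len F q -> D (curve F q t).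
Proof.
have [[_ _ usp _ _] _] := fD => /usp[+ _ _ _] t0 tl; apply.
by rewrite in_itv/= t0.
Qed.

(** Arc length dominates the chord: take the partition of [a, b] with a single interval. *)
Lemma curve_lipschitz q : base_set F q ->
  forall a b, 0 < a -> a <= b -> b < len F q ->
  enorm (curve F q b - curve F q a) <= b - a.
Proof.
have [[_ _ usp _ _] _] := fD => /usp[_ + _ _] a b a0 ab bl.
move=> /(_ a b a0 ab bl) arcE.
have [->|anb] := eqVneq a b.
  rewrite !subrr /enorm big1 ?sqrtr0// => i _; by rewrite mxE expr0n.
rewrite -lee_fin -arcE; apply: ereal_sup_ubound; exists [:: b] => /=.
  by split => //=; rewrite lt_neqAle anb ab.
by rewrite big_nat1.
Qed.

Lemma density_ge0 x : D x -> 0 <= density F x.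
Proof. by have [[_ _ _ _ [_ _ [+ _] _]] _] := fD; exact. Qed.

Lemma path_integral_ge0 q (f : 'rV[R]_n -> \bar R) : base_set F q ->
  (forall x, D x -> 0 <= f x)%E -> (0 <= path_integral F q f)%E.
Proof.
move=> qF f0; apply: integral_ge0 => t /=; rewrite in_itv/= => /andP[t0 tl].
have Dt := curve_in qF t0 tl.
by apply: mule_ge0; [exact: f0|rewrite lee_fin density_ge0].
Qed.

(** Finiteness almost everywhere needs a measurable integrand on a measurable set: the path integral
    is replaced by a Borel version, clipped at 0, and the base set by the Borel set [A]. *)
Lemma path_integral_finite (f : 'rV[R]_n -> \bar R) : measurable_fun D f ->
  (forall x, D x -> 0 <= f x)%E -> (\int[mu]_(x in D) f x < +oo)%E ->
  {ae nu, forall q, base_set F q -> (path_integral F q f < +oo)%E}.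
Proof.
have [[_ [A mA nA] _ _ [_ _ _ cov]] _] := fD.
move=> mf f0 foo; have [[h mh hE] intE] := cov f mf f0.
pose h' q := maxe (h q) 0.
have mh' : measurable_fun setT h' by apply: measurable_maxe => //;
  exact: measurable_cst.
have h'0 q : (0 <= h' q)%E by rewrite le_max lexx orbT.
have hE' : {ae nu, forall q, base_set F q -> path_integral F q f = h' q}.
  apply: (ae_mono hE) => q + qF => /(_ qF) E.
  by rewrite /h' -E; apply/esym/max_l; exact: path_integral_ge0.
have : (\int[nu]_(q in A) h' q < +oo)%E.
  rewrite (@ae_eq_set_integral_nomeas _ _ _ nu A (base_set F))//.
    rewrite -(@ae_eq_integral_nomeas _ _ _ nu _ (fun q =>
      path_integral F q f))//.
      by rewrite -intE.
    by move=> q qF; exact: path_integral_ge0.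
  by rewrite setUC.
move=> h'oo.
have ih' : nu.-integrable A h'.
  apply/integrableP; split; first exact: measurable_funS mh'.
  by under eq_integral do rewrite gee0_abs//.
have aeA : {ae nu, forall q, base_set F q -> A q}.
  apply: negligibleS nA => q /= nq; left.
  by move/not_implyP : nq.
have aeh : {ae nu, forall q, A q -> (h' q < +oo)%E}.
  apply: (ae_mono (integrable_ae mA ih')) => q + Aq => /(_ Aq).
  by rewrite ge0_fin_numE.
apply: (ae_mono2 hE' (ae_mono2 aeA aeh (fun q h1 h2 Aq => h2 (h1 Aq)))) =>
  q E lt qF.
by rewrite E//; exact: lt.
Qed.

Lemma integral_le_path_integral (f1 f2 : 'rV[R]_n -> \bar R) :
  measurable_fun D f1 -> (forall x, D x -> 0 <= f1 x)%E ->
  measurable_fun D f2 -> (forall x, D x -> 0 <= f2 x)%E ->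
  {ae nu, forall q, base_set F q ->
    (path_integral F q f1 <= path_integral F q f2)%E} ->
  (\int[mu]_(x in D) f1 x <= \int[mu]_(x in D) f2 x)%E.
Proof.
have [[_ _ _ _ [_ _ _ cov]] _] := fD.
move=> m1 f10 m2 f20 f12; rewrite (cov f1 m1 f10).2 (cov f2 m2 f20).2.
apply: ae_le_integral_nomeas => [q qF|q qF|//]; exact: path_integral_ge0.
Qed.

(** The maximum of [b] and a Borel version of the density is Borel, at least [b] everywhere, and
    equal to the density off a null set, which meets almost every leaf in a null set. The
    exceptional leaves do not depend on [f]. *)
Lemma borel_density (b : R) : 0 <= b -> (b%:E <= beta_inf F D)%E ->
  exists2 B : 'rV[R]_n -> R, measurable_fun setT B /\ forall x, b <= B x &
  {ae nu, forall q, base_set F q ->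
    forall f : 'rV[R]_n -> \bar R, (forall x, D x -> 0 <= f x)%E ->
    path_integral F q f =
    (\int[leb]_(t in `]0%R, len F q[) (f (curve F q t) * (B (curve F q
      t))%:E))%E}.
Proof.
have [[_ _ _ _ [_ negl [_ [bt mbt btE]] _]] _] := fD.
move=> b0 /ess_infP bD.
pose B x := Num.max (bt x) b; exists B.
  split; first by apply: measurable_maxr => //; exact: measurable_cst.
  by move=> x; rewrite le_max lexx orbT.
have : {ae mu, forall x, D x -> density F x = B x}.
  apply: (ae_mono2 btE bD) => x E bx Dx; move: bx.
  rewrite /patch mem_set//= lee_fin /B -E// => bx.
  by rewrite max_l.
move=> /negl H; apply: (ae_mono H) => q + qF => /(_ qF) nq f f0.
apply: ae_eq_integral_nomeas.
- move=> t /=; rewrite in_itv/= => /andP[t0 tl]; have Dt := curve_in qF t0 tl.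
  by apply: mule_ge0; [exact: f0|rewrite lee_fin density_ge0].
- move=> t /=; rewrite in_itv/= => /andP[t0 tl]; have Dt := curve_in qF t0 tl.
  by apply: mule_ge0; [exact: f0|rewrite lee_fin /B le_max b0 orbT].
apply: negligibleS nq => t /= nE; split.
  by apply: contrapT => tl; apply: nE => /tl.
by move=> E; apply: nE => tl; rewrite E//; apply: curve_in => //;
  move: tl; rewrite in_itv/= => /andP[].
Qed.

(** A point determines its leaf, by disjointness, and its parameter, by injectivity; r < [inf_len F]
    places the competing parameter inside its leaf. *)
Lemma initial_partE r q t : (r%:E < inf_len F)%E -> base_set F q ->
  0 < t -> t < len F q -> initial_part F r (curve F q t) <-> t < r.
Proof.
have [[_ _ _ [disj _] [inj _ _ _]] _] := fD.
move=> rl qF t0 tl; split => [[q' [t' [q'F /andP[t'0 t'r] E]]]|tr]; last first.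
  by exists q, t; rewrite t0 tr.
have t'l : t' < len F q'.
  rewrite -lte_fin; apply: (lt_le_trans (y := r%:E)); first by rewrite lte_fin.
  by apply: (le_trans (ltW rl)); apply: ereal_inf_lbound; exists q'.
have [qq'|qq'] := pselect (q = q'); last first.
  have : (leaf F q `&` leaf F q') (curve F q t).
    by split; [exists t|exists t'] => //=; rewrite in_itv/= ?t0 ?t'0.
  by rewrite disj.
subst q'; suff -> : t = t' by [].
by apply: (inj q qF) => //; rewrite in_itv/= ?t0 ?t'0.
Qed.

Lemma initial_part_sub r : (r%:E < inf_len F)%E -> initial_part F r `<=` D.
Proof.
move=> rl x [q [t [qF /andP[t0 tr] ->]]]; apply: curve_in => //.
rewrite -lte_fin; apply: (lt_le_trans (y := r%:E)); first by rewrite lte_fin.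
by apply: (le_trans (ltW rl)); apply: ereal_inf_lbound; exists q.
Qed.

End foliated_estimates.

(** * From the leafwise inequality to the whole domain *)

Section foliated_inequality.
Context {R : realType} {n : nat}.
Variables (D : set 'rV[R]_n) (F : foliation R n).
Hypothesis oD : open D.
Hypothesis fD : foliates D F.
Local Notation mu := (@lebesgue_rV R n).
Local Notation nu := (@lebesgue_rV R n.-1).
Local Notation leb := (@lebesgue_measure R).
Variables (r b I c eta : R).
Hypothesis r_gt0 : 0 < r.
Hypothesis r_lt : (r%:E < inf_len F)%E.
Hypothesis b_gt0 : 0 < b.
Hypothesis b_le : (b%:E <= beta_inf F D)%E.
Hypothesis I_ge0 : 0 <= I.
Hypothesis I_le : (I_beta F D <= I%:E)%E.
Hypothesis eta_gt0 : 0 < eta.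
Hypothesis L_ge0 : 0 <= len_bound F.

Let c1 := 1 + I * (1 + eta) / (r * b).
Let c2 := (1 + eta^-1) * len_bound F * I / b.

Section on_leaf.
Variables (v : 'rV[R]_n -> R) (g : 'I_n -> 'rV[R]_n -> R).
Variables (vk : nat -> 'rV[R]_n -> R) (gk : nat -> 'I_n -> 'rV[R]_n -> R).
Hypothesis mv : measurable_fun setT v.
Hypothesis mg : forall i, measurable_fun setT (g i).
Hypothesis mvk : forall k, measurable_fun setT (vk k).
Hypothesis mgk : forall k i, measurable_fun setT (gk k i).
Hypothesis approx : forall k, inner_taylor D k.+1%:R^-1 (vk k) (gk k).

Let err := total_error v g vk gk.
Let W x := (v x - c) ^+ 2.
Let G x := enorm (\row_i g i x) ^+ 2.
Let E := initial_part F r.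

Let mrow (T : set R) (gam : R -> 'rV[R]_n) :
  (forall f : 'rV[R]_n -> R, measurable_fun setT f ->
    measurable_fun T (fun t => f (gam t))) ->
  measurable_fun T (fun t => enorm (\row_i g i (gam t))).
Proof.
move=> H; apply: (measurable_enorm (f := fun t => \row_i g i (gam t))) => i.
have -> : (fun t => (\row_i g i (gam t)) ord0 i) = (fun t => g i (gam t)).
  by apply/funext => t; rewrite mxE.
exact: H.
Qed.

(** Since B >= b > 0, finiteness of the weighted integral of err + W + G yields unweighted
    integrability of each term. This feeds [curve_limit] (through err), Cauchy-Schwarz (through G)
    and [leaf_inequality]. *)
Lemma leaf_step q (B : 'rV[R]_n -> R) : base_set F q ->
  measurable_fun setT B -> (forall x, b <= B x) ->
  (forall f : 'rV[R]_n -> \bar R, (forall x, D x -> 0 <= f x)%E ->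
    path_integral F q f =
    (\int[leb]_(t in `]0%R, len F q[) (f (curve F q t) * (B (curve F q
      t))%:E))%E) ->
  (path_integral F q (fun x => err x + (W x + G x)%:E) < +oo)%E ->
  (path_integral F q (fun x => (W x)%:E) <=
   path_integral F q (fun x => (c1 * (\1_E x * W x) + c2 * G x)%:E))%E.
Proof.
move=> qF mB bB piE foo.
set gam := curve F q in piE *; set l := len F q in piE *.
have lip := curve_lipschitz fD qF.
have inD := @curve_in _ _ _ _ fD q _ qF.
have rl : r < l.
  rewrite -lte_fin; apply: (lt_le_trans r_lt).
  by apply: ereal_inf_lbound; exists q.
have l0 : 0 < l by exact: lt_trans rl.
have lL : l <= len_bound F.
  have [_ [_ h _ _]] := fD; rewrite -lee_fin; apply: le_trans (ltW h).
  by apply: ereal_sup_ubound; exists q.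
have B0 x : 0 <= B x by exact: le_trans (ltW b_gt0) (bB x).
have W0 x : 0 <= W x by exact: sqr_ge0.
have G0 x : 0 <= G x by exact: sqr_ge0.
have err0 x : (0 <= err x)%E.
  by apply: nneseries_ge0 => k _ _; rewrite lee_fin approx_error_ge0.
have mcE (f : 'rV[R]_n -> \bar R) : measurable_fun setT f ->
    measurable_fun `]0, l[%classic (fun t => f (gam t)).
  exact: measurable_curve.
have mc (f : 'rV[R]_n -> R) : measurable_fun setT f ->
    measurable_fun `]0, l[%classic (fun t => f (gam t)).
  exact: measurable_curveR.
have merr : measurable_fun setT err by exact: measurable_total_error.
have mWc : measurable_fun `]0, l[%classic (fun t => W (gam t)).
  apply: (mc W); apply: measurable_funX; apply: measurable_funB => //.
have mGc : measurable_fun `]0, l[%classic (fun t => G (gam t)).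
  by apply: measurable_funX; exact: (mrow mc).
have mBc := mc _ mB.
have fE : (\int[leb]_(t in `]0%R,
  l[) (err (gam t) + (W (gam t) + G (gam t))%:E) < +oo)%E.
  rewrite -(@lte_pmul2l _ b%:E)// ?lte_fin// [ltRHS]gt0_muley ?lte_fin//.
  apply: le_lt_trans foo; rewrite piE; last first.
    by move=> x _; rewrite adde_ge0// lee_fin addr_ge0.
  rewrite -ge0_integralZl//; last 3 first.
  - apply: emeasurable_funD; first exact: mcE.
    by apply/measurable_EFinP; exact: measurable_funD.
  - by move=> t _; rewrite adde_ge0// lee_fin addr_ge0.
  - by rewrite lee_fin ltW.
  apply: ae_le_integral_nomeas => [t _|t _|].
  - by rewrite mule_ge0 ?lee_fin ?(ltW b_gt0)// adde_ge0// lee_fin addr_ge0.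
  - by rewrite mule_ge0 ?lee_fin ?B0// adde_ge0// lee_fin addr_ge0.
  apply: aeW => t _; rewrite muleC; apply: lee_wpmul2l; last by rewrite lee_fin.
  by rewrite adde_ge0// lee_fin addr_ge0.
have sub_fin (h : R -> \bar R) : (forall t, 0 <= h t)%E ->
    (forall t, h t <= err (gam t) + (W (gam t) + G (gam t))%:E)%E ->
    (\int[leb]_(t in `]0%R, l[) h t < +oo)%E.
  move=> h0 hle; apply: le_lt_trans fE;
    apply: ae_le_integral_nomeas => // [t _|].
    by rewrite adde_ge0// lee_fin addr_ge0.
  by apply: aeW => t _.
have erroo : (\int[leb]_(t in `]0%R, l[) err (gam t) < +oo)%E.
  by apply: sub_fin => // t; rewrite leeDl// lee_fin addr_ge0.
have Woo : (\int[leb]_(t in `]0%R, l[) (W (gam t))%:E < +oo)%E.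
  apply: sub_fin => t; first by rewrite lee_fin.
  by rewrite EFinD addeCA leeDl// adde_ge0// lee_fin.
have Goo : (\int[leb]_(t in `]0%R, l[) (G (gam t))%:E < +oo)%E.
  apply: sub_fin => t; first by rewrite lee_fin.
  by rewrite EFinD addeA leeDr// adde_ge0// lee_fin.
pose Gt := fine (\int[leb]_(t in `]0%R, l[) (G (gam t))%:E)%E.
have GtE : (\int[leb]_(t in `]0%R, l[) (G (gam t))%:E)%E = Gt%:E.
  rewrite fineK// ge0_fin_numE//; apply: integral_ge0 => t _.
  by rewrite lee_fin.
(* N is the integral of |g| along the whole leaf, so it bounds every increment of v between points
   of [T] below. *)
have [N NE N2] := @integral_cauchy_schwarz _ l Gt (fun t =>
  enorm (\row_i g i (gam t)))
  l0 (mrow mc) (fun t => enorm_ge0 _) GtE.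
pose T := [set t | (err (gam t) < +oo)%E].
have aeT : {ae leb, forall t, `]0, l[%classic t -> T t}.
  have ierr : leb.-integrable `]0, l[ (fun t => err (gam t)).
    apply/integrableP; split; first exact: mcE.
    by under eq_integral do rewrite gee0_abs//.
  apply: (ae_mono (integrable_ae _ ierr)) => // t + tl => /(_ tl).
  by rewrite ge0_fin_numE.
have vN s t : 0 < s -> s <= t -> t < l -> T s -> T t ->
  `|v (gam t) - v (gam s)| <= N.
  move=> s0 st tl Ts Tt; rewrite -lee_fin -NE.
  apply: (le_trans (curve_limit oD lip inD mv mg mvk mgk approx s0 st tl Ts Tt
    erroo)).
  apply: ge0_subset_integral => //.
  - by apply/measurable_EFinP; exact: (mrow mc).
  - by move=> a _; rewrite lee_fin enorm_ge0.
  - move=> a /=; rewrite !in_itv/= => /andP[sa at_].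
    by rewrite (lt_trans s0 sa) (le_lt_trans at_ tl).
have WT s t : 0 < s < l -> 0 < t < l -> T s -> T t ->
    W (gam t) <= (1 + eta) * W (gam s) + (1 + eta^-1) * (len_bound F * Gt).
  move=> /andP[s0 sl] /andP[t0 tl] Ts Tt.
  have vts : `|(v (gam t) - c) - (v (gam s) - c)| <= N.
    rewrite opprB addrA subrK; have [st|/ltW ts] := leP s t; first exact: vN.
    by rewrite distrC; exact: vN.
  apply: (le_trans (young_sqr eta_gt0 vts)); rewrite lerD2l ler_wpM2l//.
    by rewrite addr_ge0// invr_ge0 ltW.
  apply: (le_trans N2); rewrite ler_wpM2r//.
  by rewrite -lee_fin -GtE; apply: integral_ge0 => a _; rewrite lee_fin.
have BI : (\int[leb]_(t in `]0%R, l[) (B (gam t))%:E <= I%:E)%E.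
  apply: le_trans I_le; rewrite [leLHS](_ : _ =
    path_integral F q (EFin \o \1_D)).
    by apply: ereal_sup_ubound; exists q.
  rewrite piE; last by move=> x _; rewrite lee_fin.
  apply: eq_integral => t; rewrite inE/= in_itv/= => /andP[t0 tl].
  by rewrite indicE mem_set ?mul1e//; exact: inD.
have := @leaf_inequality R l r b I (len_bound F) eta Gt (fun t => W (gam t))
  (fun t => G (gam t)) (fun t => B (gam t)) T r_gt0 rl lL b_gt0 eta_gt0 I_ge0
  mWc mGc mBc (fun t => W0 _) (fun t => G0 _) (fun t => bB _) BI GtE Woo aeT WT.
rewrite !piE//; last 2 first.
- move=> x _; rewrite lee_fin addr_ge0// mulr_ge0//.
  + by rewrite /c1 addr_ge0// divr_ge0// ?mulr_ge0// ?addr_ge0// ltW.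
  + by rewrite mulr_ge0.
  + by rewrite /c2 divr_ge0 ?(ltW b_gt0)// !mulr_ge0// addr_ge0// invr_ge0 ltW.
- by move=> x _; rewrite lee_fin.
move=> H; apply: (le_trans H); rewrite le_eqVlt; apply/orP; left; apply/eqP.
apply: eq_integral => t; rewrite inE/= in_itv/= => /andP[t0 tl].
rewrite -EFinM; congr EFin; congr (_ * _); congr (_ * (_ * _) + _).
have tE := initial_partE fD r_lt qF t0 tl.
rewrite !indicE; congr ((nat_of_bool _)%:R); apply/idP/idP;
  rewrite !inE/= in_itv/= t0/=.
  by move=> tr; apply/tE.
by move/tE.
Qed.

End on_leaf.

(** The integral over [D] of err + |v - c|^2 + |g|^2 is finite, so almost every leaf satisfies the
    hypothesis of [leaf_step]. On [D] the zero extensions agree with [v] and [g]. *)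
Lemma foliated_inequality (v : 'rV[R]_n -> R) (g : 'rV[R]_n -> 'rV[R]_n) :
  (mu D < +oo)%E -> H1 D v g -> measurable (initial_part F r) ->
  (\int[mu]_(x in D) ((v x - c) ^+ 2)%:E <=
   \int[mu]_(x in D) (c1 * (\1_(initial_part F r) x * (v x - c) ^+ 2) +
      c2 * enorm (g x) ^+ 2)%:E)%E.
Proof.
move=> Doo Hv mE; have [Lv Lg _] := Hv; have [mv _] := Lv;
  have mD := open_measurable_rV oD.
have [vk [gk [[mvk mgk] hv hg approx]]] := sobolev_approx oD Doo Hv.
pose v0 := v \_ D; pose g0 i := (fun y => g y ord0 i) \_ D.
have mv0 : measurable_fun setT v0 by apply/(measurable_restrictT _ _).1.
have mg0 i : measurable_fun setT (g0 i).
  by apply/(measurable_restrictT _ _).1 => //; have [] := Lg i.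
pose err := total_error v0 g0 vk gk.
pose W x := (v0 x - c) ^+ 2.
pose G x := enorm (\row_i g0 i x) ^+ 2.
have W0 x : 0 <= W x by exact: sqr_ge0.
have G0 x : 0 <= G x by exact: sqr_ge0.
have mW : measurable_fun setT W.
  by apply: measurable_funX; apply: measurable_funB.
have mG : measurable_fun setT G.
  apply: measurable_funX; apply: (measurable_enorm (f := fun t =>
    \row_i g0 i t)) => i.
  have -> : (fun t => (\row_i g0 i t) ord0 i) = g0 i.
    by apply/funext => t; rewrite mxE.
  exact: mg0.
have err0 x : (0 <= err x)%E.
  by apply: nneseries_ge0 => k _ _; rewrite lee_fin approx_error_ge0.
have merr : measurable_fun setT err by exact: measurable_total_error.
have c10 : 0 <= c1.
  by rewrite /c1 addr_ge0// divr_ge0// ?mulr_ge0// ?addr_ge0// ltW.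
have vE x : D x -> v0 x = v x by move=> Dx; rewrite /v0 patchE mem_set.
have gE x : D x -> \row_i g0 i x = g x.
  by move=> Dx; apply/rowP => i; rewrite mxE /g0 patchE mem_set.
rewrite [leLHS](_ : _ = \int[mu]_(x in D) (W x)%:E)%E; last first.
  by apply: eq_integral => x /set_mem Dx; rewrite /W vE.
rewrite [leRHS](_ : _ = \int[mu]_(x in D)
    (c1 * (\1_(initial_part F r) x * W x) + c2 * G x)%:E)%E; last first.
  by apply: eq_integral => x /set_mem Dx; rewrite /W /G vE// gE.
have c20 : 0 <= c2.
  by rewrite /c2 divr_ge0 ?(ltW b_gt0)// !mulr_ge0// addr_ge0// invr_ge0 ltW.
have f0 x : (0 <= err x + (W x + G x)%:E)%E
  by rewrite adde_ge0// lee_fin addr_ge0.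
have mf : measurable_fun setT (fun x => err x + (W x + G x)%:E)%E.
  by apply: emeasurable_funD => //; apply/measurable_EFinP;
    exact: measurable_funD.
have erroo : (\int[mu]_(x in D) err x < +oo)%E.
  have mae k : measurable_fun setT (EFin \o approx_error v0 g0 vk gk k).
    by apply/measurable_EFinP; exact: measurable_approx_error.
  apply: (@le_lt_trans _ _ (\int[mu]_x err x)%E).
    exact: ge0_subset_integral.
  rewrite integral_nneseries//; last first.
    by move=> k x _; rewrite lee_fin approx_error_ge0.
  (* One value and n gradient components contribute (n + 1) 2^-k, written as 2 (n + 1) / 2^(k+1) to
     fit [epsilon_trick0]. *)
  apply: (@le_lt_trans _ _ (\sum_(k <oo) ((n.+1.*2)%:R / (2 ^
    k.+1)%:R)%:E)%E); last first.
    by apply: le_lt_trans (@epsilon_trick0 R (n.+1.*2)%:R xpredT _) (ltry _).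
  apply: lee_nneseries => [k _ _|k _].
    by apply: integral_ge0 => x _; rewrite lee_fin approx_error_ge0.
  under eq_integral do rewrite EFinD -sumEFin.
  have m1 : measurable_fun setT (fun x => `|vk k x - v0 x|%:E).
    by apply/measurable_EFinP; apply: measurableT_comp => //;
      exact: measurable_funB.
  have m2 i : measurable_fun setT (fun x => `|gk k i x - g0 i x|%:E).
    by apply/measurable_EFinP; apply: measurableT_comp => //;
      exact: measurable_funB.
  rewrite ge0_integralD//; last 2 first.
  - by move=> x _; apply: sume_ge0.
  - by apply: emeasurable_sum.
  rewrite ge0_integral_sum//.
  apply: (@le_trans _ _ ((2^-1 ^+ k)%:E + \sum_(i < n) (2^-1 ^+ k)%:E)%E).
    by apply: leeD; [exact: hv|apply: lee_sum => i _; exact: hg].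
  rewrite sumEFin -EFinD lee_fin sumr_const card_ord -mulrS.
  have -> : (n.+1.*2)%:R / (2 ^ k.+1)%:R = n.+1%:R * 2^-1 ^+ k :> R.
    rewrite natrX exprS -muln2 natrM exprVn;
      have : (2 : R) ^+ k != 0 by rewrite expf_neq0.
    by move: (2 ^+ k) (n.+1%:R) => p N p0; field.
  by rewrite mulr_natl.
have Woo : (\int[mu]_(x in D) (W x)%:E < +oo)%E.
  have [_] := L2_subr c mD Doo Lv.
  rewrite [X in (X < _)%E -> _](_ : _ = \int[mu]_(x in D) (W x)%:E)%E//.
  by apply: eq_integral => x /set_mem Dx; rewrite /W vE.
have Goo : (\int[mu]_(x in D) (G x)%:E < +oo)%E.
  have [_] := L2_enorm mD Lg.
  rewrite [X in (X < _)%E -> _](_ : _ = \int[mu]_(x in D) (G x)%:E)%E//.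
  by apply: eq_integral => x /set_mem Dx; rewrite /G gE.
have foo : (\int[mu]_(x in D) (err x + (W x + G x)%:E) < +oo)%E.
  under eq_integral do rewrite EFinD.
  have mWD : measurable_fun D (fun x => (W x)%:E).
    by apply/measurable_EFinP; exact: measurable_funTS.
  have mGD : measurable_fun D (fun x => (G x)%:E).
    by apply/measurable_EFinP; exact: measurable_funTS.
  rewrite ge0_integralD//; last 3 first.
  - exact: measurable_funTS.
  - by move=> x _; rewrite adde_ge0// lee_fin.
  - exact: emeasurable_funD.
  rewrite ge0_integralD//; last 2 first.
  - by move=> x _; rewrite lee_fin.
  - by move=> x _; rewrite lee_fin.
  by rewrite lte_add_pinfty// lte_add_pinfty.
have [B [mB bB] piE] := borel_density fD (ltW b_gt0) b_le.
have fin := path_integral_finite fD (measurable_funTS mf) (fun x _ => f0 x) foo.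
apply: (integral_le_path_integral fD).
- by apply/measurable_EFinP; exact: measurable_funTS.
- by move=> x _; rewrite lee_fin.
- apply/measurable_EFinP; apply: measurable_funTS; apply: measurable_funD.
    apply: measurable_funM => //; apply: measurable_funM => //.
  exact: measurable_funM.
- move=> x Dx; rewrite lee_fin; apply: addr_ge0; last exact: mulr_ge0.
  by apply: mulr_ge0 => //; exact: mulr_ge0.
apply: (ae_mono2 fin piE) => q h1 h2 qF.
exact: (leaf_step mv0 mg0 mvk mgk approx qF mB bB (h2 qF) (h1 qF)).
Qed.

End foliated_inequality.

(** * Restriction and shift of Sobolev functions *)

(** Monotonicity in the index makes the largest of finitely many local thresholds valid
    everywhere. *)
Lemma compact_uniform_nat (X : topologicalType) (K : set X) (P : nat -> X ->
  Prop) :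
  compact K -> (forall k l x, (k <= l)%N -> P k x -> P l x) ->
  (forall x, K x -> exists k, \forall y \near x, P k y) ->
  exists k, forall x, K x -> P k x.
Proof.
move=> /compact_near_coveringP/(_ nat \oo P) cK Pmono Ploc.
case: cK => [x Kx|N _ HN]; last by exists N; exact: (HN N (leqnn N)).
have [k Pk] := Ploc x Kx.
exists ([set y | P k y], [set l | (k <= l)%N]); first by split => //; exists k.
by move=> [y l] [/= Py kl]; exact: Pmono Py.
Qed.

Section test_functions.
Context {R : realType} {n : nat}.
Local Notation mu := (@lebesgue_rV R n).
Implicit Types (D : set 'rV[R]_n) (phi : 'rV[R]_n -> R).

Lemma compact_sub_cube (K : set 'rV[R]_n) : compact K ->
  exists N : nat, K `<=` cube 0 N%:R.
Proof.
move=> cK; apply: (compact_uniform_nat (P := fun k x => cube 0 k%:R x) cK).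
  by move=> k l x kl h i; apply: (lt_le_trans (h i)); rewrite ler_nat.
move=> x _; pose m := \max_(i < n) (Num.truncn `|x ord0 i|).+1.
exists m.+1; apply: filterS (nbhs_cube x ltr01) => y xy i.
have xm : `|x ord0 i| <= m%:R.
  by rewrite ltW// (lt_le_trans (truncnS_gt _))// ler_nat;
    exact: (leq_bigmax i).
rewrite mxE subr0 -(subrK (x ord0 i) (y ord0 i)) (le_lt_trans (ler_normD _
  _))//.
by rewrite -natr1 [ltRHS]addrC ltr_leD//; exact: xy.
Qed.

Lemma compact_support_bounded (K : set 'rV[R]_n) (f : 'rV[R]_n -> R) :
  compact K -> continuous f -> (forall x, ~ K x -> f x = 0) -> bounded_borel f.
Proof.
move=> cK cf f0; split; first exact: continuous_measurable_rV.
have [k hk] : exists k : nat, forall x, K x -> `|f x| <= k%:R.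
  apply: (compact_uniform_nat (P := fun k x => `|f x| <= k%:R) cK).
    by move=> k l x kl /le_trans; apply; rewrite ler_nat.
  move=> x _; exists (Num.truncn `|f x|).+1.
  have := @cvgr_norm_le _ _ _ (nbhs x) (nbhs_filter x) f (f x) (cf x)
    (Num.truncn `|f x|).+1%:R (truncnS_gt _).
  exact.
exists k%:R => // x; have [Kx|Kx] := pselect (K x); first exact: hk.
by rewrite f0// normr0.
Qed.

Lemma smooth_partial phi i : smooth phi -> continuous (partial i phi).
Proof. by move=> sphi x; have [] := sphi [:: i] x. Qed.

Lemma partial_supp (K : set 'rV[R]_n) phi i x : compact K ->
  (forall y, ~ K y -> phi y = 0) -> ~ K x -> partial i phi x = 0.
Proof.
move=> cK phi0 Kx.
have oK : open (~` K) by apply: closed_openC; exact: compact_closed.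
have : is_derive x (delta_mx ord0 i : 'rV[R]_n) phi 0.
  apply: (@near_eq_is_derive _ _ _ (cst 0)).
    by apply: filterS (open_nbhs_nbhs (conj oK Kx)) => y Ky /=; rewrite phi0.
by move=> /@derive_val.
Qed.

Lemma test_function_facts D phi i : test_function D phi ->
  exists N : nat, [/\ bounded_borel phi, bounded_borel (partial i phi),
    forall x, ~ D x -> phi x = 0, forall x, ~ D x -> partial i phi x = 0 &
    forall x, ~ cube 0 N%:R x -> phi x = 0 /\ partial i phi x = 0].
Proof.
move=> [sphi [K [cK KD phi0]]]; have [N KN] := compact_sub_cube cK.
have p0 := fun x => @partial_supp K phi i x cK phi0.
exists N; split.
- by apply: (compact_support_bounded cK) => // x; have [] := sphi [::] x.
- by apply: (compact_support_bounded cK) => //; exact: smooth_partial.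
- by move=> x Dx; apply: phi0 => /KD.
- by move=> x Dx; apply: p0 => /KD.
- by move=> x Nx; split; [apply: phi0|apply: p0] => /KN.
Qed.

Lemma is_derive_line phi i (x : 'rV[R]_n) (t : R) : smooth phi ->
  is_derive t (1 : R) (fun s => phi (x + s *: delta_mx ord0 i))
    (partial i phi (x + t *: delta_mx ord0 i)).
Proof.
move=> sphi; have [_ /(_ i) d] := sphi [::] (x + t *: delta_mx ord0 i).
have E : (fun h : R => h^-1 *: (((fun s =>
  phi (x + s *: delta_mx ord0 i)) \o shift t) (h *: (1 : R)) -
      phi (x + t *: delta_mx ord0 i))) =
   (fun h : R => h^-1 *: ((phi \o shift (x + t *: delta_mx ord0 i)) (h *:
     delta_mx ord0 i) -
      phi (x + t *: delta_mx ord0 i))).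
  apply/funext => h; congr (_ *: (phi _ - _)) => /=.
  by rewrite [h *: 1]mulr1 scalerDl addrCA.
split; first by rewrite /derivable E.
by rewrite /partial /derive E.
Qed.

(** Difference quotients have zero integral by translation invariance, and dominated convergence
    passes to the limit. This says that constants have weak gradient zero. *)
Lemma integral_partial D phi i : test_function D phi ->
  \int[mu]_x partial i phi x = 0.
Proof.
move=> tphi; have [sphi _] := tphi.
have [N [bphi [mdphi [M M0 hM]] _ _ supp]] := test_function_facts i tphi.
pose e : 'rV[R]_n := delta_mx ord0 i.
pose h k : R := k.+1%:R^-1.
have h0 k : 0 < h k by rewrite invr_gt0 ltr0n.
have h1 k : h k <= 1 by rewrite invf_le1 ?ltr0n// ler1n.
pose f k x := (h k)^-1 * (phi (x + h k *: e) - phi x).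
have iphi : mu.-integrable setT (EFin \o phi).
  by apply: (bounded_borel_cube_integrable bphi (e := N%:R)) => x /supp[].
have [mphi _] := bphi.
have iphih k : mu.-integrable setT (EFin \o (fun x => phi (x + h k *: e))).
  apply/integrableP; split.
    apply/measurable_EFinP; apply: (measurableT_comp mphi).
    exact: measurable_translate.
  rewrite (ge0_integral_translate (h k *: e) (f := fun x => `|(phi x)%:E|%E))//.
    by have /integrableP[] := iphi.
  by apply: measurableT_comp => //; exact/measurable_EFinP.
have if0 k : (\int[mu]_x (f k x)%:E = 0)%E.
  under eq_integral do rewrite /f EFinM.
  rewrite integralZl//; last exact: (integrableB _ (iphih k) iphi).
  under eq_integral do rewrite EFinB.
  rewrite (integralB _ (iphih k) iphi)//.
  rewrite (integral_translate (h k *: e) (f := EFin \o phi)); last first.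
    exact/measurable_EFinP.
  by rewrite subee ?mule0//; exact: integrable_fin_num.
have fE k x : exists2 c, `|c| <= h k & f k x = partial i phi (x + c *: e).
  have [c ch E] := mean_value 0 (h k) (fun t => is_derive_line i x t sphi).
  exists c; first by rewrite subr0 (gtr0_norm (h0 k)) in ch.
  by rewrite add0r scale0r addr0 in E; rewrite /f E mulKf// gt_eqF.
(* The radius is N + 1 because a step of length at most 1 can reach the support, contained in the
   cube of radius N. *)
have fM k x : `|f k x| <= M * \1_(cube 0 N.+1%:R) x.
  rewrite indicE; have [xN|xN] := pselect (cube 0 N.+1%:R x).
    by rewrite mem_set// mulr1; have [c _ ->] := fE k x.
  rewrite memNset// mulr0 /f.
  have /existsNP[j /negP] := xN; rewrite -leNgt mxE subr0 => xj.
  have [-> _] : phi x = 0 /\ partial i phi x = 0.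
    apply: supp => /(_ j); rewrite mxE subr0; apply/negP; rewrite -leNgt.
    by apply: le_trans xj; rewrite ler_nat.
  have [-> _] : phi (x + h k *: e) = 0 /\ partial i phi (x + h k *: e) = 0.
    apply: supp => /(_ j); rewrite !mxE subr0; apply/negP; rewrite -leNgt.
    rewrite -natr1 in xj.
    have := ler_normB (x ord0 j + h k * ((0%R == 0 :> 'I_1) && (j == i))%:R)
      (h k * ((0%R == 0 :> 'I_1) && (j == i))%:R).
    rewrite addrK => xle.
    have : `|h k * ((0%R == 0 :> 'I_1) && (j == i))%:R| <= 1.
      rewrite normrM (gtr0_norm (h0 k)) mulr_ile1//; first exact: ltW.
      by case: (_ && _); rewrite ?normr1 ?normr0.
    lra.
  by rewrite subrr mulr0 normr0.
have cvgf x : (f k x)%:E @[k --> \oo] --> (partial i phi x)%:E.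
  apply/fine_cvgP; split; first exact: nearW.
  apply/cvgrPdist_le => eps eps0.
  have cx := @smooth_partial phi i sphi x.
  move/(@cvgrPdist_le _ _ _ _ (nbhs_filter x))/(_ _ eps0) : cx.
  move=> /nbhs_ballP[d d0 hd].
  have [K _ HK] := near_infty_natSinv_lt (PosNum d0).
  exists K => // k /= Kk; have [c ck ->] := fE k x; apply: hd; split => // a j.
  rewrite /ball/= (ord1 a) !mxE opprD addrA subrr add0r normrN.
  rewrite (le_lt_trans _ (HK k Kk))// normrM -[leRHS]mulr1 ler_pM//.
  by case: (_ && _); rewrite ?normr1 ?normr0.
have mf k : measurable_fun setT (fun x => (f k x)%:E).
  apply/measurable_EFinP; apply: measurable_funM => //;
    apply: measurable_funB => //.
  apply: (measurableT_comp mphi); exact: measurable_translate.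
have mC := @measurable_cube R n 0 N.+1%:R.
have iC : mu.-integrable setT (fun x => (M * \1_(cube 0 N.+1%:R) x)%:E).
  apply: (@bounded_borel_cube_integrable _ _ (fun x =>
    M * \1_(cube 0 N.+1%:R) x) N.+1%:R).
    split; first by apply: measurable_funM => //; exact: measurable_indic.
    exists M => // z; rewrite normrM (ger0_norm M0) ler_piMr// indicE.
    by case: (_ \in _); rewrite ?normr1 ?normr0.
  by move=> z zN; rewrite indicE memNset ?mulr0.
have := @dominated_cvg _ _ _ mu setT measurableT (fun k x => (f k x)%:E)
  (fun x => (partial i phi x)%:E) (fun x => (M * \1_(cube 0 N.+1%:R) x)%:E)
  mf (fun x _ => cvgf x) (fun x _ => isT) iC (fun k x _ => fM k x).
under eq_fun do rewrite if0.
move=> /cvg_lim; rewrite lim_cst// => H.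
by rewrite /Rintegral -H.
Qed.

(** A test function on [E] is one on [D] and vanishes off [E], so the identity on [D] restricts; the
    constant drops out by [integral_partial]. *)
Lemma weak_gradient_shift (D E : set 'rV[R]_n) (v : 'rV[R]_n -> R)
    (g : 'rV[R]_n -> 'rV[R]_n) (c : R) :
  open D -> open E -> E `<=` D -> (mu D < +oo)%E -> H1 D v g ->
  weak_gradient E (fun x => v x - c) g.
Proof.
move=> oD oE ED Doo [Lv Lg wg] phi i tE.
have mD := open_measurable_rV oD.
have tD : test_function D phi.
  case: tE => sphi [K [cK KE phi0]]; split => //; exists K; split => //.
  exact: subset_trans ED.
have [N [bphi bdphi phiE dphiE supp]] := test_function_facts i tE.
pose v0 := v \_ D.
have iv0 : mu.-integrable setT (EFin \o v0).
  by rewrite -restrict_EFin -integrable_mkcond//; exact: L2_integrable.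
have i1 := integrable_mul_bounded iv0 bdphi.
have idphi : mu.-integrable setT (EFin \o partial i phi).
  by apply: (bounded_borel_cube_integrable bdphi (e := N%:R)) => x /supp[].
have i2 := integrableZl measurableT c idphi.
have int0 : (\int[mu]_x (EFin \o partial i phi) x = 0)%E.
  have := integral_partial i tE; rewrite /Rintegral => H.
  by rewrite -[LHS]fineK; [rewrite H|exact: integrable_fin_num].
transitivity (\int[mu]_x ((v0 x * partial i phi x)%:E - c%:E * (EFin \o
  partial i phi) x))%E.
  rewrite integral_mkcond; apply: eq_integral => x _; rewrite patchE.
  case: ifPn => [/set_mem Ex|/negP Ex].
    by rewrite /v0 patchE mem_set//=; [rewrite -EFinB mulrBl|exact: ED].
  by rewrite /= dphiE ?mulr0 ?mule0 ?sube0//; apply: contra_not Ex => /mem_set.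
rewrite (integralB measurableT i1 i2) integralZl// int0 mule0 sube0.
transitivity (\int[mu]_(x in D) (v x * partial i phi x)%:E)%E.
  rewrite [RHS]integral_mkcond; apply: eq_integral => x _.
  by rewrite /v0 !patchE; case: ifP => _; rewrite ?mul0r.
rewrite wg//; congr (- _)%E; rewrite integral_mkcond [RHS]integral_mkcond.
apply: eq_integral => x _; rewrite !patchE.
have [Ex|Ex] := pselect (E x); first by rewrite !mem_set//; exact: ED.
rewrite (memNset Ex); case: ifP => // _.
by rewrite phiE// mulr0.
Qed.

(** The constant is the mean over [E], which makes v - c a competitor in the infimum defining
    [lambda2N E], unless its norm vanishes and the inequality is trivial. *)
Lemma neumann_poincare_shift (D E : set 'rV[R]_n) (v : 'rV[R]_n -> R)
    (g : 'rV[R]_n -> 'rV[R]_n) (lam : R) :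
  open D -> open E -> E `<=` D -> (mu D < +oo)%E -> H1 D v g ->
  (lam%:E <= lambda2N E)%E -> exists c, lam * sqL2 E (fun x => v x - c) <=
    sqL2 E (fun x => enorm (g x)) /\ L2 E (fun x => v x - c).
Proof.
move=> oD oE ED Doo Hv lamE; have [Lv Lg wg] := Hv.
have mD := open_measurable_rV oD; have mE := open_measurable_rV oE.
have Eoo : (mu E < +oo)%E by apply: le_lt_trans Doo; rewrite le_measure ?inE.
have L2E u : L2 D u -> L2 E u by exact: L2_subset.
have L2c c : L2 E (fun x => v x - c) by apply: L2_subr => //; exact: L2E.
have main c : (\int[mu]_(x in E) (v x - c)%:E = 0)%E ->
    lam * sqL2 E (fun x => v x - c) <= sqL2 E (fun x => enorm (g x)).
  move=> int0; have [->|w0] := eqVneq (sqL2 E (fun x => v x - c)) 0.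
    by rewrite mulr0 sqL2_ge0.
  have wp : 0 < sqL2 E (fun x => v x - c) by rewrite lt0r w0 sqL2_ge0.
  rewrite -ler_pdivlMr// -lee_fin; apply: (le_trans lamE).
  apply: ereal_inf_lbound; exists (fun x => v x - c), g; split => //.
  split; [exact: L2c|by move=> i; apply: L2E; exact: Lg|].
  exact: (weak_gradient_shift c oD oE ED Doo Hv).
have iv : mu.-integrable E (EFin \o v).
  by apply: L2_integrable => //; exact: L2E.
have icst c : mu.-integrable E (EFin \o cst c).
  apply: measurable_bounded_integrable => //.
  by exists `|c|; split => [|M /ltW KM x _ /=]; [exact: num_real|].
(* On a null set there is no mean, but all integrals vanish and c = 0 serves. *)
have [mE0|mE0] := eqVneq (mu E) 0%E.
  exists 0; split; [apply: main|exact: L2c].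
  have i0 := L2_integrable mE Eoo (L2c 0).
  exact: (null_set_integral mE (measurable_int _ i0) mE0).
pose k := fine (\int[mu]_(x in E) (v x)%:E)%E / fine (mu E).
exists k; split; [apply: main|exact: L2c].
have mEE : mu E = (fine (mu E))%:E by rewrite fineK// ge0_fin_numE.
have m0 : fine (mu E) != 0 by apply: contra_neq mE0 => m0; rewrite mEE m0.
have -> : (\int[mu]_(x in E) (v x - k)%:E =
    \int[mu]_(x in E) (EFin \o v) x - \int[mu]_(x in E) (EFin \o cst k) x)%E.
  rewrite -(integralB mE iv (icst k)).
  by apply: eq_integral => x _ /=; rewrite EFinB.
have -> : (\int[mu]_(x in E) (EFin \o cst k) x = k%:E * mu E)%E.
  by rewrite -(integral_cst mu mE k%:E).
have fv := integrable_fin_num mE iv.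
by rewrite mEE -EFinM divfK// fineK// subee.
Qed.

End test_functions.

(** * Well-covered domains *)

(** The density is real on [D], so an essential infimum +oo would force [D] to be a null set. *)
Lemma beta_inf_lty (R : realType) n (D : set 'rV[R]_n) (F : foliation R n) :
  measurable D -> (0 < lebesgue_rV n D)%E -> (beta_inf F D < +oo)%E.
Proof.
move=> mD; rewrite ltey => D0; apply/eqP => /ess_inf_eqyP [A [mA A0 sA]].
move: D0; rewrite lt0e => /andP[/negP D0 _]; apply: D0.
rewrite eq_le measure_ge0 andbT -A0 le_measure ?inE// => x Dx.
by apply: sA => /=; rewrite /patch mem_set.
Qed.

Section well_covered.
Context {R : realType} {n : nat}.
Local Notation mu := (@lebesgue_rV R n).

Lemma foliated_poincare (D : set 'rV[R]_n) (F : foliation R n) (r b I eta lam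
  : R)
    (v : 'rV[R]_n -> R) (g : 'rV[R]_n -> 'rV[R]_n) :
  foliated_with D F r -> (mu D < +oo)%E ->
  0 < b -> (b%:E <= beta_inf F D)%E -> 0 <= I -> (I_beta F D <= I%:E)%E ->
  0 < eta -> 0 <= len_bound F ->
  0 < lam -> (lam%:E <= lambda2N (initial_part F r))%E ->
  H1 D v g -> (\int[mu]_(x in D) (v x)%:E = 0)%E ->
  sqL2 D v <= ((1 + I * (1 + eta) / (r * b)) / lam
               + (1 + eta^-1) * len_bound F * I / b) * sqL2 D (fun x =>
                 enorm (g x)).
Proof.
move=> [[oD _] fD r0 rF [[oE _] _]] Doo b0 bF I0 IF eta0 L0 lam0 lamE Hv v0.
have mD := open_measurable_rV oD; have mE := open_measurable_rV oE.
set E := initial_part F r in oE mE lamE *.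
have ED : E `<=` D := initial_part_sub fD rF.
have [c [Hc LEc]] := neumann_poincare_shift oD oE ED Doo Hv lamE.
have [Lv Lg wg] := Hv.
have Lgn := L2_enorm mD Lg.
have Lc := L2_subr c mD Doo Lv.
have := foliated_inequality oD fD c r0 rF b0 bF I0 IF eta0 L0 Doo Hv mE.
set c1 := 1 + I * (1 + eta) / (r * b).
set c2 := (1 + eta^-1) * len_bound F * I / b.
have c10 : 0 <= c1.
  by rewrite addr_ge0// divr_ge0 ?mulr_ge0 ?addr_ge0// ltW.
have c20 : 0 <= c2.
  by rewrite divr_ge0 ?mulr_ge0 ?addr_ge0 ?invr_ge0// ltW.
have <- : ((c1 * sqL2 E (fun x => v x - c) + c2 * sqL2 D (fun x =>
  enorm (g x)))%:E =
  \int[mu]_(x in D) (c1 * (\1_E x * (v x - c) ^+ 2) + c2 * enorm (g x) ^+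
    2)%:E)%E.
  under eq_integral do rewrite EFinD !EFinM.
  have mc : measurable_fun D (fun x => (\1_E x)%:E * ((v x - c) ^+ 2)%:E)%E.
    apply/measurable_EFinP; apply: measurable_funM => //.
    by apply: measurable_funX; case: Lc.
  have mg : measurable_fun D (fun x => (enorm (g x) ^+ 2)%:E).
    by apply/measurable_EFinP; apply: measurable_funX; case: Lgn.
  have p x : D x -> (0 <= (\1_E x)%:E * ((v x - c) ^+ 2)%:E)%E.
    by move=> _; rewrite -EFinM lee_fin mulr_ge0// sqr_ge0.
  have q x : D x -> (0 <= (enorm (g x) ^+ 2)%:E)%E by rewrite lee_fin sqr_ge0.
  rewrite ge0_integralD//; last 4 first.
  - by move=> x Dx; apply: mule_ge0; [rewrite lee_fin|exact: p].
  - exact: measurable_funeM.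
  - by move=> x Dx; apply: mule_ge0; [rewrite lee_fin|exact: q].
  - exact: measurable_funeM.
  rewrite !ge0_integralZl//; try by rewrite lee_fin.
  rewrite (sqL2E Lgn) EFinD !EFinM -(sqL2E LEc); congr (_ * _ + _)%E.
  rewrite [LHS]integral_mkcond [RHS]integral_mkcond; apply: eq_integral => x _.
  rewrite !patchE indicE; case: ifPn => xE.
    by rewrite mem_set ?mul1e//; apply: ED; exact: set_mem.
  by case: ifP => // _; rewrite mul0e.
rewrite sqL2E// lee_fin => H.
apply: le_trans (sqL2_mean0_le c mD Doo Lv v0) _; apply: le_trans H _.
rewrite [leRHS]mulrDl lerD2r -(mulrA c1); apply: ler_wpM2l => //.
rewrite -ler_pdivrMl ?invr_gt0// invrK.
by apply: le_trans Hc _; exact: le_sqL2.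
Qed.

(** The bracket of [C1] as a function of the lower density bound, isolated to express its
    monotonicity. *)
Definition C1_denominator (W : covering R n) (b : R) : R :=
  (c_E W)^-1 * c_r_p W ^+ 2 *
     (1 + (c_r_p W + Num.sqrt (c_E W * c_L_p W * c_r_m W)) / (c_r_p W * b)
            * (c_I_p W / c_r_m W))
   + (1 + c_r_p W / Num.sqrt (c_E W * c_L_p W * c_r_m W)) / b
       * c_L_p W * c_I_p W.

Variable W : covering R n.
Hypothesis W_gt0 : constants_gt0 W.
Hypothesis c_E_gt0 : 0 < c_E W.

Let s := Num.sqrt (c_E W * c_L_p W * c_r_m W).

Let s_gt0 : 0 < s.
Proof. by case: W_gt0 => -[? ?] [? ?] _ _ _; rewrite sqrtr_gt0 !mulr_gt0. Qed.

Lemma C1_denominator_gt0 b : 0 <= b -> 0 < C1_denominator W b.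
Proof.
move=> b0; case: W_gt0 => -[r1 r2] [L1 L2] [I1 I2] _ _.
rewrite /C1_denominator -/s ltr_pwDl//.
  rewrite !mulr_gt0 ?invr_gt0 ?exprn_gt0//.
  by rewrite ltr_pwDl// !mulr_ge0 ?invr_ge0 ?mulr_ge0 ?addr_ge0// ltW.
by rewrite !mulr_ge0 ?invr_ge0 ?addr_ge0 ?divr_ge0// ltW.
Qed.

(** The comparison is between inverses so as to cover b = 0, the value taken when the index set is
    empty, where b^-1 = 0. *)
Lemma le_C1_denominator b b' : 0 <= b -> 0 < b' -> b^-1 <= b'^-1 ->
  C1_denominator W b <= C1_denominator W b'.
Proof.
move=> b0 b'0 bb'; case: W_gt0 => -[r1 r2] [L1 L2] [I1 I2] _ _.
rewrite /C1_denominator -/s lerD//.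
  rewrite ler_wpM2l ?mulr_ge0 ?invr_ge0 ?sqr_ge0 ?(ltW c_E_gt0) ?(ltW r2)//.
  rewrite lerD2l ler_wpM2r ?divr_ge0 ?(ltW I2) ?(ltW r1)// !invfM.
  by rewrite !ler_wpM2l ?addr_ge0 ?invr_ge0 ?(ltW r2) ?(ltW s_gt0).
rewrite -!mulrA ler_wpM2l ?addr_ge0 ?mulr_ge0 ?invr_ge0 ?(ltW s_gt0) ?(ltW
  r2)//.
by rewrite ler_wpM2r// mulr_ge0 ?(ltW L2) ?(ltW I2).
Qed.

(** The left side is the constant of [foliated_poincare] with eta = s / c_r^+, I = c_I^+ e and lam =
    c_E / r^2. Once r^2, e / r and l are isolated, they are bounded by (c_r^+ e)^2, 1 / c_r^- and
    c_L^+ e. *)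
Lemma scaling_bound e r l b : 0 < e -> 0 < b -> c_r_m W * e < r ->
  r < c_r_p W * e ->
  0 <= l -> l < c_L_p W * e ->
  (1 + c_I_p W * e * (1 + s / c_r_p W) / (r * b)) / (c_E W * r ^- 2)
    + (1 + (s / c_r_p W)^-1) * l * (c_I_p W * e) / b
  <= e ^+ 2 * C1_denominator W b.
Proof.
move=> e0 b0 rm rp l0 lp; case: W_gt0 => -[r1 r2] [L1 L2] [I1 I2] _ _.
have r0 : 0 < r by apply: le_lt_trans rm; rewrite mulr_ge0 ?(ltW r1) ?(ltW e0).
rewrite /C1_denominator -/s [leRHS]mulrDr lerD//.
  rewrite [leLHS](_ : _ = (c_E W)^-1 * r ^+ 2 *
    (1 + (c_r_p W + s) / (c_r_p W * b) * (c_I_p W * (e / r)))); last first.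
    by field; rewrite !lt0r_neq0.
  rewrite [leRHS](_ : _ = (c_E W)^-1 * (c_r_p W * e) ^+ 2 *
    (1 + (c_r_p W + s) / (c_r_p W * b) * (c_I_p W / c_r_m W))); last first.
    by field; rewrite !lt0r_neq0.
  have A0 : 0 <= (c_r_p W + s) / (c_r_p W * b).
    by rewrite divr_ge0 ?addr_ge0 ?mulr_ge0// ltW.
  apply: ler_pM.
  - by rewrite mulr_ge0 ?invr_ge0 ?sqr_ge0 ?(ltW c_E_gt0).
  - by rewrite addr_ge0// mulr_ge0// mulr_ge0 ?divr_ge0 ?(ltW I2) ?(ltW e0)
    ?(ltW r0).
  - rewrite ler_wpM2l ?invr_ge0 ?(ltW c_E_gt0)//.
    by rewrite ler_sqr ?nnegrE ?(ltW rp) ?(ltW r0)// mulr_ge0 ?(ltW r2) ?(ltW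
      e0).
  rewrite lerD2l ler_wpM2l// ler_wpM2l ?(ltW I2)//.
  by rewrite ler_pdivrMr// mulrC ler_pdivlMr// mulrC ltW.
rewrite invf_div [leLHS](_ : _ = (1 + c_r_p W / s) / b * c_I_p W * e * l);
  last first.
  by field; rewrite !lt0r_neq0.
rewrite [leRHS](_ : _ = (1 + c_r_p W / s) / b * c_I_p W * e * (c_L_p W * e));
  last first.
  by field; rewrite !lt0r_neq0.
rewrite ler_wpM2l ?(ltW lp)//.
by rewrite !mulr_ge0 ?invr_ge0 ?addr_ge0 ?divr_ge0// ltW.
Qed.

End well_covered.

Theorem corollary3p6 (R : realType) (n : nat) (n_gt0 : (0 < n)%N)
    (Omega : set 'rV[R]_n) (W : covering R n)
    (domOmega : is_domain Omega) (bndOmega : bounded_set Omega)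
    (covOmega : well_covered_by Omega W) :
  (0 < ereal_inf [set (C1 W e)%:E | e in `]0%R, eps0 W]])%E /\
  forall (e : R), e \in `]0, eps0 W] -> forall i : idx W e,
    ((C1 W e * e ^- 2)%:E <= lambda2N (piece i))%E.
Proof.
case: covOmega => eps_gt0 cov _ [W_gt0 geom] [binf cE0 lamE].
set B := ereal_inf _ in binf.
have BW e (i : idx W e) : e \in `]0, eps0 W] -> (B <= piece_beta_inf i)%E.
  by move=> ee; apply: ereal_inf_lbound; exists e => //; exists i.
(* [B] may be +oo, for instance when all index sets are empty; any positive real then works. *)
have [b0 b0_gt0 b0B] : exists2 b0, 0 < b0 & (b0%:E <= B)%E.
  case: B binf {BW} => [x x0|_|//]; last by exists 1; rewrite ?leey.
  by exists x.
pose binf_at e := ereal_inf [set piece_beta_inf i | i in [set: idx W e]].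
have Bb e : e \in `]0, eps0 W] -> (b0%:E <= binf_at e)%E.
  move=> ee; apply: le_ereal_inf_tmp => _ [i _ <-].
  exact: le_trans b0B (BW _ _ ee).
have C1E e : C1 W e = (C1_denominator W (fine (binf_at e)))^-1 by [].
(* For an empty index set the infimum is +oo, which [fine] sends to 0, and 0^-1 = 0 still lies below
   b0^-1. *)
have b_ge0 e : e \in `]0, eps0 W] ->
    0 <= fine (binf_at e) /\ (fine (binf_at e))^-1 <= b0^-1.
  move=> /Bb; case: (binf_at e) => [x|_|//] /=; last first.
    by rewrite invr0 invr_ge0 (ltW b0_gt0).
  rewrite lee_fin => bx; have x0 := lt_le_trans b0_gt0 bx.
  by rewrite (ltW x0) lef_pV2.
split.
  apply: (@lt_le_trans _ _ (C1_denominator W b0)^-1%:E).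
    by rewrite lte_fin invr_gt0 C1_denominator_gt0// ltW.
  apply: le_ereal_inf_tmp => _ [e ee <-]; have [bge ble] := b_ge0 e ee.
  rewrite lee_fin C1E lef_pV2 ?posrE ?C1_denominator_gt0 ?(ltW b0_gt0)//.
  exact: le_C1_denominator.
move=> e ee i; have [_ /(_ i) fw _ _] := cov e ee.
have e0 : 0 < e by move: ee; rewrite in_itv/= => /andP[].
have scale (x : \bar R) (t cm cp : R) : 0 < t -> scaled_in x t cm cp ->
    ((cm * t)%:E < x /\ x < (cp * t)%:E)%E.
  by move=> t0 /andP[]; rewrite lte_pdivlMr// lte_pdivrMr// !EFinM.
have [/(scale _ _ _ _ e0)[rm rp] /(scale _ _ _ _ e0)[Lm Lp]
  /(scale _ _ _ _ e0)[_ Ip] _ /(scale _ _ _ _ (exprn_gt0 n e0))[Vm Vp]] :=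
    geom e ee i.
rewrite !lte_fin in rm rp Lm Lp.
have [_ [Lm0 _] [_ I0] _ [V0 _]] := W_gt0.
have Doo : (lebesgue_rV n (piece i) < +oo)%E by apply: lt_trans Vp _;
  rewrite ltry.
have D0 : (0 < lebesgue_rV n (piece i))%E.
  by apply: lt_trans Vm; rewrite lte_fin mulr_gt0// exprn_gt0.
have [[oD _] fD r0 _ _] := fw.
have bi : (binf_at e <= piece_beta_inf i)%E by apply: ereal_inf_lbound;
  exists i.
(* Once a piece exists the infimum is finite, since the volume of that piece is positive. *)
have bfin : binf_at e \is a fin_num.
  rewrite fin_real// (lt_le_trans _ (Bb e ee)) ?ltNyr//=;
    apply: le_lt_trans bi _.
  exact: beta_inf_lty (open_measurable_rV oD) D0.
have b_gt0 : 0 < fine (binf_at e).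
  by rewrite -lte_fin fineK//; apply: lt_le_trans (Bb e ee); rewrite lte_fin.
have L0 : 0 <= len_bound (fol i).
  by apply: ltW; apply: lt_trans Lm; rewrite mulr_gt0.
have c_r0 : 0 < c_r_p W by case: W_gt0 => -[].
have s_gt0 : 0 < Num.sqrt (c_E W * c_L_p W * c_r_m W).
  by case: W_gt0 => -[? ?] [? ?] _ _ _; rewrite sqrtr_gt0 !mulr_gt0.
have lam0 : 0 < c_E W * Defs.rad i ^- 2
  by rewrite mulr_gt0// invr_gt0 exprn_gt0.
apply: le_ereal_inf_tmp => _ [v [g [Hv sv v0 ->]]].
have sv0 : 0 < sqL2 (piece i) v by rewrite lt0r sv sqL2_ge0.
rewrite lee_fin C1E ler_pdivlMr// -mulrA mulrC ler_pdivrMr; last first.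
  by rewrite C1_denominator_gt0// ltW.
rewrite ler_pdivrMl ?exprn_gt0// mulrCA mulrC.
have := foliated_poincare fw Doo b_gt0 _ (ltW (mulr_gt0 I0 e0)) (ltW Ip)
  (divr_gt0 s_gt0 c_r0) L0 lam0 (lamE e ee i) Hv v0.
rewrite fineK// => /(_ bi) H; apply: le_trans H _.
rewrite ler_wpM2r ?sqL2_ge0//.
exact: scaling_bound.
Qed.
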